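(* Let $\alpha=2$. For every admissible $\varepsilon$, let $\varphi_\varepsilon$ be the unique solution of the rescaled problem (given in the context) with $\alpha=2$. Define $$\varphi_1(x_1,x_2,y)=\begin{cases}x_2-l_1,& y\in\omega^a,\\ 0,& y\in]0,1[\setminus\omega^a,\end{cases}\quad (x_1,x_2,y)\in\Omega^{c,1}\times]0,1[,$$ $$\varphi_3(x_1,x_2,y)=\begin{cases}x_2+1-l_2,& y\in\omega^b,\\ 1,& y\in]0,1[\setminus\omega^b,\end{cases}\quad (x_1,x_2,y)\in\Omega^{c,3}\times]0,1[,$$ $$\varphi_2(y)=\begin{cases}\frac{y+1-\zeta_4}{\zeta_1-\zeta_4+1},& y\in[0,\zeta_1],\\ 1,& y\in[\zeta_1,\zeta_2],\\ \frac{y-\zeta_3}{\zeta_2-\zeta_3},& y\in[\zeta_2,\zeta_3],\\ 0,& y\in[\zeta_3,\zeta_4],\\ \frac{y-\zeta_4}{\zeta_1-\zeta_4+1},& y\in[\zeta_4,1].\end{cases}$$ Then $$\lim_{\varepsilon\to0}\int_{\Omega^{c,1}_\varepsilon}\left(\left|\varepsilon^2\partial_{x_1}\varphi_\varepsilon\right|^2+\left|\partial_{x_2}\varphi_\varepsilon(x)-(\partial_{x_2}\varphi_1)\left(\frac{x_1}\varepsilon\right)\right|^2\right)dx=0,$$ $$\lim_{\varepsilon\to0}\int_{\Omega^{c,3}_\varepsilon}\left(\left|\varepsilon^2\partial_{x_1}\varphi_\varepsilon\right|^2+\left|\partial_{x_2}\varphi_\varepsilon(x)-(\partial_{x_2}\varphi_3)\left(\frac{x_1}\varepsilon\right)\right|^2\right)dx=0,$$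 $$\lim_{\varepsilon\to0}\int_{\Omega^{c,2}_\varepsilon}\left(\left|\varepsilon\partial_{x_1}\varphi_\varepsilon(x)-(\partial_y\varphi_2)\left(\frac{x_1}\varepsilon\right)\right|^2+\left|\varepsilon\partial_{x_2}\varphi_\varepsilon(x)\right|^2\right)dx=0.$$
   Context: Notation: $]a,b[$ is the open interval. Fix $0<\zeta_1<\zeta_2<\zeta_3<\zeta_4<1$, $\omega^a=]\zeta_1,\zeta_2[$, $\omega^b=]\zeta_3,\zeta_4[$. Fix $L>0$ and $l_1,l_2,l_3>0$ with $l_1+2<l_2<l_3$. The parameter $\varepsilon$ is admissible if $\varepsilon\in\{L/n:n\in\mathbb N\}$ and $\varepsilon<1$. Set $$\Omega^a_{\varepsilon}=\left(]0,L[\times]l_2,l_3[\right)\cup\bigcup_{k=0}^{L/\varepsilon-1}(\varepsilon\omega^a+\varepsilon k)\times]l_1+1,l_2],\quad \Omega^b_{\varepsilon}=\left(]0,L[\times]0,l_1[\right)\cup\bigcup_{k=0}^{L/\varepsilon-1}(\varepsilon\omega^b+\varepsilon k)\times[l_1,l_2-1[,$$ $\Omega^c_\varepsilon=(]0,L[\times]0,l_3[)\setminus(\overline{\Omega^a_\varepsilon}\cup\overline{\Omega^b_\varepsilon})$, $\Gamma^a_\varepsilon=\partial\Omega^a_\varepsilon\cap\partial\Omega^c_\varepsilon$, $\Gamma^b_\varepsilon=\partial\Omega^b_\varepsilon\cap\partial\Omega^c_\varepsilon$, $\Omega^{c,1}_\varepsilon=\Omega^c_\varepsilon\cap(]0,L[\times]l_1,l_1+1[)$,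 $\Omega^{c,2}_\varepsilon=\Omega^c_\varepsilon\cap(]0,L[\times[l_1+1,l_2-1])$, $\Omega^{c,3}_\varepsilon=\Omega^c_\varepsilon\cap(]0,L[\times]l_2-1,l_2[)$; $\Omega^{c,1}=]0,L[\times]l_1,l_1+1[$, $\Omega^{c,2}=]0,L[\times]l_1+1,l_2-1[$, $\Omega^{c,3}=]0,L[\times]l_2-1,l_2[$. Rescaled problem with parameter $\alpha\ge0$: with $D_\varepsilon=\frac{l_2-l_1-2\varepsilon^\alpha}{l_2-l_1-2}$, find $\varphi_\varepsilon\in H^1(\Omega^c_\varepsilon)$ with $\varphi_\varepsilon=1$ on $\Gamma^a_\varepsilon$, $\varphi_\varepsilon=0$ on $\Gamma^b_\varepsilon$ (traces), such that $$\int_{\Omega^{c,1}_\varepsilon\cup\Omega^{c,3}_\varepsilon}\left(\varepsilon^\alpha\partial_{x_1}\varphi_\varepsilon\partial_{x_1}\psi+\varepsilon^{-\alpha}\partial_{x_2}\varphi_\varepsilon\partial_{x_2}\psi\right)dx+\int_{\Omega^{c,2}_\varepsilon}\left(D_\varepsilon\partial_{x_1}\varphi_\varepsilon\partial_{x_1}\psi+D_\varepsilon^{-1}\partial_{x_2}\varphi_\varepsilon\partial_{x_2}\psi\right)dx=0$$ for all $\psi\in H^1(\Omega^c_\varepsilon)$ with $\psi=0$ on $\Gamma^a_\varepsilon\cup\Gamma^b_\varepsilon$. The functions $\partial_{x_2}\varphi_1$ and $\partial_{x_2}\varphi_3$ depend only on $y$ (they are the characteristic functions of $\omega^a$ and $\omega^b$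 respectively); these and $\partial_y\varphi_2$ are extended $1$-periodically in $y\in\mathbb R$ and evaluated at $y=x_1/\varepsilon$. *)

(* Defs.v *)
From HB Require Import structures.
From mathcomp Require Import all_boot all_order all_algebra.
From mathcomp Require Import all_classical all_reals all_analysis.

Set Implicit Arguments.
Unset Strict Implicit.
Unset Printing Implicit Defensive.

Import Order.TTheory GRing.Theory Num.Theory.
Import numFieldNormedType.Exports.

Local Open Scope classical_set_scope.
Local Open Scope ring_scope.

Section PlaneCalculus.
Context {R : realType}.
Implicit Types (O Gamma : set (R * R)) (f g : R * R -> R).

Definition lebesgue2 := ((@lebesgue_measure R) \x (@lebesgue_measure R))%E.

Definition partial1 f : R * R -> R := fun x => 'D_(1, 0) f x.
Definition partial2 f : R * R -> R := fun x => 'D_(0, 1) f x.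

Fixpoint Ck (k : nat) f : Prop :=
  if k is k'.+1 then
    [/\ continuous f,
        forall x, derivable f x (1, 0) /\ derivable f x (0, 1),
        Ck k' (partial1 f) &
        Ck k' (partial2 f)]
  else continuous f.

Definition test_function O f : Prop :=
  (forall k, Ck k f) /\
  exists K, [/\ compact K, K `<=` O & forall x, ~ K x -> f x = 0].

Definition L2 O f : Prop :=
  measurable_fun O f /\
  (\int[lebesgue2]_(x in O) (`|f x| ^+ 2)%:E < +oo)%E.

Definition weak_derivative O (D : (R * R -> R) -> R * R -> R) f g : Prop :=
  forall eta, test_function O eta ->
    \int[lebesgue2]_(x in O) (f x * D eta x) =
    - \int[lebesgue2]_(x in O) (g x * eta x).

(* An element of the Sobolev space H^1(O) is given by representatives of the
   function and of its two weak partial derivatives; the latter are determined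
   almost everywhere in O by the former. *)
Record H1 O := MkH1 {
  H1_fun :> R * R -> R;
  dx1 : R * R -> R;
  dx2 : R * R -> R;
  H1_L2 : L2 O H1_fun;
  dx1_L2 : L2 O dx1;
  dx2_L2 : L2 O dx2;
  dx1_weak : weak_derivative O partial1 H1_fun dx1;
  dx2_weak : weak_derivative O partial2 H1_fun dx2
}.

(* Integral of a nonnegative function over Gamma with respect to arc length,
   when Gamma lies on finitely many horizontal and vertical lines; only those
   lines contribute to the two sums. *)
Definition arc_integral Gamma (f : R * R -> \bar R) : \bar R :=
  (\esum_(c in setT)
     \int[lebesgue_measure]_(t in [set t | Gamma (t, c)]) f (t, c) +
   \esum_(c in setT)
     \int[lebesgue_measure]_(t in [set t | Gamma (c, t)]) f (c, t))%E.

(* u = g on Gamma in the sense of traces, for O a bounded Lipschitz domain and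
   Gamma a part of its boundary to which arc_integral applies. The trace
   operator is the continuous extension from C^1(closure O) to H^1(O) of the
   restriction to the boundary, so its graph is the closure, in
   H^1(O) x L^2(Gamma), of the graph of the restriction. *)
Definition trace_eq O Gamma (u : H1 O) g : Prop :=
  exists v : nat -> R * R -> R,
    [/\ forall n, Ck 1 (v n),
        (\int[lebesgue2]_(x in O)
           (`|v n x - u x| ^+ 2 + `|partial1 (v n) x - dx1 u x| ^+ 2 +
            `|partial2 (v n) x - dx2 u x| ^+ 2)%:E)%E @[n --> \oo] --> 0%E &
        arc_integral Gamma (fun x => (`|v n x - g x| ^+ 2)%:E)
           @[n --> \oo] --> 0%E].

Definition boundary O : set (R * R) := closure O `\` interior O.

Definition periodic_ext (f : R -> R) : R -> R :=
  fun t => f (t - (Num.floor t)%:~R).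

End PlaneCalculus.

Record comb_params (R : realType) := CombParams {
  zeta1 : R; zeta2 : R; zeta3 : R; zeta4 : R;
  L : R;
  l1 : R; l2 : R; l3 : R
}.

Section Combs.
Context {R : realType}.
Variable p : comb_params R.
Local Notation zeta1 := (zeta1 p).
Local Notation zeta2 := (zeta2 p).
Local Notation zeta3 := (zeta3 p).
Local Notation zeta4 := (zeta4 p).
Local Notation L := (L p).
Local Notation l1 := (l1 p).
Local Notation l2 := (l2 p).
Local Notation l3 := (l3 p).

Definition admissible : set R :=
  [set e | (exists2 n : nat, (0 < n)%N & e = L / n%:R) /\ e < 1].

Definition omega_a : set R := `]zeta1, zeta2[.
Definition omega_b : set R := `]zeta3, zeta4[.

Definition cell (e : R) (omega : set R) (k : nat) : set R :=
  [set e * y + e * k%:R | y in omega].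

Definition Omega_a (e : R) : set (R * R) :=
  (`]0, L[ `*` `]l2, l3[) `|`
  \bigcup_(k in [set k : nat | k%:R <= L / e - 1])
     (cell e omega_a k `*` `]l1 + 1, l2]).

Definition Omega_b (e : R) : set (R * R) :=
  (`]0, L[ `*` `]0, l1[) `|`
  \bigcup_(k in [set k : nat | k%:R <= L / e - 1])
     (cell e omega_b k `*` `[l1, l2 - 1[).

Definition Omega_c (e : R) : set (R * R) :=
  (`]0, L[ `*` `]0, l3[) `\` (closure (Omega_a e) `|` closure (Omega_b e)).

Definition Gamma_a (e : R) := boundary (Omega_a e) `&` boundary (Omega_c e).
Definition Gamma_b (e : R) := boundary (Omega_b e) `&` boundary (Omega_c e).

Definition Omega_c1 (e : R) := Omega_c e `&` (`]0, L[ `*` `]l1, l1 + 1[).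
Definition Omega_c2 (e : R) := Omega_c e `&` (`]0, L[ `*` `[l1 + 1, l2 - 1]).
Definition Omega_c3 (e : R) := Omega_c e `&` (`]0, L[ `*` `]l2 - 1, l2[).

Definition Dcoef (alpha e : R) : R :=
  (l2 - l1 - 2 * e `^ alpha) / (l2 - l1 - 2).

Definition solution (alpha e : R) (phi : H1 (Omega_c e)) : Prop :=
  [/\ trace_eq (Gamma_a e) phi (cst 1),
      trace_eq (Gamma_b e) phi (cst 0) &
      forall psi : H1 (Omega_c e),
        trace_eq (Gamma_a e) psi (cst 0) ->
        trace_eq (Gamma_b e) psi (cst 0) ->
        \int[lebesgue2]_(x in Omega_c1 e `|` Omega_c3 e)
           (e `^ alpha * dx1 phi x * dx1 psi x +
            e `^ (- alpha) * dx2 phi x * dx2 psi x) +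
        \int[lebesgue2]_(x in Omega_c2 e)
           (Dcoef alpha e * dx1 phi x * dx1 psi x +
            (Dcoef alpha e)^-1 * dx2 phi x * dx2 psi x) = 0].

Definition phi1 (x : R * R) (y : R) : R :=
  if y \in omega_a then x.2 - l1 else 0.

Definition phi3 (x : R * R) (y : R) : R :=
  if y \in omega_b then x.2 + 1 - l2 else 1.

(* Only the values on [0, 1] matter; consecutive formulas agree at the common
   endpoints of the intervals. *)
Definition phi2 (y : R) : R :=
  if y <= zeta1 then (y + 1 - zeta4) / (zeta1 - zeta4 + 1)
  else if y <= zeta2 then 1
  else if y <= zeta3 then (y - zeta3) / (zeta2 - zeta3)
  else if y <= zeta4 then 0
  else (y - zeta4) / (zeta1 - zeta4 + 1).

End Combs.

(* Main.v *)
Require Import Defs.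
From mathcomp Require Import all_boot all_order all_algebra.
From mathcomp Require Import all_classical all_reals all_analysis.
From mathcomp Require Import measurable_realfun.
From mathcomp Require Import ring lra.
Import Order.TTheory GRing.Theory Num.Theory.
Import numFieldNormedType.Exports.
Local Open Scope classical_set_scope.
Local Open Scope ring_scope.

Set Implicit Arguments.
Unset Strict Implicit.
Unset Printing Implicit Defensive.

(** Why the theorem holds.

    Multiplied by e^2, the variational equation says that the rescaled gradient
    of the solution, (e^2 d1 phi, d2 phi) in the two outer layers and
    (e d1 phi, e d2 phi) in the middle zone, is orthogonal to the rescaled
    gradients of all test functions with zero traces, for the weights 1, 1 in
    the outer layers and D, 1/D in the middle zone ([scaled_equation]).  The
    limit field is orthogonal to them as well.  It is constant on rectangles:
    vertical and equal to 1 on the columns over omega_a (lower layer) and over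
    omega_b (upper layer), horizontal and equal to the slope of phi2 on the gaps
    between two fingers.  Each of these rectangles has one side on Gamma_a and
    the opposite side on Gamma_b, so that the derivative of a test function
    across it has integral zero ([flux_column_a], [flux_column_b],
    [flux_gap_ab], [flux_gap_ba]).  The only exceptions are the two half gaps
    next to x1 = 0 and x1 = L; there the limit field is replaced by 0, on a set
    of area O(e).

    By these two orthogonalities, among all functions with the traces of phi it
    is phi whose rescaled gradient is closest to the limit field
    ([energy_minimal]).  It is therefore enough to exhibit one function with
    these traces whose rescaled gradient is close to it.  The [competitor] is a
    C^1 function on the whole plane, equal to 1 on Omega_a and to 0 on Omega_b:
    it smooths phi1, phi2 and phi3 on the length h of the cell variable, and glues
    the three pieces in two horizontal layers of height e.  Its rescaled
    gradient agrees with the limit field up to O(e / h), except on finitely many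
    strips of total area O(h + e), where the error is bounded independently of
    e and h, and on the two gluing layers, of area O(e), where the error is
    O(1 / h) ([err_zone1], [err_zone2], [err_zone3]).  The squared distance is
    thus at most C (h + e / h^2) ([error_mass_le]), and is made small by the
    choice of h first and of e next.

    Zero traces enter as follows.  The condition on Gamma_a and the one on
    Gamma_b provide two unrelated sequences of C^1 functions, so that the
    fundamental theorem of calculus cannot be applied from one side of a
    rectangle to the opposite one.  Instead, d2 ((x2 - o) u) is integrated for
    an affine weight that vanishes on one side, which only involves the trace on
    the opposite side ([flux_ver], [flux_hor]); the difference of the two
    identities so obtained is the integral of d2 u ([H1_flux_zero2]). *)

(** * Measurability and square integrability *)

(** The product of two Borel lines under a name, so that a type annotation suffices to
    declare a set of pairs measurable. *)
Definition plane (R : realType) : measurableType _ :=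
  (measurableTypeR R * measurableTypeR R)%type.

Section PlaneMeasure.
Context {R : realType}.
Implicit Types (O : set (R * R)) (f g : R * R -> R).

Definition rect (a b c d : R) : set (R * R) := `]a, b[ `*` `]c, d[.

Lemma rectP a b c d (x : R * R) :
  rect a b c d x <-> [/\ a < x.1, x.1 < b, c < x.2 & x.2 < d].
Proof.
rewrite /rect /setX /= !in_itv /=; split; first by move=> [/andP[? ?] /andP[? ?]].
by move=> [-> -> -> ->].
Qed.

Lemma open_rect a b c d : open (rect a b c d).
Proof.
have -> : rect a b c d = (fst @^-1` `]a, b[) `&` (snd @^-1` `]c, d[) by [].
apply: openI; apply: open_comp => //; try exact: interval_open.
- by move=> x _; exact: cvg_fst.
- by move=> x _; exact: cvg_snd.
Qed.

Lemma open_plane_rect O x : open O -> O x ->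
  exists2 e : R, 0 < e & rect (x.1 - e) (x.1 + e) (x.2 - e) (x.2 + e) `<=` O.
Proof.
move=> oO Ox; have /nbhs_ballP[e /= e0 eO] := open_nbhs_nbhs (conj oO Ox).
exists e => // y /rectP[y1 y2 y3 y4]; apply: eO; split;
  rewrite /ball /= ltr_norml; apply/andP; split; lra.
Qed.

(** An open set is the union, over pairs of rationals p < q, of the products of
    ]p, q[ with the open set of the ordinates above which all of ]p, q[ stays
    inside. *)
Lemma open_measurable_plane O : open O -> measurable (O : set (plane R)).
Proof.
move=> oO.
pose V (p q : R) := \bigcup_(I in [set I : set R | open I /\ `]p, q[ `*` I `<=` O]) I.
have -> : O = \bigcup_p \bigcup_q (`]ratr p, ratr q[ `*` V (ratr p) (ratr q)).
  apply/seteqP; split => x.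
    move=> /(open_plane_rect oO) [e e0 eO].
    have /rat_in_itvoo[p] : x.1 - e < x.1 by lra.
    have /rat_in_itvoo[q] : x.1 < x.1 + e by lra.
    rewrite !in_itv /= => /andP[q1 q2] /andP[p1 p2].
    exists p => //; exists q => //; split; first by rewrite /= in_itv /= p2 q1.
    exists `]x.2 - e, x.2 + e[%classic; last by rewrite /= in_itv /=; lra.
    split; first exact: interval_open.
    move=> y [] /=; rewrite !in_itv /= => /andP[y1 y2] /andP[y3 y4].
    by apply: eO; apply/rectP; split; lra.
  move=> [p _ [q _ [xpq]]] [I [oI IO] Ix].
  by apply: IO; split.
apply: bigcupT_measurable_rat => p; apply: bigcupT_measurable_rat => q.
apply: measurableX; first exact: measurable_itv.
apply: open_measurable; apply: bigcup_open => I [] //.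
Qed.

Lemma continuous_measurable_plane f :
  continuous f -> measurable_fun [set: plane R] f.
Proof.
move=> /continuousP cf; apply: (measurability _ (RGenOpens.measurableE R)).
move=> _ [_ [a [b ->] <-]]; rewrite setTI; apply: open_measurable_plane.
exact/cf/interval_open.
Qed.

End PlaneMeasure.

Section SquareIntegrable.
Context d (T : measurableType d) (R : realType).
Variable mu : {measure set T -> \bar R}.
Implicit Types (D : set T) (f g : T -> R).

Definition sqint D f :=
  measurable_fun D f /\ (\int[mu]_(x in D) (`|f x| ^+ 2)%:E < +oo)%E.

(** Linearity of integrability for integrands of the form [EFin \o f], with the
    linear combinations formed in [R]. *)
Lemma integrable_addr D f g : measurable D ->
  mu.-integrable D (EFin \o f) -> mu.-integrable D (EFin \o g) ->
  mu.-integrable D (EFin \o (fun x => f x + g x)).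
Proof. by move=> mD fi gi; exact: (integrableD mD fi gi). Qed.

Lemma integrable_subr D f g : measurable D ->
  mu.-integrable D (EFin \o f) -> mu.-integrable D (EFin \o g) ->
  mu.-integrable D (EFin \o (fun x => f x - g x)).
Proof. by move=> mD fi gi; exact: (integrableB mD fi gi). Qed.

Lemma integrable_mulrl D f (k : R) : measurable D ->
  mu.-integrable D (EFin \o f) -> mu.-integrable D (EFin \o (fun x => k * f x)).
Proof. by move=> mD fi; exact: (integrableZl mD k fi). Qed.

Lemma sqint_integrable2 D f : measurable D -> sqint D f ->
  mu.-integrable D (EFin \o (fun x => f x ^+ 2)).
Proof.
move=> mD [mf fD]; apply/integrableP; split.
  by apply/measurable_EFinP; exact: measurable_funX.
apply: le_lt_trans fD; rewrite le_eqVlt; apply/orP; left; apply/eqP.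
by apply: eq_integral => x _ /=; rewrite normrX.
Qed.

Lemma integrable2_sqint D f : measurable D -> measurable_fun D f ->
  mu.-integrable D (EFin \o (fun x => f x ^+ 2)) -> sqint D f.
Proof.
move=> mD mf /integrableP[_ fD]; split=> //.
apply: le_lt_trans fD; rewrite le_eqVlt; apply/orP; left; apply/eqP.
by apply: eq_integral => x _ /=; rewrite normrX.
Qed.

Lemma sqint_integrableM D f g : measurable D -> sqint D f -> sqint D g ->
  mu.-integrable D (EFin \o (fun x => f x * g x)).
Proof.
move=> mD Lf Lg.
apply: (@le_integrable _ _ _ mu D _ _ (EFin \o (fun x => f x ^+ 2 + g x ^+ 2))) => //.
- by apply/measurable_EFinP; apply: measurable_funM; [case: Lf|case: Lg].
- move=> x Dx /=; rewrite lee_fin.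
  rewrite [leRHS]ger0_norm ?addr_ge0 ?sqr_ge0// ler_norml; apply/andP; split; nra.
- by apply: integrable_addr => //; exact: sqint_integrable2.
Qed.

Lemma sqintD D f g : measurable D -> sqint D f -> sqint D g ->
  sqint D (fun x => f x + g x).
Proof.
move=> mD Lf Lg; apply: integrable2_sqint => //.
  by apply: measurable_funD; [case: Lf|case: Lg].
rewrite (_ : _ \o _ = EFin \o
  (fun x => f x ^+ 2 + (f x * g x + (f x * g x + g x ^+ 2)))); last first.
  by apply/funext => x /=; congr EFin; ring.
by do 3 (apply: integrable_addr => //; first by
  first [exact: sqint_integrable2|exact: sqint_integrableM]); exact: sqint_integrable2.
Qed.

Lemma sqintM_bounded D f g (M : R) : measurable D -> sqint D f -> measurable_fun D g ->
  (forall x, D x -> `|g x| <= M) -> sqint D (fun x => g x * f x).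
Proof.
move=> mD Lf mg gM; apply: integrable2_sqint => //.
  by apply: measurable_funM => //; case: Lf.
apply: (@le_integrable _ _ _ mu D _ _ (EFin \o (fun x => M ^+ 2 * f x ^+ 2))) => //.
- apply/measurable_EFinP; apply: measurable_funX; apply: measurable_funM => //.
  by case: Lf.
- move=> x Dx /=; rewrite lee_fin exprMn ![`|_ * _|]normrM.
  have gM' : `|g x| <= `|M| by rewrite (le_trans (gM _ Dx))// ler_norm.
  by rewrite ler_wpM2r// ler_pM.
- by apply: integrable_mulrl => //; exact: sqint_integrable2.
Qed.

Lemma sqintZ D f (k : R) : measurable D -> sqint D f -> sqint D (fun x => k * f x).
Proof.
by move=> mD Lf; apply: (@sqintM_bounded D f (cst k) `|k|) => //=; exact: measurable_cst.
Qed.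

Lemma sqintB D f g : measurable D -> sqint D f -> sqint D g ->
  sqint D (fun x => f x - g x).
Proof.
move=> mD Lf Lg; apply: sqintD => //.
rewrite (_ : (fun x => - g x) = (fun x => -1 * g x)); first exact: sqintZ.
by apply/funext => x; rewrite mulN1r.
Qed.

Lemma sqintS D E f : measurable D -> measurable E -> E `<=` D -> sqint D f -> sqint E f.
Proof.
move=> mD mE ED Lf; apply: integrable2_sqint => //.
  by apply: measurable_funS ED _ => //; case: Lf.
by apply: (integrableS mD) => //; exact: sqint_integrable2.
Qed.

Lemma bounded_sqint D f (M : R) : measurable D -> (mu D < +oo)%E -> measurable_fun D f ->
  (forall x, D x -> `|f x| <= M) -> sqint D f.
Proof.
move=> mD Dfin mf fM; apply: integrable2_sqint => //.
apply: (@measurable_bounded_integrable _ _ _ mu) => //.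
  exact: measurable_funX.
exists (M ^+ 2); split; first exact: num_real.
move=> N MN x Dx /=; rewrite normrX; apply: ltW; apply: le_lt_trans MN.
by rewrite ler_sqr ?nnegrE ?fM ?(le_trans _ (fM _ Dx)).
Qed.

Lemma sqint_integrable D f : measurable D -> (mu D < +oo)%E -> sqint D f ->
  mu.-integrable D (EFin \o f).
Proof.
move=> mD Dfin Lf.
have -> : EFin \o f = EFin \o (fun x => f x * cst 1 x).
  by apply/funext => x /=; rewrite mulr1.
apply: sqint_integrableM => //.
by apply: (@bounded_sqint _ _ 1) => //= x _; rewrite normr1.
Qed.

End SquareIntegrable.

(** * Integration over rectangles *)

(** [lebesgue2] with its structure of measure, which the integration lemmas
    require. *)
Definition leb2 (R : realType) : {measure set (plane R) -> \bar R} :=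
  ((@lebesgue_measure R) \x (@lebesgue_measure R))%E.

Section RectangleCalculus.
Context {R : realType}.
Implicit Types (O : set (R * R)) (f g v : R * R -> R).
Notation mu := (@leb2 R).
Notation leb := (@lebesgue_measure R).

Lemma measurable_rect (a b c d : R) : measurable (rect a b c d : set (plane R)).
Proof. by apply: measurableX; exact: measurable_itv. Qed.

Lemma rect_measure (a b c d : R) : a <= b -> c <= d ->
  mu (rect a b c d) = ((b - a) * (d - c))%:E.
Proof.
move=> ab cd; rewrite /leb2 /= product_measure1E /=; try exact: measurable_itv.
have len (x y : R) : x <= y -> leb (`]x, y[%classic : set R) = (y - x)%:E.
  move=> xy; rewrite lebesgue_measure_itv /= lte_fin; case: ltP => // yx.
  by have -> : y = x; [lra|rewrite subrr].
by rewrite !len// -EFinM.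
Qed.

Definition box (a b c d : R) : set (R * R) := `[a, b] `*` `[c, d].

Lemma boxP a b c d (x : R * R) :
  box a b c d x <-> [/\ a <= x.1, x.1 <= b, c <= x.2 & x.2 <= d].
Proof.
rewrite /box /setX /= !in_itv /=; split; first by move=> [/andP[? ?] /andP[? ?]].
by move=> [-> -> -> ->].
Qed.

Lemma continuous_bounded_box f a b c d : continuous f ->
  exists M, forall x, box a b c d x -> `|f x| <= M.
Proof.
move=> cf.
have cK : compact (box a b c d) by apply: compact_setX; exact: segment_compact.
have /compact_bounded[M [_ fM]] : compact (f @` box a b c d).
  by apply: continuous_compact => //; exact: continuous_subspaceT.
exists (M + 1) => x Kx; apply: (fM (M + 1)); first by rewrite ltrDl.
by exists x.
Qed.

Lemma box_finite O a b c d : measurable (O : set (plane R)) ->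
  O `<=` box a b c d -> (mu O < +oo)%E.
Proof.
move=> mO Obox.
have sub : O `<=` rect (a - 1) (`|b| + `|a| + 1) (c - 1) (`|d| + `|c| + 1).
  move=> x /Obox /boxP[x1 x2 x3 x4]; apply/rectP.
  have := ler_norm b; have := ler_norm d; have := normr_ge0 a; have := normr_ge0 c.
  split; lra.
have /= := le_measure mu (mem_set mO) (mem_set (measurable_rect _ _ _ _)) sub.
move=> /le_lt_trans; apply; rewrite rect_measure ?ltry//.
- have := ler_norm a; have := normr_ge0 b; lra.
- have := ler_norm c; have := normr_ge0 d; lra.
Qed.

Lemma continuous_sqint O f a b c d : measurable (O : set (plane R)) ->
  O `<=` box a b c d -> continuous f -> sqint mu O f.
Proof.
move=> mO Obox cf; have [M fM] := continuous_bounded_box a b c d cf.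
apply: (@bounded_sqint _ _ _ _ _ _ M) => //.
- exact: box_finite Obox.
- exact: measurable_funS (continuous_measurable_plane cf).
- by move=> x /Obox; exact: fM.
Qed.

(** Difference quotients in a coordinate direction are those of a function of one
    variable, so that partial derivatives are derivatives along slices. *)
Lemma slice1 v (x y : R) : (fun h : R => h^-1 *: ((v \o shift (x, y)) (h *: (1, 0)) - v (x, y))) =
  (fun h : R => h^-1 *: (((fun t => v (t, y)) \o shift x) (h *: 1) - v (x, y))).
Proof.
apply/funext => h /=; congr (_ *: (v _ - _)).
by rewrite /shift /=; congr pair; rewrite /= scaler0 add0r.
Qed.

Lemma slice2 v (x y : R) : (fun h : R => h^-1 *: ((v \o shift (x, y)) (h *: (0, 1)) - v (x, y))) =
  (fun h : R => h^-1 *: (((fun t => v (x, t)) \o shift y) (h *: 1) - v (x, y))).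
Proof.
apply/funext => h /=; congr (_ *: (v _ - _)).
by rewrite /shift /=; congr pair; rewrite /= scaler0 add0r.
Qed.

Lemma derivable_slice1 v (x y : R) :
  derivable v (x, y) (1, 0) = derivable (fun t => v (t, y)) x 1.
Proof. by rewrite /derivable slice1. Qed.

Lemma derivable_slice2 v (x y : R) :
  derivable v (x, y) (0, 1) = derivable (fun t => v (x, t)) y 1.
Proof. by rewrite /derivable slice2. Qed.

Lemma partial1_slice v (x y : R) :
  partial1 v (x, y) = (fun t => v (t, y))^`()%classic x.
Proof. by rewrite derive1E /partial1 /derive slice1. Qed.

Lemma partial2_slice v (x y : R) :
  partial2 v (x, y) = (fun t => v (x, t))^`()%classic y.
Proof. by rewrite derive1E /partial2 /derive slice2. Qed.

Lemma continuous_pairl (y : R) : continuous (fun t : R => (t, y)).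
Proof.
move=> t; apply: (@cvg_pair _ _ _ (nbhs t) (nbhs t) (nbhs y)) => //; exact: cvg_cst.
Qed.

Lemma continuous_pairr (x : R) : continuous (fun t : R => (x, t)).
Proof.
move=> t; apply: (@cvg_pair _ _ _ (nbhs t) (nbhs x) (nbhs t)) => //; exact: cvg_cst.
Qed.

Lemma FTC_oo (F f : R -> R) (a b : R) : a < b -> continuous f ->
  (forall x, derivable F x 1) -> F^`()%classic =1 f ->
  (\int[leb]_(x in `]a, b[) (f x)%:E = (F b - F a)%:E)%E.
Proof.
move=> ab cf dF Ff.
have mf : measurable_fun setT (EFin \o f).
  by apply/measurable_EFinP; exact: continuous_measurable_fun.
rewrite integral_itv_obnd_cbnd; last by apply: measurable_funS mf.
rewrite integral_itv_bndo_bndc; last by apply: measurable_funS mf.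
rewrite EFinB; apply: continuous_FTC2 => //.
- exact: continuous_subspaceT.
- have cF x : F @ x --> F x.
    by apply: differentiable_continuous; apply/derivable1_diffP.
  split.
  + by move=> x _.
  + exact: cvg_at_right_filter.
  + exact: cvg_at_left_filter.
Qed.

Lemma restrict_rect f (a b c d x y : R) :
  (EFin \o (f \_ (rect a b c d))) (x, y) =
  ((fun t => ((fun s => (f (t, s))%:E) \_ `]c, d[) y) \_ `]a, b[) x.
Proof.
rewrite /= !patchE.
have -> : ((x, y) \in rect a b c d) = (x \in `]a, b[%classic) && (y \in `]c, d[%classic).
  by apply/idP/andP; rewrite !inE => -[].
by case: (x \in _); case: (y \in _).
Qed.

(** The integrand is cut off to the rectangle first: the Fubini theorem on the whole
    plane then applies, because a continuous function is bounded there. *)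
Lemma int_rect f (a b c d : R) : continuous f ->
  (\int[mu]_(x in rect a b c d) (f x)%:E =
   \int[leb]_(x in `]a, b[) \int[leb]_(y in `]c, d[) (f (x, y))%:E)%E /\
  (\int[mu]_(x in rect a b c d) (f x)%:E =
   \int[leb]_(y in `]c, d[) \int[leb]_(x in `]a, b[) (f (x, y))%:E)%E.
Proof.
move=> cf.
have mQ := measurable_rect a b c d.
have fi : mu.-integrable setT (EFin \o (f \_ (rect a b c d))).
  rewrite -restrict_EFin; apply: (iffLR (integrable_mkcond _ mQ)).
  have Qbox : rect a b c d `<=` box a b c d.
    by move=> x /rectP[? ? ? ?]; apply/boxP; split; exact: ltW.
  by apply: sqint_integrable => //; [exact: box_finite Qbox|exact: continuous_sqint Qbox cf].
rewrite integral_mkcond restrict_EFin; split.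
- rewrite -(integral12_prod_meas1 fi) [RHS]integral_mkcond.
  apply: eq_integral => x _; rewrite /fubini_F.
  under eq_integral do rewrite restrict_rect.
  rewrite patchE; case: ifPn => xab; last first.
    by under eq_integral do rewrite patchE (negbTE xab); rewrite integral0.
  under eq_integral do rewrite patchE xab.
  by rewrite [RHS]integral_mkcond.
- rewrite -(integral21_prod_meas1 fi) [RHS]integral_mkcond.
  apply: eq_integral => y _; rewrite /fubini_G.
  under eq_integral do rewrite restrict_rect.
  rewrite patchE; case: ifPn => ycd; last first.
    under eq_integral => x _ do rewrite patchE [X in if _ then X else _]patchE (negbTE ycd) if_same.
    by rewrite integral0.
  rewrite [RHS]integral_mkcond; apply: eq_integral => x _.
  by rewrite !patchE ycd.
Qed.

Lemma int_rect_partial1 v a b c d : Ck 1 v -> a < b ->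
  \int[mu]_(x in rect a b c d) partial1 v x =
  \int[leb]_(y in `]c, d[) (v (b, y) - v (a, y)).
Proof.
move=> [cv dv c1 c2] ab; rewrite /Rintegral; congr fine.
rewrite (int_rect _ _ _ _ c1).2; apply: eq_integral => y _.
rewrite (@FTC_oo (fun t => v (t, y)))//.
- move=> x; apply: continuous_comp; first exact: continuous_pairl.
  exact: c1.
- by move=> x; rewrite -derivable_slice1; exact: (dv _).1.
- by move=> x; rewrite partial1_slice.
Qed.

Lemma int_rect_partial2 v a b c d : Ck 1 v -> c < d ->
  \int[mu]_(x in rect a b c d) partial2 v x =
  \int[leb]_(x in `]a, b[) (v (x, d) - v (x, c)).
Proof.
move=> [cv dv c1 c2] ab; rewrite /Rintegral; congr fine.
rewrite (int_rect _ _ _ _ c2).1; apply: eq_integral => x _.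
rewrite (@FTC_oo (fun t => v (x, t)))//.
- move=> y; apply: continuous_comp; first exact: continuous_pairr.
  exact: c2.
- by move=> y; rewrite -derivable_slice2; exact: (dv _).2.
- by move=> y; rewrite partial2_slice.
Qed.

End RectangleCalculus.

(** * Continuously differentiable functions of two variables *)

Section ContinuouslyDifferentiable.
Context {R : realType}.
Implicit Types (O : set (R * R)) (f g v : R * R -> R).

(** [Ck 1] with named derivatives: the derivatives of sums and products are then
    found by unification. *)
Definition hasC1 v (d1 d2 : R * R -> R) : Prop :=
  [/\ continuous v, continuous d1, continuous d2,
      forall x : R * R, is_derive x ((1, 0) : R * R) v (d1 x) &
      forall x : R * R, is_derive x ((0, 1) : R * R) v (d2 x)].

Lemma hasC1_partial v d1 d2 : hasC1 v d1 d2 -> partial1 v = d1 /\ partial2 v = d2.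
Proof.
move=> [_ _ _ h1 h2]; split; apply/funext => x.
- by have := h1 x => -[].
- by have := h2 x => -[].
Qed.

Lemma hasC1_Ck v d1 d2 : hasC1 v d1 d2 -> Ck 1 v.
Proof.
move=> C1; have [e1 e2] := hasC1_partial C1; case: C1 => cv c1 c2 h1 h2.
by split; rewrite /= ?e1 ?e2.
Qed.

Lemma Ck_hasC1 v : Ck 1 v -> hasC1 v (partial1 v) (partial2 v).
Proof.
move=> [cv dv c1 c2]; split=> // x; apply: DeriveDef => //.
- exact: (dv x).1.
- exact: (dv x).2.
Qed.

Lemma hasC1_cst (k : R) : hasC1 (cst k) (cst 0) (cst 0).
Proof. by split; try (move=> x; exact: cvg_cst); move=> x; exact: is_derive_cst. Qed.

Lemma hasC1D v v1 v2 w w1 w2 : hasC1 v v1 v2 -> hasC1 w w1 w2 ->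
  hasC1 (fun x => v x + w x) (fun x => v1 x + w1 x) (fun x => v2 x + w2 x).
Proof.
move=> [a b c d e] [a' b' c' d' e']; split.
- by move=> x; apply: cvgD; [exact: a|exact: a'].
- by move=> x; apply: cvgD; [exact: b|exact: b'].
- by move=> x; apply: cvgD; [exact: c|exact: c'].
- by move=> x; apply: is_deriveD.
- by move=> x; apply: is_deriveD.
Qed.

Lemma hasC1B v v1 v2 w w1 w2 : hasC1 v v1 v2 -> hasC1 w w1 w2 ->
  hasC1 (fun x => v x - w x) (fun x => v1 x - w1 x) (fun x => v2 x - w2 x).
Proof.
move=> [a b c d e] [a' b' c' d' e']; split.
- by move=> x; apply: cvgB; [exact: a|exact: a'].
- by move=> x; apply: cvgB; [exact: b|exact: b'].
- by move=> x; apply: cvgB; [exact: c|exact: c'].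
- by move=> x; apply: is_deriveB.
- by move=> x; apply: is_deriveB.
Qed.

Lemma hasC1M v v1 v2 w w1 w2 : hasC1 v v1 v2 -> hasC1 w w1 w2 ->
  hasC1 (fun x => v x * w x) (fun x => v x * w1 x + w x * v1 x)
    (fun x => v x * w2 x + w x * v2 x).
Proof.
move=> [a b c d e] [a' b' c' d' e']; split.
- by move=> x; apply: cvgM; [exact: a|exact: a'].
- by move=> x; apply: cvgD; apply: cvgM; [exact: a|exact: b'|exact: a'|exact: b].
- by move=> x; apply: cvgD; apply: cvgM; [exact: a|exact: c'|exact: a'|exact: c].
- by move=> x; exact: (is_deriveM (d x) (d' x)).
- by move=> x; exact: (is_deriveM (e x) (e' x)).
Qed.

Lemma hasC1_fst (F f : R -> R) : continuous f ->
  (forall x : R, is_derive x 1 F (f x)) ->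
  hasC1 (fun x => F x.1) (fun x => f x.1) (cst 0).
Proof.
move=> cf dF.
have cF x : {for x, continuous F}.
  by apply: differentiable_continuous; apply/derivable1_diffP; case: (dF x).
split.
- by move=> x; apply: (continuous_comp (f := fst)); [exact: cvg_fst|exact: cF].
- by move=> x; apply: (continuous_comp (f := fst)); [exact: cvg_fst|exact: cf].
- by move=> x; exact: cvg_cst.
- move=> [x y]; apply: DeriveDef.
    by rewrite derivable_slice1 /=; case: (dF x).
  by have := partial1_slice (fun x => F x.1) x y; rewrite /partial1 => ->; rewrite derive1E /=; case: (dF x).
- move=> [x y]; apply: DeriveDef.
    by rewrite derivable_slice2 /=; exact: derivable_cst.
  by have := partial2_slice (fun x => F x.1) x y; rewrite /partial2 => -> /=; rewrite derive1E derive_cst.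
Qed.

Lemma hasC1_snd (F f : R -> R) : continuous f ->
  (forall x : R, is_derive x 1 F (f x)) ->
  hasC1 (fun x => F x.2) (cst 0) (fun x => f x.2).
Proof.
move=> cf dF.
have cF x : {for x, continuous F}.
  by apply: differentiable_continuous; apply/derivable1_diffP; case: (dF x).
split.
- by move=> x; apply: (continuous_comp (f := snd)); [exact: cvg_snd|exact: cF].
- by move=> x; exact: cvg_cst.
- by move=> x; apply: (continuous_comp (f := snd)); [exact: cvg_snd|exact: cf].
- move=> [x y]; apply: DeriveDef.
    by rewrite derivable_slice1 /=; exact: derivable_cst.
  by have := partial1_slice (fun x => F x.2) x y; rewrite /partial1 => -> /=; rewrite derive1E derive_cst.
- move=> [x y]; apply: DeriveDef.
    by rewrite derivable_slice2 /=; case: (dF y).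
  by have := partial2_slice (fun x => F x.2) x y; rewrite /partial2 => ->; rewrite derive1E /=; case: (dF y).
Qed.

Lemma hasC1_eq v d1 d2 v' d1' d2' : hasC1 v d1 d2 ->
  v =1 v' -> d1 =1 d1' -> d2 =1 d2' -> hasC1 v' d1' d2'.
Proof. by move=> h /funext <- /funext <- /funext <-. Qed.

End ContinuouslyDifferentiable.

(** * Weak derivatives *)

Section WeakDerivative.
Context {R : realType}.
Implicit Types (O : set (R * R)) (f g v : R * R -> R).
Notation mu := (@leb2 R).
Notation leb := (@lebesgue_measure R).

Lemma derive_outside_support f (K : set (R * R)) (h x : R * R) :
  compact K -> (forall x, ~ K x -> f x = 0) -> ~ K x -> 'D_h f x = 0.
Proof.
move=> cK fK Kx.
have oK : open (~` K).
  by apply: closed_openC; apply: compact_closed cK; exact: norm_hausdorff.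
rewrite (@near_eq_derive _ _ _ f (cst 0)) ?derive_cst//.
apply: filterS (open_nbhs_nbhs (conj oK Kx)).
by move=> y Ky; rewrite fK.
Qed.

Lemma Rintegral_support O (Q : set (R * R)) g : O `<=` Q ->
  (forall x, ~ O x -> g x = 0) ->
  \int[mu]_(x in O) g x = \int[mu]_(x in Q) g x.
Proof.
move=> OQ gO; rewrite Rintegral_mkcond [RHS]Rintegral_mkcond.
congr (Rintegral _ _ _); apply/funext => x; rewrite !patchE.
case: ifPn => [/set_mem/OQ/mem_set -> //|].
by move=> /negP xO; rewrite gO ?if_same// => Ox; apply: xO; exact: mem_set.
Qed.

Lemma weak_of_total O (D : (R * R -> R) -> R * R -> R) v dv :
  measurable (O : set (plane R)) ->
  (forall eta, test_function O eta ->
    [/\ mu.-integrable O (EFin \o (fun x => v x * D eta x)),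
        mu.-integrable O (EFin \o (fun x => eta x * dv x)) &
        \int[mu]_(x in O) (v x * D eta x + eta x * dv x) = 0]) ->
  weak_derivative O D v dv.
Proof.
move=> mO h eta teta; have [i1 i2] := h eta teta; rewrite RintegralD// => h0.
apply/eqP; rewrite -addr_eq0 -h0; apply/eqP; congr (_ + _).
by apply: eq_Rintegral => x _; rewrite mulrC.
Qed.

(** The product of v with a test function vanishes outside a compact subset of O,
    so its partial derivatives have integral zero over a rectangle that contains
    the closure of O. *)
Lemma weak_derivative_C1 O v a b c d : open O -> O `<=` box a b c d -> Ck 1 v ->
  weak_derivative O partial1 v (partial1 v) /\
  weak_derivative O partial2 v (partial2 v).
Proof.
move=> oO Obox C1v.
have mO := open_measurable_plane oO.
set Q := rect (a - 1) (`|b| + `|a| + 1) (c - 1) (`|d| + `|c| + 1).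
have OQ : O `<=` Q.
  move=> x /Obox /boxP[x1 x2 x3 x4]; apply/rectP.
  have := ler_norm b; have := ler_norm d; have := normr_ge0 a; have := normr_ge0 c.
  split; lra.
have ab : a - 1 < `|b| + `|a| + 1.
  by have := ler_norm a; have := normr_ge0 b; lra.
have cd : c - 1 < `|d| + `|c| + 1.
  by have := ler_norm c; have := normr_ge0 d; lra.
have Cv := Ck_hasC1 C1v.
split; apply: weak_of_total => // eta [Cketa [K [cK KO etaK]]].
all: have Ce := Ck_hasC1 (Cketa 1%N).
all: have Cve := hasC1M Cv Ce.
all: have [p1 p2] := hasC1_partial Cve.
all: have out x : ~ O x -> ~ K x by move=> Ox /KO.
all: case: (Cv) => cv cv1 cv2 _ _; case: (Ce) => ce ce1 ce2 _ _.
all: have L2c f : continuous f -> sqint mu O f by exact: (continuous_sqint mO Obox).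
all: split; try by apply: sqint_integrableM => //; exact: L2c.
all: rewrite (@Rintegral_support O Q)//; last first.
all: try by move=> x /out Kx; rewrite /partial1 /partial2 (derive_outside_support _ cK etaK Kx) (etaK _ Kx) mulr0 mul0r addr0.
all: have edge x : ~ O x -> v x * eta x = 0 by move=> /out /etaK ->; rewrite mulr0.
- rewrite -p1 (int_rect_partial1 _ _ (hasC1_Ck Cve) ab).
  rewrite (@eq_Rintegral _ _ _ leb _ (cst 0)) ?Rintegral_cst ?mul0r//.
  by move=> y _; rewrite !edge ?subrr// => /OQ/rectP[/=]; lra.
- rewrite -p2 (int_rect_partial2 _ _ (hasC1_Ck Cve) cd).
  rewrite (@eq_Rintegral _ _ _ leb _ (cst 0)) ?Rintegral_cst ?mul0r//.
  by move=> y _; rewrite !edge ?subrr// => /OQ/rectP[/=]; lra.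
Qed.

End WeakDerivative.

(** * Passing to the limit in traces *)

Section SmallSquares.
Context d (T : measurableType d) (R : realType).
Variable mu : {measure set T -> \bar R}.

(** From |t| <= s + t^2 / s: on a set of finite measure, smallness in L^2 gives
    smallness in L^1 with explicit constants. *)
Lemma L1_small (D : set T) (f : T -> R) (s : R) : measurable D ->
  (mu D < +oo)%E -> sqint mu D f -> 0 < s ->
  \int[mu]_(x in D) (f x ^+ 2) <= s ^+ 2 ->
  \int[mu]_(x in D) `|f x| <= s * fine (mu D) + s.
Proof.
move=> mD Dfin Lf s0 fs.
have f2i := sqint_integrable2 mD Lf.
have ci : mu.-integrable D (EFin \o cst s).
  by apply: sqint_integrable => //; apply: (@bounded_sqint _ _ _ _ _ _ `|s|).
apply: (@le_trans _ _ (\int[mu]_(x in D) (s + s^-1 * f x ^+ 2))).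
  apply: le_Rintegral => //.
  - by have := integrable_abse (sqint_integrable mD Dfin Lf).
  - by apply: integrable_addr => //; exact: integrable_mulrl.
  - move=> x _; rewrite -subr_ge0.
    have -> : s + s^-1 * f x ^+ 2 - `|f x| = s^-1 * ((s - `|f x| / 2) ^+ 2 + 3 / 4 * `|f x| ^+ 2).
      by rewrite -[f x ^+ 2]real_normK ?num_real//; field; rewrite gt_eqF.
    apply: mulr_ge0; first by rewrite invr_ge0 ltW.
    by apply: addr_ge0; rewrite ?sqr_ge0// mulr_ge0 ?sqr_ge0//; lra.
rewrite RintegralD//; last exact: integrable_mulrl.
rewrite Rintegral_cst// RintegralZl// lerD2l.
rewrite mulrC ler_pdivrMr// -expr2; exact: fs.
Qed.

Lemma zero_of_small (I C : R) : (forall s, 0 < s -> `|I| <= C * s) -> I = 0.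
Proof.
move=> h; apply/eqP; rewrite -normr_le0 leNgt; apply/negP => I0.
have C0 : 0 < `|C| + 1 by rewrite ltr_wpDl.
have := h (`|I| / 2 / (`|C| + 1)) _; rewrite !divr_gt0// => /(_ isT).
rewrite mulrA ler_pdivlMr// => h1.
have : C * (`|I| / 2) <= `|C| * (`|I| / 2).
  by rewrite ler_wpM2r ?ler_norm// divr_ge0.
nra.
Qed.

End SmallSquares.

Section Traces.
Context {R : realType}.
Implicit Types (O Gamma : set (R * R)) (f g v : R * R -> R).
Notation mu := (@leb2 R).
Notation leb := (@lebesgue_measure R).

Lemma cvge0_near (A : nat -> \bar R) (s : R) : A n @[n --> \oo] --> 0%E -> 0 < s ->
  \forall n \near \oo, (A n <= s%:E)%E.
Proof.
move=> A0 s0; have s0' : (0 < s%:E)%E by rewrite lte_fin.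
have As : \forall n \near \oo, (A n < s%:E)%E := A0 _ (open_ereal_lt' s0').
by apply: filterS As => n; exact: ltW.
Qed.

Definition sqdist O (u : H1 O) v (x : R * R) : R :=
  `|v x - u x| ^+ 2 + `|partial1 v x - dx1 u x| ^+ 2 +
            `|partial2 v x - dx2 u x| ^+ 2.

Lemma trace_approx O Gamma (u : H1 O) g (s : R) : trace_eq Gamma u g -> 0 < s ->
  exists v, [/\ Ck 1 v,
    (\int[mu]_(x in O) (sqdist u v x)%:E <= s%:E)%E &
    (arc_integral Gamma (fun x => (`|v x - g x| ^+ 2)%:E) <= s%:E)%E].
Proof.
move=> [v [C1 h1 h2]] s0.
have [n [a b]] := filter_ex (filterI (cvge0_near h1 s0) (cvge0_near h2 s0)).
by exists (v n).
Qed.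

Lemma esum_ge1 (F : R -> \bar R) (c : R) : (forall x, 0 <= F x)%E ->
  (F c <= \esum_(i in setT) F i)%E.
Proof.
move=> F0; apply: esum_ge; exists [set c]; last by rewrite fsbig_set1.
by split.
Qed.

(** The sum that defines [arc_integral] has nonnegative terms, so the line on which
    the segment lies bounds it from below. *)
Lemma arc_integral_hor Gamma f (a b c : R) : closed Gamma -> continuous f ->
  (forall t, a < t < b -> Gamma (t, c)) ->
  (\int[leb]_(t in `]a, b[) (f (t, c) ^+ 2)%:E <=
   arc_integral Gamma (fun x => (`|f x| ^+ 2)%:E))%E.
Proof.
move=> cG cf sub.
have int0 (D : set R) (h : R -> R * R) : (0 <= \int[leb]_(t in D) (`|f (h t)| ^+ 2)%:E)%E.
  by apply: integral_ge0 => t _; rewrite lee_fin sqr_ge0.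
apply: (@le_trans _ _ (\int[leb]_(t in [set t | Gamma (t, c)]) (`|f (t, c)| ^+ 2)%:E)%E).
  under eq_integral do rewrite -[_ ^+ 2]real_normK ?num_real//.
  apply: ge0_subset_integral => //.
  - apply: closed_measurable; apply: (@closed_comp _ _ (fun t => (t, c))) => //.
    by move=> t _; exact: continuous_pairl.
  - apply/measurable_EFinP/measurable_funX/measurableT_comp => //.
    apply: measurable_funTS; apply: continuous_measurable_fun => t.
    by apply: continuous_comp; [exact: continuous_pairl|exact: cf].
pose F c := (\int[leb]_(t in [set t | Gamma (t, c)]) (`|f (t, c)| ^+ 2)%:E)%E.
apply: (le_trans (@esum_ge1 F c _)); first by move=> x; exact: int0.
by apply: leeDl; apply: esum_ge0 => x _; exact: int0.
Qed.

Lemma arc_integral_ver Gamma f (a b c : R) : closed Gamma -> continuous f ->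
  (forall t, a < t < b -> Gamma (c, t)) ->
  (\int[leb]_(t in `]a, b[) (f (c, t) ^+ 2)%:E <=
   arc_integral Gamma (fun x => (`|f x| ^+ 2)%:E))%E.
Proof.
move=> cG cf sub.
have int0 (D : set R) (h : R -> R * R) : (0 <= \int[leb]_(t in D) (`|f (h t)| ^+ 2)%:E)%E.
  by apply: integral_ge0 => t _; rewrite lee_fin sqr_ge0.
apply: (@le_trans _ _ (\int[leb]_(t in [set t | Gamma (c, t)]) (`|f (c, t)| ^+ 2)%:E)%E).
  under eq_integral do rewrite -[_ ^+ 2]real_normK ?num_real//.
  apply: ge0_subset_integral => //.
  - apply: closed_measurable; apply: (@closed_comp _ _ (fun t => (c, t))) => //.
    by move=> t _; exact: continuous_pairr.
  - apply/measurable_EFinP/measurable_funX/measurableT_comp => //.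
    apply: measurable_funTS; apply: continuous_measurable_fun => t.
    by apply: continuous_comp; [exact: continuous_pairr|exact: cf].
pose F c := (\int[leb]_(t in [set t | Gamma (c, t)]) (`|f (c, t)| ^+ 2)%:E)%E.
apply: (le_trans (@esum_ge1 F c _)); first by move=> x; exact: int0.
by apply: leeDr; apply: esum_ge0 => x _; exact: int0.
Qed.

Lemma L1_small_itv (f : R -> R) (a b s : R) : a < b -> 0 < s -> continuous f ->
  (\int[leb]_(t in `]a, b[) (f t ^+ 2)%:E <= (s ^+ 2)%:E)%E ->
  `|\int[leb]_(t in `]a, b[) f t| <= s * (b - a) + s.
Proof.
move=> ab s0 cf fs.
have mf : measurable_fun `]a, b[%classic f.
  by apply: measurable_funTS; exact: continuous_measurable_fun.
have len : leb (`]a, b[%classic : set R) = (b - a)%:E.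
  by rewrite lebesgue_measure_itv /= lte_fin ab.
have Lf : sqint leb `]a, b[%classic f.
  split=> //; under eq_integral do rewrite real_normK ?num_real//.
  by apply: le_lt_trans fs _; rewrite ltry.
have fin : (leb (`]a, b[%classic : set R) < +oo)%E by rewrite len ltry.
apply: (@le_trans _ _ (\int[leb]_(t in `]a, b[) `|f t|)).
  by apply: le_normr_Rintegral => //; exact: sqint_integrable.
have -> : b - a = fine (leb (`]a, b[%classic : set R)) by rewrite len.
apply: L1_small => //; rewrite /Rintegral -lee_fin fineK//.
exact: (integrable_fin_num _ (sqint_integrable2 _ Lf)).
Qed.

(** Every C^1 function v satisfies int_Q (v + theta D v) = O(trace of v on Gamma);
    both sides depend continuously on v for the norms that define [trace_eq], so the
    left-hand side is zero for a function whose trace on Gamma is zero. *)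
Lemma flux_limit O (u : H1 O) Gamma (Q : set (R * R)) (D : (R * R -> R) -> R * R -> R)
  (du theta : R * R -> R) (K C a b c d : R) :
  measurable (O : set (plane R)) -> measurable (Q : set (plane R)) -> Q `<=` O ->
  O `<=` box a b c d -> continuous theta ->
  (forall x, Q x -> `|theta x| <= K) -> sqint mu Q du ->
  (forall v, Ck 1 v -> continuous (D v) /\
    forall x, (D v x - du x) ^+ 2 <= sqdist u v x) ->
  (forall v s, Ck 1 v -> 0 < s ->
     (arc_integral Gamma (fun x => (`|v x| ^+ 2)%:E) <= (s ^+ 2)%:E)%E ->
     `|\int[mu]_(x in Q) (v x + theta x * D v x)| <= C * s) ->
  trace_eq Gamma u (cst 0) ->
  \int[mu]_(x in Q) (u x + theta x * du x) = 0.
Proof.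
move=> mO mQ QO Obox ct tK Ldu Dv edge tr.
have Qfin : (mu Q < +oo)%E by apply: (box_finite mQ) => x /QO /Obox; exact.
have Qbox : Q `<=` box a b c d by move=> x /QO /Obox.
have Lc f : continuous f -> sqint mu Q f by exact: (continuous_sqint mQ Qbox).
have LuO : sqint mu O u by exact: H1_L2.
have Lu : sqint mu Q u by apply: sqintS LuO.
have mt : measurable_fun Q theta by case: (Lc _ ct).
have LtM f : sqint mu Q f -> sqint mu Q (fun x => theta x * f x).
  by move=> Lf; apply: (sqintM_bounded _ Lf mt tK).
pose m := fine (mu Q).
apply: (@zero_of_small _ _ (C + (1 + `|K|) * (m + 1))) => s s0.
have [v [C1 e1]] := trace_approx tr (exprn_gt0 2 s0).
under [X in arc_integral _ X]eq_fun do rewrite subr0.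
move=> e2; have {e2} Jv := edge v s C1 s0 e2.
have [cv _ _ _ _] := Ck_hasC1 C1.
have [cDv Dvu] := Dv v C1.
have mS : measurable_fun O (sqdist u v).
  have [_ c1 c2 _ _] := Ck_hasC1 C1.
  have mc f g : continuous f -> sqint mu O g -> measurable_fun O (fun x => `|f x - g x| ^+ 2).
    move=> cf [mg _]; apply: measurable_funX; apply: measurableT_comp => //.
    by apply: measurable_funB => //; exact: measurable_funS (continuous_measurable_plane cf).
  apply: measurable_funD; [apply: measurable_funD|]; apply: mc => //.
  - exact: dx1_L2.
  - exact: dx2_L2.
have small f : sqint mu Q f -> (forall x, f x ^+ 2 <= sqdist u v x) ->
    \int[mu]_(x in Q) `|f x| <= s * m + s.
  move=> Lf fs; apply: L1_small => //.
  rewrite /Rintegral -lee_fin fineK; last exact: (integrable_fin_num _ (sqint_integrable2 _ Lf)).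
  apply: le_trans e1; apply: (@le_trans _ _ (\int[mu]_(x in Q) (sqdist u v x)%:E)%E).
    apply: ge0_le_integral => //.
    - by move=> x _; rewrite lee_fin sqr_ge0.
    - by apply/measurable_EFinP/measurable_funX; case: Lf.
    - by apply/measurable_EFinP; exact: measurable_funS mS.
    - by move=> x _; rewrite lee_fin.
  apply: ge0_subset_integral => //; first exact/measurable_EFinP.
  by move=> x _; rewrite lee_fin !addr_ge0 ?sqr_ge0.
have i1 : mu.-integrable Q (EFin \o (fun x => v x + theta x * D v x)).
  by apply: sqint_integrable => //; apply: sqintD => //; [exact: Lc|apply: LtM; exact: Lc].
have i2 : mu.-integrable Q (EFin \o (fun x => u x + theta x * du x)).
  by apply: sqint_integrable => //; apply: sqintD => //; exact: LtM.
have Lvu : sqint mu Q (fun x => v x - u x) by apply: sqintB => //; exact: Lc.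
have LDvu : sqint mu Q (fun x => D v x - du x) by apply: sqintB => //; exact: Lc.
have diff : `|\int[mu]_(x in Q) (v x + theta x * D v x) - \int[mu]_(x in Q) (u x + theta x * du x)|
    <= (1 + `|K|) * (m + 1) * s.
  rewrite -RintegralB//.
  have LtDvu := LtM _ LDvu.
  apply: (le_trans (le_normr_Rintegral mQ (integrable_subr mQ i1 i2))).
  have ai f : sqint mu Q f -> mu.-integrable Q (EFin \o (fun x => `|f x|)).
    by move=> Lf; have := integrable_abse (sqint_integrable mQ Qfin Lf).
  apply: (@le_trans _ _ (\int[mu]_(x in Q) (`|v x - u x| + `|K| * `|D v x - du x|))).
    apply: le_Rintegral => //.
    - exact: (integrable_abse (integrable_subr mQ i1 i2)).
    - apply: integrable_addr => //; first exact: ai.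
      by apply: integrable_mulrl => //; exact: ai.
    - move=> x Qx.
      have -> : v x + theta x * D v x - (u x + theta x * du x) =
          (v x - u x) + theta x * (D v x - du x) by ring.
      apply: (le_trans (ler_normD _ _)); rewrite lerD2l normrM ler_wpM2r//.
      by apply: (le_trans (tK _ Qx)); exact: ler_norm.
  rewrite RintegralD//; [|exact: ai|by apply: integrable_mulrl => //; exact: ai].
  rewrite RintegralZl//; last exact: ai.
  have h1 : \int[mu]_(x in Q) `|v x - u x| <= s * m + s.
    apply: small => // x; rewrite /sqdist -[leLHS]real_normK ?num_real//.
    by rewrite -addrA lerDl addr_ge0 ?sqr_ge0.
  have h2 : \int[mu]_(x in Q) `|D v x - du x| <= s * m + s by exact: small.
  have := ler_wpM2l (normr_ge0 K) h2; lra.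
rewrite mulrDl; apply: le_trans (lerD Jv diff).
rewrite -[X in `|X| <= _](subKr (\int[mu]_(x in Q) (v x + theta x * D v x))).
exact: ler_normB.
Qed.

End Traces.

(** * Rectangles with zero traces on two opposite sides *)

Section Flux.
Context {R : realType}.
Implicit Types (O Gamma : set (R * R)) (f g v : R * R -> R).
Notation mu := (@leb2 R).
Notation leb := (@lebesgue_measure R).

Lemma hasC1_shift1 (o : R) : hasC1 (fun x : R * R => x.1 - o) (cst 1) (cst 0).
Proof.
apply: (@hasC1_fst _ (fun t => t - o) (cst 1)); first by move=> x; exact: cvg_cst.
by move=> x; apply: is_derive_eq; rewrite subr0.
Qed.

Lemma hasC1_shift2 (o : R) : hasC1 (fun x : R * R => x.2 - o) (cst 0) (cst 1).
Proof.
apply: (@hasC1_snd _ (fun t => t - o) (cst 1)); first by move=> x; exact: cvg_cst.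
by move=> x; apply: is_derive_eq; rewrite subr0.
Qed.

Lemma continuous_integrable_oo (f : R -> R) (a b : R) : continuous f ->
  leb.-integrable `]a, b[ (EFin \o f).
Proof.
move=> cf.
have sub : (`]a, b[%classic : set R) `<=` `[a, b]%classic by apply: subset_itvW.
refine (@integrableS _ _ _ leb _ _ _ (measurable_itv _) (measurable_itv _) sub _).
apply: continuous_compact_integrable; first exact: segment_compact.
exact: continuous_subspaceT.
Qed.

Section OneSided.
Variables (O : set (R * R)) (u : H1 O) (Gamma : set (R * R)).
Variables (a b c d A B C D : R).
Hypotheses (oO : open O) (Obox : O `<=` box A B C D) (cG : closed Gamma).
Hypotheses (ab : a < b) (cd : c < d) (QO : rect a b c d `<=` O).
Hypothesis tr : trace_eq Gamma u (cst 0).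

Let mO := open_measurable_plane oO.
Let mQ := @measurable_rect R a b c d.

(** The integrand is the vertical derivative of (x2 - o) u, a function that vanishes
    on the side x2 = o because of its first factor, and on the opposite side x2 = e
    because of the trace of u. *)
Lemma flux_ver (e o : R) : (e = d /\ o = c) \/ (e = c /\ o = d) ->
  (forall t, a < t < b -> Gamma (t, e)) ->
  \int[mu]_(x in rect a b c d) (u x + (x.2 - o) * dx2 u x) = 0.
Proof.
move=> eo sub.
have [ct _ _ _ _] := hasC1_shift2 o.
apply: (@flux_limit _ O u Gamma (rect a b c d) partial2 (dx2 u)
  (fun x => x.2 - o) (d - c) ((d - c) * ((b - a) + 1)) A B C D) => //.
- move=> x /rectP[x1 x2 x3 x4]; rewrite ler_norml.
  by case: eo => -[_ ->]; apply/andP; split; lra.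
- exact: (sqintS mO mQ QO (dx2_L2 u)).
- move=> v C1; have [_ _ c2 _ _] := Ck_hasC1 C1; split => // x.
  by rewrite -[leLHS]real_normK ?num_real// /sqdist lerDr addr_ge0 ?sqr_ge0.
move=> v s C1 s0 arc.
have Cv := Ck_hasC1 C1; have Cp := hasC1M (hasC1_shift2 o) Cv.
have [cv _ _ _ _] := Cv.
have [_ p2] := hasC1_partial Cp.
rewrite (_ : \int[mu]_(x in rect a b c d) (v x + (x.2 - o) * partial2 v x) =
  \int[mu]_(x in rect a b c d) partial2 (fun x => (x.2 - o) * v x) x); last first.
  by rewrite p2; apply: eq_Rintegral => x _; rewrite /= mulr1 addrC.
rewrite int_rect_partial2//; last exact: hasC1_Ck Cp.
rewrite (_ : \int[leb]_(x in _) _ = \int[leb]_(t in `]a, b[) ((d - c) * v (t, e))); last first.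
  by apply: eq_Rintegral => t _ /=; case: eo => -[-> ->]; ring.
have ce : continuous (fun t => v (t, e)).
  by move=> t; apply: continuous_comp; [exact: continuous_pairl|exact: cv].
rewrite RintegralZl//; last first.
  exact: continuous_integrable_oo.
rewrite normrM gtr0_norm ?subr_gt0//.
rewrite (_ : (d - c) * (b - a + 1) * s = (d - c) * (s * (b - a) + s)); last by ring.
rewrite ler_pM2l ?subr_gt0//; apply: (@L1_small_itv _ (fun t => v (t, e))) => //.
by apply: le_trans arc; exact: arc_integral_hor.
Qed.

Lemma flux_hor (e o : R) : (e = b /\ o = a) \/ (e = a /\ o = b) ->
  (forall t, c < t < d -> Gamma (e, t)) ->
  \int[mu]_(x in rect a b c d) (u x + (x.1 - o) * dx1 u x) = 0.
Proof.
move=> eo sub.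
have [ct _ _ _ _] := hasC1_shift1 o.
apply: (@flux_limit _ O u Gamma (rect a b c d) partial1 (dx1 u)
  (fun x => x.1 - o) (b - a) ((b - a) * ((d - c) + 1)) A B C D) => //.
- move=> x /rectP[x1 x2 x3 x4]; rewrite ler_norml.
  by case: eo => -[_ ->]; apply/andP; split; lra.
- exact: (sqintS mO mQ QO (dx1_L2 u)).
- move=> v C1; have [_ c2 _ _ _] := Ck_hasC1 C1; split => // x.
  by rewrite -[leLHS]real_normK ?num_real// /sqdist -addrA addrCA lerDl addr_ge0 ?sqr_ge0.
move=> v s C1 s0 arc.
have Cv := Ck_hasC1 C1; have Cp := hasC1M (hasC1_shift1 o) Cv.
have [cv _ _ _ _] := Cv.
have [p2 _] := hasC1_partial Cp.
rewrite (_ : \int[mu]_(x in rect a b c d) (v x + (x.1 - o) * partial1 v x) =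
  \int[mu]_(x in rect a b c d) partial1 (fun x => (x.1 - o) * v x) x); last first.
  by rewrite p2; apply: eq_Rintegral => x _; rewrite /= mulr1 addrC.
rewrite int_rect_partial1//; last exact: hasC1_Ck Cp.
rewrite (_ : \int[leb]_(x in _) _ = \int[leb]_(t in `]c, d[) ((b - a) * v (e, t))); last first.
  by apply: eq_Rintegral => t _ /=; case: eo => -[-> ->]; ring.
have ce : continuous (fun t => v (e, t)).
  by move=> t; apply: continuous_comp; [exact: continuous_pairr|exact: cv].
rewrite RintegralZl//; last first.
  exact: continuous_integrable_oo.
rewrite normrM gtr0_norm ?subr_gt0//.
rewrite (_ : (b - a) * (d - c + 1) * s = (b - a) * (s * (d - c) + s)); last by ring.
rewrite ler_pM2l ?subr_gt0//; apply: (@L1_small_itv _ (fun t => v (e, t))) => //.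
by apply: le_trans arc; exact: arc_integral_ver.
Qed.

End OneSided.

(** The two identities of [flux_ver], for o = c and for o = d, differ by
    (d - c) int d2 u. *)
Lemma H1_flux_zero2 O (u : H1 O) (Gc Gd : set (R * R)) (a b c d A B C D : R) :
  open O -> O `<=` box A B C D -> closed Gc -> closed Gd ->
  a < b -> c < d -> rect a b c d `<=` O ->
  trace_eq Gc u (cst 0) -> trace_eq Gd u (cst 0) ->
  (forall t, a < t < b -> Gc (t, c)) -> (forall t, a < t < b -> Gd (t, d)) ->
  \int[mu]_(x in rect a b c d) dx2 u x = 0.
Proof.
move=> oO Obox cGc cGd ab cd QO trc trd ec ed.
have mQ := @measurable_rect R a b c d.
have mO := open_measurable_plane oO.
have Qfin : (mu (rect a b c d) < +oo)%E by apply: (box_finite mQ) => x /QO /Obox; exact.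
have L1 := sqintS mO mQ QO (H1_L2 u).
have L2 := sqintS mO mQ QO (dx2_L2 u).
have Lo o : sqint mu (rect a b c d) (fun x => (x.2 - o) * dx2 u x).
  have [cs _ _ _ _] := hasC1_shift2 o.
  apply: (@sqintM_bounded _ _ _ _ _ _ _ (`|o| + `|c| + `|d|)) => //.
    exact: measurable_funTS (continuous_measurable_plane cs).
  move=> x /rectP[_ _ x3 x4]; rewrite ler_norml.
  have := ler_norm d; have := ler_norm (- c); have := ler_norm o; have := ler_norm (- o).
  rewrite !normrN; have := normr_ge0 c; have := normr_ge0 d.
  by move=> *; apply/andP; split; lra.
have bot := flux_ver oO Obox cGc ab cd QO trc (or_intror (conj erefl erefl)) ec.
have top := flux_ver oO Obox cGd ab cd QO trd (or_introl (conj erefl erefl)) ed.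
have ii o : mu.-integrable (rect a b c d) (EFin \o (fun x => u x + (x.2 - o) * dx2 u x)).
  by apply: sqint_integrable => //; exact: sqintD.
have : (d - c) * \int[mu]_(x in rect a b c d) dx2 u x = 0.
  rewrite -RintegralZl//; last exact: sqint_integrable.
  rewrite -[RHS](subrr 0) -{1}top -bot -RintegralB//.
  by apply: eq_Rintegral => x _; ring.
by move/eqP; rewrite mulf_eq0 subr_eq0 gt_eqF//= => /eqP.
Qed.

Lemma H1_flux_zero1 O (u : H1 O) (Ga Gb : set (R * R)) (a b c d A B C D : R) :
  open O -> O `<=` box A B C D -> closed Ga -> closed Gb ->
  a < b -> c < d -> rect a b c d `<=` O ->
  trace_eq Ga u (cst 0) -> trace_eq Gb u (cst 0) ->
  (forall t, c < t < d -> Ga (a, t)) -> (forall t, c < t < d -> Gb (b, t)) ->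
  \int[mu]_(x in rect a b c d) dx1 u x = 0.
Proof.
move=> oO Obox cGc cGd ab cd QO trc trd ec ed.
have mQ := @measurable_rect R a b c d.
have mO := open_measurable_plane oO.
have Qfin : (mu (rect a b c d) < +oo)%E by apply: (box_finite mQ) => x /QO /Obox; exact.
have L1 := sqintS mO mQ QO (H1_L2 u).
have L2 := sqintS mO mQ QO (dx1_L2 u).
have Lo o : sqint mu (rect a b c d) (fun x => (x.1 - o) * dx1 u x).
  have [cs _ _ _ _] := hasC1_shift1 o.
  apply: (@sqintM_bounded _ _ _ _ _ _ _ (`|o| + `|a| + `|b|)) => //.
    exact: measurable_funTS (continuous_measurable_plane cs).
  move=> x /rectP[x3 x4 _ _]; rewrite ler_norml.
  have := ler_norm b; have := ler_norm (- a); have := ler_norm o; have := ler_norm (- o).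
  rewrite !normrN; have := normr_ge0 a; have := normr_ge0 b.
  by move=> *; apply/andP; split; lra.
have bot := flux_hor oO Obox cGc ab cd QO trc (or_intror (conj erefl erefl)) ec.
have top := flux_hor oO Obox cGd ab cd QO trd (or_introl (conj erefl erefl)) ed.
have ii o : mu.-integrable (rect a b c d) (EFin \o (fun x => u x + (x.1 - o) * dx1 u x)).
  by apply: sqint_integrable => //; exact: sqintD.
have : (b - a) * \int[mu]_(x in rect a b c d) dx1 u x = 0.
  rewrite -RintegralZl//; last exact: sqint_integrable.
  rewrite -[RHS](subrr 0) -{1}top -bot -RintegralB//.
  by apply: eq_Rintegral => x _; ring.
by move/eqP; rewrite mulf_eq0 subr_eq0 gt_eqF//= => /eqP.
Qed.

Lemma weakP O D f g : weak_derivative O D f g -> forall eta, test_function O eta ->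
  \int[mu]_(x in O) (f x * D eta x) = - \int[mu]_(x in O) (g x * eta x).
Proof. by []. Qed.

Lemma weak_derivativeB O (D : (R * R -> R) -> R * R -> R) f g df dg (A B C E : R) :
  measurable (O : set (plane R)) -> O `<=` box A B C E ->
  sqint mu O f -> sqint mu O g -> sqint mu O df -> sqint mu O dg ->
  (forall eta, Ck 1 eta -> continuous (D eta)) ->
  weak_derivative O D f df -> weak_derivative O D g dg ->
  weak_derivative O D (fun x => f x - g x) (fun x => df x - dg x).
Proof.
move=> mO Obox Lf Lg Ldf Ldg cD wf wg eta teta.
have C1 : Ck 1 eta by case: teta => /(_ 1%N).
have LD : sqint mu O (D eta) by apply: (continuous_sqint mO Obox); exact: cD.
have Le : sqint mu O eta by apply: (continuous_sqint mO Obox); case: C1.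
transitivity (\int[mu]_(x in O) (f x * D eta x) - \int[mu]_(x in O) (g x * D eta x)).
  rewrite -RintegralB//; try exact: sqint_integrableM.
  by apply: eq_Rintegral => x _; ring.
rewrite (weakP wf teta) (weakP wg teta) -opprD; congr (- _).
rewrite -RintegralB//; try exact: sqint_integrableM.
by apply: eq_Rintegral => x _; ring.
Qed.

(** A sequence that realizes the trace of u, minus w, realizes the trace of
    u - w. *)
Lemma H1B_C1 O (u : H1 O) w (A B C D : R) :
  open O -> O `<=` box A B C D -> Ck 1 w ->
  exists psi : H1 O, [/\ forall x, psi x = u x - w x,
    forall x, dx1 psi x = dx1 u x - partial1 w x,
    forall x, dx2 psi x = dx2 u x - partial2 w x &
    forall Gamma g, trace_eq Gamma u g -> (forall x, Gamma x -> w x = g x) ->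
      trace_eq Gamma psi (cst 0)].
Proof.
move=> oO Obox C1.
have mO := open_measurable_plane oO.
have [cw c1 c2 _ _] := Ck_hasC1 C1.
have Lc f : continuous f -> sqint mu O f by exact: (continuous_sqint mO Obox).
have [w1 w2] := weak_derivative_C1 oO Obox C1.
have h0 : L2 O (fun x => u x - w x) := sqintB mO (H1_L2 u) (Lc _ cw).
have h1 : L2 O (fun x => dx1 u x - partial1 w x) := sqintB mO (dx1_L2 u) (Lc _ c1).
have h2 : L2 O (fun x => dx2 u x - partial2 w x) := sqintB mO (dx2_L2 u) (Lc _ c2).
have d1 : weak_derivative O partial1 (fun x => u x - w x) (fun x => dx1 u x - partial1 w x).
  apply: (weak_derivativeB mO Obox (H1_L2 u) (Lc _ cw) (dx1_L2 u) (Lc _ c1) _ (@dx1_weak _ _ u) w1).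
  by move=> eta /Ck_hasC1[].
have d2 : weak_derivative O partial2 (fun x => u x - w x) (fun x => dx2 u x - partial2 w x).
  apply: (weak_derivativeB mO Obox (H1_L2 u) (Lc _ cw) (dx2_L2 u) (Lc _ c2) _ (@dx2_weak _ _ u) w2).
  by move=> eta /Ck_hasC1[].
exists (MkH1 h0 h1 h2 d1 d2).
split; [by []|by []|by []|].
move=> Gamma g [v [Cv cv1 cv2]] wg.
have Cn n := hasC1B (Ck_hasC1 (Cv n)) (Ck_hasC1 C1).
exists (fun n x => v n x - w x); split.
- by move=> n; exact: hasC1_Ck (Cn n).
- apply: cvg_trans cv1; apply: near_eq_cvg; near=> n.
  apply: eq_integral => x _ /=; have [-> ->] := hasC1_partial (Cn n).
  have subK (p q r : R) : p - q - (r - q) = p - r by ring.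
  by rewrite 3!subK.
- apply: cvg_trans cv2; apply: near_eq_cvg; near=> n.
  congr (_ + _)%E; apply: eq_esum => c _; apply: eq_integral => t /set_mem /= Gt;
    by rewrite (wg _ Gt) subr0.
Unshelve. all: by end_near. Qed.
End Flux.

(** * Geometry of the combs *)

Section PlaneTopology.
Context {R : realType}.
Implicit Types (O : set (R * R)).

Lemma closed_boundary O : closed (boundary O).
Proof. by apply: closedI; [exact: closed_closure|apply: open_closedC; exact: open_interior]. Qed.

(** A point of both closures cannot be interior to one of two disjoint sets, as a
    neighbourhood of it would meet the other one. *)
Lemma boundary_disjoint O U : O `&` U = set0 ->
  closure O `&` closure U `<=` boundary O `&` boundary U.
Proof.
move=> OU x [Ox Ux]; split; split=> // ix.
- have [y [Uy iy]] := Ux _ (open_nbhs_nbhs (conj (@open_interior _ O) ix)).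
  have : (O `&` U) y by split=> //; exact: interior_subset iy.
  by rewrite OU.
- have [y [Oy iy]] := Ox _ (open_nbhs_nbhs (conj (@open_interior _ U) ix)).
  have : (O `&` U) y by split=> //; exact: interior_subset iy.
  by rewrite OU.
Qed.

Lemma open_disjoint_closure O U : open U -> U `&` O = set0 -> U `&` closure O = set0.
Proof.
move=> oU UO; apply/seteqP; split => // x [Ux Ox].
have [y [Oy Uy]] := Ox _ (open_nbhs_nbhs (conj oU Ux)).
by have : (U `&` O) y by []; rewrite UO.
Qed.

Lemma box_closure_rect O (a b c d : R) : a < b -> c < d -> rect a b c d `<=` O ->
  box a b c d `<=` closure O.
Proof.
move=> ab cd QO x /boxP[x1 x2 x3 x4] B /nbhs_ballP[r /= r0 rB].
have near (p q t : R) : p < q -> p <= t -> t <= q ->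
    exists2 t', p < t' < q & `|t - t'| < r.
  move=> pq pt tq.
  (* t is moved towards the midpoint m by the fraction h of its distance to it. *)
  pose m := (p + q) / 2; pose h := Num.min 1 (r / (q - p)) / 2.
  have qp0 : 0 < q - p by lra.
  have h0 : 0 < h by rewrite /h divr_gt0// lt_min ltr01 divr_gt0.
  have h1 : h <= 1 / 2 by rewrite /h ler_pM2r ?invr_gt0// ge_min lexx.
  have h2 : h * (q - p) <= r / 2.
    rewrite /h mulrAC ler_pM2r ?invr_gt0//.
    by rewrite -ler_pdivlMr// ge_min lexx orbT.
  exists (t + h * (m - t)); first by apply/andP; split; rewrite /m; nra.
  rewrite (_ : _ - _ = h * (t - m)); last by ring.
  rewrite normrM gtr0_norm//; apply: (@le_lt_trans _ _ (h * (q - p))); last lra.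
  rewrite ler_wpM2l ?(ltW h0)// ler_norml /m; apply/andP; split; lra.
have [t1 /andP[p1 q1] r1] := near a b x.1 ab x1 x2.
have [t2 /andP[p2 q2] r2] := near c d x.2 cd x3 x4.
exists (t1, t2); split; first by apply: QO; apply/rectP.
by apply: rB; split.
Qed.

End PlaneTopology.

Record comb_ordered (R : realType) (p : comb_params R) : Prop := CombOrdered {
  zeta1_gt0 : 0 < zeta1 p; zeta12 : zeta1 p < zeta2 p;
  zeta23 : zeta2 p < zeta3 p; zeta34 : zeta3 p < zeta4 p; zeta4_lt1 : zeta4 p < 1;
  l1_gt0 : 0 < l1 p; l12 : l1 p + 2 < l2 p; l23 : l2 p < l3 p }.

Section CombGeometry.
Context {R : realType}.
Variable p : comb_params R.
Notation z1 := (zeta1 p).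
Notation z2 := (zeta2 p).
Notation z3 := (zeta3 p).
Notation z4 := (zeta4 p).
Notation L := (L p).
Notation l1 := (l1 p).
Notation l2 := (l2 p).
Notation l3 := (l3 p).
Hypothesis ok : comb_ordered p.
Variables (n : nat) (e : R).
Hypothesis adm : [/\ (0 < n)%N, 0 < e & L = e * n%:R].

Let e_gt0 : 0 < e. Proof. by case: adm. Qed.
Let Le : L = e * n%:R. Proof. by case: adm. Qed.

Lemma cellP (om : set R) (k : nat) (t : R) :
  cell e om k t <-> om (t / e - k%:R).
Proof.
split=> [[y oy <-]|ot].
  by rewrite (_ : _ / e - _ = y)//; field; rewrite gt_eqF.
by exists (t / e - k%:R) => //; field; rewrite gt_eqF.
Qed.

Lemma index_lt (k : nat) : (k%:R <= L / e - 1) = (k < n)%N.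
Proof.
by rewrite Le mulrAC divff ?gt_eqF// mul1r lerBrDr natr1 ler_nat.
Qed.

Lemma nat_close (j k : nat) : (j%:R : R) < k%:R + 1 -> (k%:R : R) < j%:R + 1 -> j = k.
Proof.
rewrite !natr1 !ltr_nat !ltnS => jk kj.
by apply/eqP; rewrite eqn_leq jk kj.
Qed.

Lemma nat_lt_dec (j k : nat) : j = k \/ (j%:R + 1 <= k%:R :> R) \/ (k%:R + 1 <= j%:R :> R).
Proof.
rewrite !natr1 !ler_nat; case: (ltngtP j k) => jk; first by right; left.
- by right; right.
- by left.
Qed.

Lemma Omega_aP (x : R * R) : Omega_a p e x <->
  [/\ 0 < x.1, x.1 < L, l2 < x.2 & x.2 < l3] \/
  exists2 k : nat, (k < n)%N &
    [/\ z1 < x.1 / e - k%:R, x.1 / e - k%:R < z2, l1 + 1 < x.2 & x.2 <= l2].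
Proof.
rewrite /Omega_a; split.
- case => [[] /=|[k /=]]; rewrite ?index_lt.
    by rewrite !in_itv /= => /andP[? ?] /andP[? ?]; left.
  move=> kn [/cellP] /=; rewrite /omega_a /= !in_itv /= => /andP[? ?] /andP[? ?].
  by right; exists k.
- case => [[h1 h2 h3 h4]|[k kn [h1 h2 h3 h4]]].
    by left; split; rewrite /= in_itv /= ?h1 ?h2 ?h3 ?h4.
  right; exists k; first by rewrite /= index_lt.
  by split; [apply/cellP; rewrite /omega_a|]; rewrite /= in_itv /= ?h1 ?h2 ?h3 ?h4.
Qed.

Lemma Omega_bP (x : R * R) : Omega_b p e x <->
  [/\ 0 < x.1, x.1 < L, 0 < x.2 & x.2 < l1] \/
  exists2 k : nat, (k < n)%N &
    [/\ z3 < x.1 / e - k%:R, x.1 / e - k%:R < z4, l1 <= x.2 & x.2 < l2 - 1].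
Proof.
rewrite /Omega_b; split.
- case => [[] /=|[k /=]]; rewrite ?index_lt.
    by rewrite !in_itv /= => /andP[? ?] /andP[? ?]; left.
  move=> kn [/cellP] /=; rewrite /omega_b /= !in_itv /= => /andP[? ?] /andP[? ?].
  by right; exists k.
- case => [[h1 h2 h3 h4]|[k kn [h1 h2 h3 h4]]].
    by left; split; rewrite /= in_itv /= ?h1 ?h2 ?h3 ?h4.
  right; exists k; first by rewrite /= index_lt.
  by split; [apply/cellP; rewrite /omega_b|]; rewrite /= in_itv /= ?h1 ?h2 ?h3 ?h4.
Qed.

Lemma open_Omega_c : open (Omega_c p e).
Proof.
apply: openI; first exact: (@open_rect R 0 L 0 l3).
by apply: closed_openC; apply: closedU; exact: closed_closure.
Qed.

Lemma Omega_c_rect x : Omega_c p e x -> [/\ 0 < x.1, x.1 < L, 0 < x.2 & x.2 < l3].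
Proof. by case=> /rectP. Qed.

Lemma Omega_c_box : Omega_c p e `<=` box 0 L 0 l3.
Proof. by move=> x /Omega_c_rect[? ? ? ?]; apply/boxP; split; exact: ltW. Qed.

Lemma closed_Gamma_a : closed (Gamma_a p e).
Proof. by apply: closedI; exact: closed_boundary. Qed.

Lemma closed_Gamma_b : closed (Gamma_b p e).
Proof. by apply: closedI; exact: closed_boundary. Qed.

Lemma Gamma_a_closure : Gamma_a p e `<=` closure (Omega_a p e).
Proof. by move=> x [[]]. Qed.

Lemma Gamma_b_closure : Gamma_b p e `<=` closure (Omega_b p e).
Proof. by move=> x [[]]. Qed.

Lemma closure_Gamma_a : closure (Omega_a p e) `&` closure (Omega_c p e) `<=` Gamma_a p e.
Proof.
apply: boundary_disjoint; apply/seteqP; split => // x [ax [_ cx]].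
by apply: cx; left; exact: subset_closure.
Qed.

Lemma closure_Gamma_b : closure (Omega_b p e) `&` closure (Omega_c p e) `<=` Gamma_b p e.
Proof.
apply: boundary_disjoint; apply/seteqP; split => // x [ax [_ cx]].
by apply: cx; right; exact: subset_closure.
Qed.

(** The abscissas s and t are measured in units of e from the left end of cell
    k. *)
Definition crect (k : nat) (s t c d : R) : set (R * R) :=
  rect (e * (k%:R + s)) (e * (k%:R + t)) c d.

Lemma crectP k s t c d x : crect k s t c d x <->
  [/\ s < x.1 / e - k%:R, x.1 / e - k%:R < t, c < x.2 & x.2 < d].
Proof.
have lt1 u : (e * (k%:R + u) < x.1) = (u < x.1 / e - k%:R).
  by rewrite ltrBrDl ltr_pdivlMr// mulrC.
have lt2 u : (x.1 < e * (k%:R + u)) = (x.1 / e - k%:R < u).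
  by rewrite ltrBlDl ltr_pdivrMr// mulrC.
split.
- by move=> /rectP[h1 h2 h3 h4]; split; rewrite -?lt1 -?lt2.
- by move=> [h1 h2 h3 h4]; apply/rectP; split; rewrite ?lt1 ?lt2.
Qed.

Lemma rect_Omega_c (a b c d : R) : 0 <= a -> b <= L -> l1 <= c -> d <= l2 ->
  (forall x, rect a b c d x -> ~ Omega_a p e x /\ ~ Omega_b p e x) ->
  rect a b c d `<=` Omega_c p e.
Proof.
have [z1_gt0 z12 z23 z34 z4_lt1 l1_gt0 l12 l23] := ok.
move=> a0 bL c1 d2 avoid x Qx; have /rectP[x1 x2 x3 x4] := Qx.
split; first by clear avoid; apply/(rectP 0 L 0 l3 x); split; lra.
move=> [ax|bx].
- have : (rect a b c d `&` closure (Omega_a p e)) x by [].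
  rewrite open_disjoint_closure//; first exact: open_rect.
  by apply/seteqP; split=> // y [/avoid[+ _]].
- have : (rect a b c d `&` closure (Omega_b p e)) x by [].
  rewrite open_disjoint_closure//; first exact: open_rect.
  by apply/seteqP; split=> // y [/avoid[_]].
Qed.

Lemma crect_Omega_c k s t c d : 0 <= e * (k%:R + s) -> e * (k%:R + t) <= L ->
  l1 <= c -> d <= l2 ->
  (forall x j, crect k s t c d x -> (j < n)%N ->
     ~ [/\ z1 < x.1 / e - j%:R, x.1 / e - j%:R < z2, l1 + 1 < x.2 & x.2 <= l2] /\
     ~ [/\ z3 < x.1 / e - j%:R, x.1 / e - j%:R < z4, l1 <= x.2 & x.2 < l2 - 1]) ->
  crect k s t c d `<=` Omega_c p e.
Proof.
have [z1_gt0 z12 z23 z34 z4_lt1 l1_gt0 l12 l23] := ok.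
move=> a0 bL c1 d2 avoid; apply: rect_Omega_c => // x Qx.
have /crectP[x1 x2 x3 x4] := Qx.
split.
- move=> /Omega_aP[[_ _ y1 y2]|[j jn]]; first by clear avoid; lra.
  exact: (avoid x j Qx jn).1.
- move=> /Omega_bP[[_ _ y1 y2]|[j jn]]; first by clear avoid; lra.
  exact: (avoid x j Qx jn).2.
Qed.

Lemma column_a_sub k : (k < n)%N -> crect k z1 z2 l1 (l1 + 1) `<=` Omega_c p e.
Proof.
have [z1_gt0 z12 z23 z34 z4_lt1 l1_gt0 l12 l23] := ok.
move=> kn; have k0 : 0 <= k%:R :> R by [].
have kn' : k%:R + 1 <= n%:R :> R by rewrite natr1 ler_nat.
have lo : 0 <= e * (k%:R + z1) by apply: mulr_ge0; [exact: ltW e_gt0|lra].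
have hi : e * (k%:R + z2) <= L by rewrite Le ler_pM2l ?e_gt0//; lra.
apply: (crect_Omega_c lo hi); [lra|lra|].
move=> x j /crectP[x1 x2 x3 x4] jn; split=> -[y1 y2 y3 y4]; first lra.
  by have [jk|[jk|jk]] := nat_lt_dec j k; [subst j|..]; lra.
Qed.

Lemma column_b_sub k : (k < n)%N -> crect k z3 z4 (l2 - 1) l2 `<=` Omega_c p e.
Proof.
have [z1_gt0 z12 z23 z34 z4_lt1 l1_gt0 l12 l23] := ok.
move=> kn; have k0 : 0 <= k%:R :> R by [].
have kn' : k%:R + 1 <= n%:R :> R by rewrite natr1 ler_nat.
have lo : 0 <= e * (k%:R + z3) by apply: mulr_ge0; [exact: ltW e_gt0|lra].
have hi : e * (k%:R + z4) <= L by rewrite Le ler_pM2l ?e_gt0//; lra.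
apply: (crect_Omega_c lo hi); [lra|lra|].
move=> x j /crectP[x1 x2 x3 x4] jn; split=> -[y1 y2 y3 y4]; last lra.
  by have [jk|[jk|jk]] := nat_lt_dec j k; [subst j|..]; lra.
Qed.

Lemma gap_ab_sub k : (k < n)%N -> crect k z2 z3 (l1 + 1) (l2 - 1) `<=` Omega_c p e.
Proof.
have [z1_gt0 z12 z23 z34 z4_lt1 l1_gt0 l12 l23] := ok.
move=> kn; have k0 : 0 <= k%:R :> R by [].
have kn' : k%:R + 1 <= n%:R :> R by rewrite natr1 ler_nat.
have lo : 0 <= e * (k%:R + z2) by apply: mulr_ge0; [exact: ltW e_gt0|lra].
have hi : e * (k%:R + z3) <= L by rewrite Le ler_pM2l ?e_gt0//; lra.
apply: (crect_Omega_c lo hi); [lra|lra|].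
move=> x j /crectP[x1 x2 x3 x4] jn; split=> -[y1 y2 y3 y4];
  by have [jk|[jk|jk]] := nat_lt_dec j k; [subst j|..]; lra.
Qed.

(** This gap straddles the common side of the cells k and k + 1. *)
Lemma gap_ba_sub k : (k.+1 < n)%N -> crect k z4 (1 + z1) (l1 + 1) (l2 - 1) `<=` Omega_c p e.
Proof.
have [z1_gt0 z12 z23 z34 z4_lt1 l1_gt0 l12 l23] := ok.
move=> kn; have k0 : 0 <= k%:R :> R by [].
have kn' : k%:R + 1 + 1 <= n%:R :> R by rewrite !natr1 ler_nat.
have lo : 0 <= e * (k%:R + z4) by apply: mulr_ge0; [exact: ltW e_gt0|lra].
have hi : e * (k%:R + (1 + z1)) <= L by rewrite Le ler_pM2l ?e_gt0//; lra.
apply: (crect_Omega_c lo hi); [lra|lra|].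
move=> x j /crectP[x1 x2 x3 x4] jn; split=> -[y1 y2 y3 y4];
  have [jk|[jk|jk]] := nat_lt_dec j k; try (subst j; lra); try lra;
  have [jk'|[jk'|jk']] := nat_lt_dec j k.+1; try subst j; move: jk; rewrite -?natr1 => jk; try lra;
  move: jk'; rewrite -?natr1; lra.
Qed.

Lemma finger_a_sub k : (k < n)%N -> crect k z1 z2 (l1 + 1) l2 `<=` Omega_a p e.
Proof.
move=> kn x /crectP[x1 x2 x3 x4]; apply/Omega_aP; right; exists k => //.
by split=> //; exact: ltW.
Qed.

Lemma finger_b_sub k : (k < n)%N -> crect k z3 z4 l1 (l2 - 1) `<=` Omega_b p e.
Proof.
move=> kn x /crectP[x1 x2 x3 x4]; apply/Omega_bP; right; exists k => //.
by split=> //; exact: ltW.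
Qed.

Lemma slab_a_sub : rect 0 L l2 l3 `<=` Omega_a p e.
Proof. by move=> x /rectP[x1 x2 x3 x4]; apply/Omega_aP; left. Qed.

Lemma slab_b_sub : rect 0 L 0 l1 `<=` Omega_b p e.
Proof. by move=> x /rectP[x1 x2 x3 x4]; apply/Omega_bP; left. Qed.

End CombGeometry.

(** * Test functions have no flux through columns and gaps *)

Section CombFlux.
Context {R : realType}.
Variable p : comb_params R.
Notation z1 := (zeta1 p).
Notation z2 := (zeta2 p).
Notation z3 := (zeta3 p).
Notation z4 := (zeta4 p).
Notation L := (L p).
Notation l1 := (l1 p).
Notation l2 := (l2 p).
Notation l3 := (l3 p).
Notation mu := (@leb2 R).
Hypothesis ok : comb_ordered p.
Variables (n : nat) (e : R).
Hypothesis adm : [/\ (0 < n)%N, 0 < e & L = e * n%:R].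

Let e_gt0 : 0 < e. Proof. by case: adm. Qed.
Let Le : L = e * n%:R. Proof. by case: adm. Qed.

Section ZeroTraces.
Variable psi : H1 (Omega_c p e).
Hypotheses (tra : trace_eq (Gamma_a p e) psi (cst 0))
           (trb : trace_eq (Gamma_b p e) psi (cst 0)).

Let oO : open (Omega_c p e) := @open_Omega_c R p e.
Let Obox := @Omega_c_box R p e.

Lemma lt_cell (k : nat) s t : s < t -> e * (k%:R + s) < e * (k%:R + t).
Proof. by move=> st; rewrite ltr_pM2l// ltrD2l. Qed.

(** The column stands on the slab of the lower comb and ends at the tip of a finger of
    the upper one. *)
Lemma flux_column_a (k : nat) : (k < n)%N ->
  \int[mu]_(x in crect e k z1 z2 l1 (l1 + 1)) dx2 psi x = 0.
Proof.
have [z1_gt0 z12 z23 z34 z4_lt1 l1_gt0 l12 l23] := ok.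
have fa : l1 + 1 < l2 by lra.
move=> kn; have sub := column_a_sub ok adm kn.
have ab := lt_cell k z12.
have L0 : 0 < L by have [n0 e0 ->] := adm; rewrite mulr_gt0// ltr0n.
have cd : l1 < l1 + 1 by lra.
apply: (H1_flux_zero2 oO Obox _ _ ab cd sub trb tra).
- exact: closed_Gamma_b.
- exact: closed_Gamma_a.
- move=> t /andP[t1 t2]; apply: closure_Gamma_b; split.
    apply: (box_closure_rect _ _ (slab_b_sub adm)) => //.
    have tin : crect e k z1 z2 l1 (l1 + 1) (t, l1 + 1 / 2) by apply/rectP; split => //=; lra.
    have [/= u1 u2 _ _] := Omega_c_rect (sub _ tin).
    by apply/boxP; split => /=; lra.
  by apply: (box_closure_rect ab cd sub); apply/boxP; split => /=; lra.
- move=> t /andP[t1 t2]; apply: closure_Gamma_a; split.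
    apply: (box_closure_rect ab fa (finger_a_sub adm kn)).
    by apply/boxP; split => /=; lra.
  by apply: (box_closure_rect ab cd sub); apply/boxP; split => /=; lra.
Qed.

(** The column stands on the tip of a finger of the lower comb and ends at the slab of
    the upper one. *)
Lemma flux_column_b (k : nat) : (k < n)%N ->
  \int[mu]_(x in crect e k z3 z4 (l2 - 1) l2) dx2 psi x = 0.
Proof.
have [z1_gt0 z12 z23 z34 z4_lt1 l1_gt0 l12 l23] := ok.
have fb : l1 < l2 - 1 by lra.
move=> kn; have sub := column_b_sub ok adm kn.
have ab := lt_cell k z34.
have L0 : 0 < L by have [n0 e0 ->] := adm; rewrite mulr_gt0// ltr0n.
have cd : l2 - 1 < l2 by lra.
apply: (H1_flux_zero2 oO Obox _ _ ab cd sub trb tra).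
- exact: closed_Gamma_b.
- exact: closed_Gamma_a.
- move=> t /andP[t1 t2]; apply: closure_Gamma_b; split.
    apply: (box_closure_rect ab fb (finger_b_sub adm kn)).
    by apply/boxP; split => /=; lra.
  by apply: (box_closure_rect ab cd sub); apply/boxP; split => /=; lra.
- move=> t /andP[t1 t2]; apply: closure_Gamma_a; split.
    apply: (box_closure_rect _ _ (slab_a_sub adm)) => //.
    have tin : crect e k z3 z4 (l2 - 1) l2 (t, l2 - 1 / 2) by apply/rectP; split => //=; lra.
    have [/= u1 u2 _ _] := Omega_c_rect (sub _ tin).
    by apply/boxP; split => /=; lra.
  by apply: (box_closure_rect ab cd sub); apply/boxP; split => /=; lra.
Qed.

(** The gap lies between two fingers of the same cell, one of each comb. *)
Lemma flux_gap_ab (k : nat) : (k < n)%N ->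
  \int[mu]_(x in crect e k z2 z3 (l1 + 1) (l2 - 1)) dx1 psi x = 0.
Proof.
have [z1_gt0 z12 z23 z34 z4_lt1 l1_gt0 l12 l23] := ok.
have fa : l1 + 1 < l2 by lra.
have fb : l1 < l2 - 1 by lra.
move=> kn; have sub := gap_ab_sub ok adm kn.
have ab := lt_cell k z23.
have cd : l1 + 1 < l2 - 1 by lra.
apply: (H1_flux_zero1 oO Obox _ _ ab cd sub tra trb).
- exact: closed_Gamma_a.
- exact: closed_Gamma_b.
- move=> t /andP[t1 t2]; apply: closure_Gamma_a; split.
    apply: (box_closure_rect (lt_cell k z12) fa (finger_a_sub adm kn)).
    by have := lt_cell k z12; move=> *; apply/boxP; split => /=; lra.
  by apply: (box_closure_rect ab cd sub); apply/boxP; split => /=; lra.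
- move=> t /andP[t1 t2]; apply: closure_Gamma_b; split.
    apply: (box_closure_rect (lt_cell k z34) fb (finger_b_sub adm kn)).
    by have := lt_cell k z34; move=> *; apply/boxP; split => /=; lra.
  by apply: (box_closure_rect ab cd sub); apply/boxP; split => /=; lra.
Qed.

(** The gap lies between a finger of the lower comb and the finger of the upper comb in
    the next cell. *)
Lemma flux_gap_ba (k : nat) : (k.+1 < n)%N ->
  \int[mu]_(x in crect e k z4 (1 + z1) (l1 + 1) (l2 - 1)) dx1 psi x = 0.
Proof.
have [z1_gt0 z12 z23 z34 z4_lt1 l1_gt0 l12 l23] := ok.
have fa : l1 + 1 < l2 by lra.
have fb : l1 < l2 - 1 by lra.
move=> kn; have sub := gap_ba_sub ok adm kn.
have z41 : z4 < 1 + z1 by lra.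
have ab := lt_cell k z41.
have cd : l1 + 1 < l2 - 1 by lra.
have kE : e * (k%:R + (1 + z1)) = e * (k.+1%:R + z1) by rewrite addrA natr1.
apply: (H1_flux_zero1 oO Obox _ _ ab cd sub trb tra).
- exact: closed_Gamma_b.
- exact: closed_Gamma_a.
- move=> t /andP[t1 t2]; apply: closure_Gamma_b; split.
    apply: (box_closure_rect (lt_cell k z34) fb (finger_b_sub adm (ltnW kn))).
    by have := lt_cell k z34; move=> *; apply/boxP; split => /=; lra.
  by apply: (box_closure_rect ab cd sub); apply/boxP; split => /=; lra.
- move=> t /andP[t1 t2]; apply: closure_Gamma_a; split.
    apply: (box_closure_rect (lt_cell k.+1 z12) fa (finger_a_sub adm kn)).
    by rewrite kE; have := lt_cell k.+1 z12; move=> *; apply/boxP; split => /=; lra.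
  by apply: (box_closure_rect ab cd sub); apply/boxP; split => /=; lra.
Qed.

End ZeroTraces.

Definition crects (m : nat) (s t c d : R) : set (R * R) :=
  \big[setU/set0]_(k < m) crect e k s t c d.

Lemma crectsP m s t c d x : crects m s t c d x <->
  exists2 k : nat, (k < m)%N & crect e k s t c d x.
Proof.
rewrite /crects; elim: m => [|m ih].
  by rewrite big_ord0; split => // -[].
rewrite big_ord_recr /=; split.
  move=> [/ih[k km kx]|mx]; last by exists m.
  by exists k => //; exact: leqW.
move=> [k]; rewrite ltnS leq_eqVlt => /predU1P[->|km] kx; first by right.
by left; apply/ih; exists k.
Qed.

Lemma measurable_crects m s t c d : measurable (crects m s t c d : set (plane R)).
Proof.
rewrite /crects; apply: bigsetU_measurable => k _; exact: measurable_rect.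
Qed.

Lemma int_crects m s t c d q : 0 <= s -> t <= 1 + s ->
  mu.-integrable (crects m s t c d) (EFin \o q) ->
  (forall k, (k < m)%N -> \int[mu]_(x in crect e k s t c d) q x = 0) ->
  \int[mu]_(x in crects m s t c d) q x = 0.
Proof.
move=> s0 ts; elim: m => [|m ih] qi h.
  by rewrite /crects big_ord0 Rintegral_set0.
have E : crects m.+1 s t c d = crects m s t c d `|` crect e m s t c d.
  by rewrite /crects big_ord_recr.
rewrite E Rintegral_setU; last 4 first.
- exact: measurable_crects.
- exact: measurable_rect.
- by rewrite -E.
- apply/disj_setPS => x [/crectsP[k km /(crectP adm)[x1 x2 _ _]] /(crectP adm)[y1 y2 _ _]].
  have := km; rewrite -(ler_nat R) -natr1 => km'; lra.
rewrite h// addr0; apply: ih => [|k km]; last by apply: h; exact: leqW.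
apply: integrableS qi => //; try exact: measurable_crects.
by rewrite E; exact: subsetUl.
Qed.

Lemma int_indic (D U : set (R * R)) q : U `<=` D ->
  \int[mu]_(x in D) (\1_U x * q x) = \int[mu]_(x in U) q x.
Proof.
move=> UD; rewrite Rintegral_mkcond [RHS]Rintegral_mkcond.
congr (Rintegral _ _ _); apply/funext => x; rewrite !patchE indicE.
case: (boolP (x \in U)) => [/set_mem/UD/mem_set -> |_]; first by rewrite mul1r.
by rewrite mul0r if_same.
Qed.

(** The abscissas 0 and L are excluded, so the floor of x1 / e is the index of one of
    the n cells. *)
Lemma cell_index (x1 : R) : 0 < x1 -> x1 < L ->
  exists k : nat, [/\ (k < n)%N, 0 <= x1 / e - k%:R, x1 / e - k%:R < 1 &
    forall f, periodic_ext f (x1 / e) = f (x1 / e - k%:R)].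
Proof.
move=> x0 xL; have y0 : 0 < x1 / e by rewrite divr_gt0.
have yn : x1 / e < n%:R by rewrite ltr_pdivrMr// mulrC -Le.
have /andP[fl fu] := floor_itv (x1 / e).
have f0 : 0 <= Num.floor (x1 / e) by rewrite floor_ge0 ltW.
have [k kE] : exists k : nat, Num.floor (x1 / e) = k%:Z.
  by exists `|Num.floor (x1 / e)|%N; rewrite gez0_abs.
have kr : (Num.floor (x1 / e))%:~R = k%:R :> R by rewrite kE.
rewrite intrD kr in fu; rewrite kr in fl.
exists k; split; last by move=> f; rewrite /periodic_ext kr.
- by rewrite -(ltr_nat R); apply: le_lt_trans yn.
- by rewrite subr_ge0.
- by rewrite ltrBlDl.
Qed.

End CombFlux.

(** * A C^1 step function *)

Section Profiles.
Context {R : realType}.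
Implicit Types (t h : R).

Definition pospart t : R := Num.max t 0.

Lemma pospart_ge t : 0 <= t -> pospart t = t.
Proof. by move=> t0; rewrite /pospart max_l. Qed.

Lemma pospart_le t : t <= 0 -> pospart t = 0.
Proof. by move=> t0; rewrite /pospart max_r. Qed.

Lemma continuous_pospart : continuous pospart.
Proof.
move=> t; apply: (@continuous_max _ _ id (cst 0)) => //.
exact: cvg_cst.
Qed.

(** The square of the positive part has a derivative that is Lipschitz with
    constant 2, which gives a Taylor remainder bounded by s^2. *)
Lemma pospart2_taylor t s :
  `|pospart (s + t) ^+ 2 - pospart t ^+ 2 - 2 * pospart t * s| <= s ^+ 2.
Proof.
rewrite ler_norml /pospart /Num.max.
by case: ltP => ts; case: ltP => t0; apply/andP; split; nra.
Qed.

Lemma is_derive_pospart2 t : is_derive t 1 (fun s => pospart s ^+ 2) (2 * pospart t).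
Proof.
have l : (fun s : R => s^-1 *: (((fun s => pospart s ^+ 2) \o shift t) (s *: 1) - pospart t ^+ 2))
    @ 0^' --> (2 * pospart t : R).
  apply/cvgrPdist_le => eps eps0; near=> s.
  have s0 : s != 0 by near: s; exact: nbhs_dnbhs_neq.
  have se : `|s| <= eps.
    near: s; apply: cvg_within; apply/nbhs_ballP; exists eps => //= y.
    by rewrite /ball /= sub0r normrN => /ltW.
  rewrite /= [s *: 1]mulr1 distrC.
  rewrite (_ : _ - _ = s^-1 * (pospart (s + t) ^+ 2 - pospart t ^+ 2 - 2 * pospart t * s)); last first.
    by rewrite /GRing.scale /=; field.
  rewrite normrM normfV mulrC ler_pdivrMr ?normr_gt0//.
  apply: (le_trans (pospart2_taylor t s)).
  by rewrite -real_normK ?num_real// expr2 ler_wpM2r.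
apply: DeriveDef; first by apply/cvg_ex; exists (2 * pospart t).
exact: cvg_lim l.
Unshelve. all: by end_near. Qed.

Lemma is_derive_comp_affine (F f : R -> R) (a b t : R) :
  (forall x : R, is_derive x 1 F (f x)) ->
  is_derive t 1 (fun s => F (a * s + b)) (a * f (a * t + b)).
Proof.
move=> dF; have da : is_derive t 1 (fun s => a * s + b) a.
  apply: is_derive_eq; rewrite /GRing.scale /= ?mulr0 ?mulr1 ?addr0 ?add0r //.
by have := @is_derive1_comp _ F (fun s => a * s + b) t _ _ (dF (a * t + b)) da; rewrite mulrC.
Qed.

Lemma continuous_comp_affine (f : R -> R) (a b : R) :
  continuous f -> continuous (fun s => f (a * s + b)).
Proof.
move=> cf t; apply: (@continuous_comp _ _ _ (fun s => a * s + b) f); last exact: cf.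
by apply: cvgD; [apply: cvgM => //|]; exact: cvg_cst.
Qed.

(** A C^1 function equal to 0 for t <= 0 and to t for t >= h.  The coefficients 3, -4
    and 1 of the quadratic spline with knots 0, h/2 and h are those for which the
    value at h is h, the slope there is 1 and the curvature beyond h is 0. *)
Definition corner h t : R := (3 * pospart t ^+ 2 - 4 * pospart (t - h / 2) ^+ 2
  + pospart (t - h) ^+ 2) / (2 * h).
Definition dcorner h t : R :=
  (3 * pospart t - 4 * pospart (t - h / 2) + pospart (t - h)) / h.

Section Corner.
Variable h : R.
Hypothesis h_gt0 : 0 < h.

Lemma continuous_dcorner : continuous (dcorner h).
Proof.
have cs b : continuous (fun s => pospart (s - b)).
  move=> t; have := @continuous_comp_affine pospart 1 (- b) continuous_pospart t.
  by under eq_fun do rewrite mul1r.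
move=> t; apply: cvgM; last exact: cvg_cst.
apply: cvgD; last exact: cs.
apply: cvgB; apply: cvgM; try exact: cvg_cst; last exact: cs.
exact: continuous_pospart.
Qed.

Lemma is_derive_corner t : is_derive t 1 (corner h) (dcorner h t).
Proof.
have ds b : is_derive t 1 (fun s => pospart (s - b) ^+ 2) (2 * pospart (t - b)).
  have := @is_derive_comp_affine (fun s => pospart s ^+ 2) (fun s => 2 * pospart s) 1 (- b) t
    is_derive_pospart2.
  by rewrite !mul1r; under eq_fun do rewrite mul1r.
have d0 := is_derive_pospart2 t.
have d1 := ds (h / 2); have d2 := ds h.
apply: is_derive_eq; rewrite /dcorner /GRing.scale /=.
by field; rewrite gt_eqF.
Qed.

Lemma dcorner_le t : t <= 0 -> dcorner h t = 0.
Proof.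
have h0 := h_gt0.
move=> t0; by rewrite /dcorner !pospart_le; lra.
Qed.

Lemma corner_le t : t <= 0 -> corner h t = 0.
Proof.
have h0 := h_gt0.
move=> t0; by rewrite /corner !pospart_le; nra.
Qed.

Lemma corner_ge t : h <= t -> corner h t = t.
Proof.
have h0 := h_gt0.
move=> ht; rewrite /corner !pospart_ge; try lra.
by field; rewrite gt_eqF.
Qed.

Lemma dcorner_ge t : h <= t -> dcorner h t = 1.
Proof.
have h0 := h_gt0.
move=> ht; rewrite /dcorner !pospart_ge; try lra.
by field; rewrite gt_eqF.
Qed.

Lemma dcorner_bound t : 0 <= dcorner h t <= 3 / 2.
Proof.
have h0 := h_gt0.
rewrite /dcorner ler_pdivlMr// ler_pdivrMr// mul0r /pospart /Num.max.
by case: ltP => a; case: ltP => b; case: ltP => c; apply/andP; split; lra.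
Qed.

Lemma corner_ge0 t : 0 <= corner h t.
Proof.
have h0 := h_gt0.
rewrite /corner ler_pdivlMr ?mulr_gt0// mul0r /pospart /Num.max.
by case: ltP => a; case: ltP => b; case: ltP => c; nra.
Qed.

Lemma corner_small t : t <= h -> corner h t <= h.
Proof.
have h0 := h_gt0.
move=> th; rewrite /corner ler_pdivrMr ?mulr_gt0// /pospart /Num.max.
by case: ltP => a; case: ltP => b; case: ltP => c; nra.
Qed.

End Corner.

(** The inner [corner] rounds the kink at 0 of the function that clamps t to [0, 1],
    and the outer one, applied to the complement to 1, rounds the kink at 1.  The
    slope is exactly 1 on [h, 1 - h]. *)
Definition step h t : R := 1 - corner h (1 - corner h t).
Definition dstep h t : R := dcorner h (1 - corner h t) * dcorner h t.

Section Step.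
Variable h : R.
Hypothesis h_gt0 : 0 < h.
Hypothesis h_half : h <= 1 / 2.

Lemma continuous_corner : continuous (corner h).
Proof.
move=> t; apply: differentiable_continuous; apply/derivable1_diffP.
by case: (is_derive_corner h_gt0 t).
Qed.

Lemma continuous_dstep : continuous (dstep h).
Proof.
move=> t; apply: cvgM; last exact: continuous_dcorner.
apply: (@continuous_comp _ _ _ (fun s => 1 - corner h s) (dcorner h)).
  by apply: cvgB; [exact: cvg_cst|exact: continuous_corner].
exact: continuous_dcorner.
Qed.

Lemma is_derive_step t : is_derive t 1 (step h) (dstep h t).
Proof.
have d1 := is_derive_corner h_gt0 t.
have d2 : is_derive t 1 (fun s => 1 - corner h s) (- dcorner h t).
  by rewrite -[- _]sub0r; exact: (is_deriveB (is_derive_cst _ _ _) d1).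
have d3 := @is_derive1_comp _ (corner h) (fun s => 1 - corner h s) t _ _ (is_derive_corner h_gt0 (1 - corner h t)) d2.
have : is_derive t 1 (fun s => 1 - (corner h \o (fun s => 1 - corner h s)) s)
    (0 - dcorner h (1 - corner h t) * - dcorner h t).
  exact: is_deriveB.
by rewrite mulrN sub0r opprK.
Qed.

Lemma step_le t : t <= 0 -> step h t = 0.
Proof.
have hh := h_half; have h0 := h_gt0; move=> t0; rewrite /step (corner_le h_gt0 t0) subr0 corner_ge ?subrr//.
by lra.
Qed.

Lemma step_ge t : 1 <= t -> step h t = 1.
Proof.
move=> t1; have hh := h_half; have h0 := h_gt0; rewrite /step (@corner_ge h h_gt0 t); last lra.
by rewrite corner_le ?subr0//; lra.
Qed.

Lemma dstep_le t : t <= 0 -> dstep h t = 0.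
Proof. by move=> t0; rewrite /dstep (dcorner_le h_gt0 t0) mulr0. Qed.

Lemma dstep_ge t : 1 <= t -> dstep h t = 0.
Proof.
move=> t1; have hh := h_half; have h0 := h_gt0; rewrite /dstep (@corner_ge h h_gt0 t); last lra.
by rewrite dcorner_le ?mul0r//; lra.
Qed.

Lemma dstep_mid t : h <= t -> t <= 1 - h -> dstep h t = 1.
Proof.
move=> t0 t1; rewrite /dstep corner_ge// !dcorner_ge ?mulr1//; lra.
Qed.

Lemma dstep_bound t : 0 <= dstep h t <= 9 / 4.
Proof.
have /andP[a b] := dcorner_bound h_gt0 t.
have /andP[c d] := dcorner_bound h_gt0 (1 - corner h t).
by rewrite /dstep; apply/andP; split; nra.
Qed.

Lemma step_bound t : 0 <= step h t <= 1.
Proof.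
have hh := h_half; have h0 := h_gt0.
rewrite /step; apply/andP; split; last first.
  by rewrite lerBlDr lerDl corner_ge0.
rewrite subr_ge0; have := corner_ge0 h_gt0 t.
set s := corner h t => s0.
have [|] := leP (1 - s) h; first by move=> /(corner_small h_gt0); lra.
by move=> /ltW/(corner_ge h_gt0) ->; lra.
Qed.

End Step.

End Profiles.

(** * Ramps, plateaus and their periodic repetition *)

Section Ramps.
Context {R : realType}.
Implicit Types (t h a b : R).

Definition ramp h a b t : R := step h ((t - a) / (b - a)).
Definition dramp h a b t : R := dstep h ((t - a) / (b - a)) / (b - a).

Section Ramp.
Variables h a b : R.
Hypotheses (h_gt0 : 0 < h) (h_half : h <= 1 / 2) (ab : a < b).

Lemma is_derive_ramp t : is_derive t 1 (ramp h a b) (dramp h a b t).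
Proof.
have ba : b - a != 0 by rewrite gt_eqF// subr_gt0.
have := @is_derive_comp_affine R (step h) (dstep h) (b - a)^-1 (- (a / (b - a))) t
  (is_derive_step h_gt0).
rewrite (_ : (b - a)^-1 * t + _ = (t - a) / (b - a)); last by field.
have -> : (fun s => step h ((b - a)^-1 * s + - (a / (b - a)))) = ramp h a b.
  by apply/funext => s; rewrite /ramp; congr (step h _); field.
by rewrite mulrC.
Qed.

Lemma continuous_dramp : continuous (dramp h a b).
Proof.
move=> t; apply: cvgM; last exact: cvg_cst.
have := @continuous_comp_affine R (dstep h) (b - a)^-1 (- (a / (b - a)))
  (continuous_dstep h_gt0) t.
have ba : b - a != 0 by rewrite gt_eqF// subr_gt0.
by have -> : (fun s => dstep h ((b - a)^-1 * s + - (a / (b - a)))) =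
   (fun s => dstep h ((s - a) / (b - a)))
  by apply/funext => s; congr (dstep h _); field.
Qed.

Lemma ramp_le t : t <= a -> ramp h a b t = 0 /\ dramp h a b t = 0.
Proof.
move=> ta; have u0 : (t - a) / (b - a) <= 0.
  by rewrite pmulr_lle0 ?invr_gt0 ?subr_gt0// subr_le0.
by rewrite /ramp /dramp step_le// dstep_le// mul0r.
Qed.

Lemma ramp_ge t : b <= t -> ramp h a b t = 1 /\ dramp h a b t = 0.
Proof.
move=> tb; have u0 : 1 <= (t - a) / (b - a).
  by rewrite ler_pdivlMr ?subr_gt0// mul1r lerD2r.
by rewrite /ramp /dramp step_ge// dstep_ge// mul0r.
Qed.

Lemma ramp_bound t : 0 <= ramp h a b t <= 1.
Proof. exact: step_bound. Qed.

Lemma dramp_bound t : 0 <= dramp h a b t <= 9 / 4 / (b - a).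
Proof.
have /andP[d0 d1] := dstep_bound h_gt0 ((t - a) / (b - a)).
rewrite /dramp divr_ge0 ?subr_ge0 ?(ltW ab)//=.
by rewrite ler_pM2r ?invr_gt0 ?subr_gt0.
Qed.

(** The step has slope 1 on [h, 1 - h]; rescaled to a width of at most 1, this contains
    [a + h, b - h]. *)
Lemma dramp_mid t : b - a <= 1 -> a + h <= t -> t <= b - h ->
  dramp h a b t = (b - a)^-1.
Proof.
move=> ba1 t1 t2; have ba := ab; have h0 := h_gt0.
rewrite /dramp dstep_mid ?mul1r//.
- by rewrite ler_pdivlMr ?subr_gt0//; nra.
- by rewrite ler_pdivrMr ?subr_gt0//; nra.
Qed.

End Ramp.

Definition plateau h a1 a2 b1 b2 t : R := ramp h a1 a2 t - ramp h b1 b2 t.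
Definition dplateau h a1 a2 b1 b2 t : R := dramp h a1 a2 t - dramp h b1 b2 t.

Section Plateau.
Variables h a1 a2 b1 b2 : R.
Hypotheses (h_gt0 : 0 < h) (h_half : h <= 1 / 2).
Hypotheses (a12 : a1 < a2) (ab : a2 <= b1) (b12 : b1 < b2).

Lemma is_derive_plateau t : is_derive t 1 (plateau h a1 a2 b1 b2) (dplateau h a1 a2 b1 b2 t).
Proof. exact: (is_deriveB (is_derive_ramp h_gt0 a12 t) (is_derive_ramp h_gt0 b12 t)). Qed.

Lemma continuous_dplateau : continuous (dplateau h a1 a2 b1 b2).
Proof. by move=> t; apply: cvgB; exact: continuous_dramp. Qed.

Lemma plateau_out t : t <= a1 \/ b2 <= t ->
  plateau h a1 a2 b1 b2 t = 0 /\ dplateau h a1 a2 b1 b2 t = 0.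
Proof.
have [[h1 h2] h3] := (a12, ab, b12).
rewrite /plateau /dplateau => -[ta|tb].
  have [-> ->] := ramp_le h_gt0 h_half a12 ta.
  have [|-> ->] := ramp_le h_gt0 h_half b12 (t := t); first lra.
  by rewrite subrr.
have [-> ->] := ramp_ge h_gt0 h_half b12 tb.
have [|-> ->] := ramp_ge h_gt0 h_half a12 (t := t); first lra.
by rewrite !subrr.
Qed.

Lemma plateau_top t : a2 <= t -> t <= b1 ->
  plateau h a1 a2 b1 b2 t = 1 /\ dplateau h a1 a2 b1 b2 t = 0.
Proof.
move=> ta tb; rewrite /plateau /dplateau.
have [-> ->] := ramp_ge h_gt0 h_half a12 ta.
have [-> ->] := ramp_le h_gt0 h_half b12 tb.
by rewrite subr0 subrr.
Qed.

Lemma plateau_bound t : 0 <= plateau h a1 a2 b1 b2 t <= 1.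
Proof.
have /andP[p1 p2] := ramp_bound a1 a2 h_gt0 h_half t.
have /andP[q1 q2] := ramp_bound b1 b2 h_gt0 h_half t.
rewrite /plateau; have [ta|ta] := leP t b1.
  by have [-> _] := ramp_le h_gt0 h_half b12 ta; apply/andP; split; lra.
have [[h1 h2] h3] := (a12, ab, b12).
have [|-> _] := ramp_ge h_gt0 h_half a12 (t := t); first lra.
by apply/andP; split; lra.
Qed.

Lemma dplateau_bound (c : R) t : 0 < c -> c <= a2 - a1 -> c <= b2 - b1 ->
  `|dplateau h a1 a2 b1 b2 t| <= 9 / 4 / c.
Proof.
move=> c0 ca cb.
have /andP[p1 p2] := dramp_bound h_gt0 a12 t.
have /andP[q1 q2] := dramp_bound h_gt0 b12 t.
have le1 (w : R) : c <= w -> 9 / 4 / w <= 9 / 4 / c.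
  move=> cw; rewrite ler_pM2l ?divr_gt0// lef_pV2//; rewrite posrE//.
  exact: lt_le_trans cw.
have p3 := le_trans p2 (le1 _ ca); have q3 := le_trans q2 (le1 _ cb).
by rewrite /dplateau ler_norml; apply/andP; split; lra.
Qed.

Lemma dplateau_up t : a2 - a1 <= 1 -> a1 + h <= t -> t <= a2 - h ->
  dplateau h a1 a2 b1 b2 t = (a2 - a1)^-1.
Proof.
have [[h1 h2] h3] := (h_gt0, ab, b12).
move=> w1 t1 t2; rewrite /dplateau dramp_mid//.
by have [|_ ->] := ramp_le h_gt0 h_half b12 (t := t); [lra|rewrite subr0].
Qed.

Lemma dplateau_down t : b2 - b1 <= 1 -> b1 + h <= t -> t <= b2 - h ->
  dplateau h a1 a2 b1 b2 t = - (b2 - b1)^-1.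
Proof.
have [[h1 h2] h3] := (h_gt0, ab, b12).
move=> w1 t1 t2; rewrite /dplateau (@dramp_mid h b1 b2)//.
by have [|_ ->] := ramp_ge h_gt0 h_half a12 (t := t); [lra|rewrite sub0r].
Qed.

End Plateau.

Definition comb (m : nat) (f : R -> R) (y : R) : R := \sum_(k < m) f (y - k%:R).

Lemma comb_recr m f y : comb m.+1 f y = comb m f y + f (y - m%:R).
Proof. by rewrite /comb big_ord_recr. Qed.

Lemma is_derive_comb m (f df : R -> R) (y : R) :
  (forall x : R, is_derive x 1 f (df x)) -> is_derive y 1 (comb m f) (comb m df y).
Proof.
move=> d; elim: m => [|m ih].
  rewrite /comb big_ord0.
  have -> : (fun y : R => \sum_(k < 0) f (y - k%:R)) = cst 0.
    by apply/funext => s; rewrite big_ord0.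
  exact: is_derive_cst.
have -> : comb m.+1 f = (fun y => comb m f y + f (1 * y + - m%:R)).
  by apply/funext => s; rewrite comb_recr mul1r.
rewrite comb_recr; apply: is_deriveD.
have := @is_derive_comp_affine R f df 1 (- m%:R) y d.
by rewrite !mul1r.
Qed.

Lemma continuous_comb m (f : R -> R) : continuous f -> continuous (comb m f).
Proof.
move=> cf; elim: m => [|m ih].
  have -> : comb 0 f = cst 0 by apply/funext => s; rewrite /comb big_ord0.
  by move=> y; exact: cvg_cst.
have -> : comb m.+1 f = (fun y => comb m f y + f (1 * y + - m%:R)).
  by apply/funext => s; rewrite comb_recr mul1r.
move=> y; apply: cvgD; first exact: ih.
exact: (@continuous_comp_affine R f 1 (- m%:R) cf).
Qed.

(** A profile supported in an interval of length 1 has translates with disjoint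
    supports, so that only one term of the sum is nonzero. *)
Lemma comb_eval m (f : R -> R) (al y : R) (k : nat) :
  (forall t, t <= al \/ al + 1 <= t -> f t = 0) -> (k < m)%N ->
  al <= y - k%:R -> y - k%:R <= al + 1 -> comb m f y = f (y - k%:R).
Proof.
move=> f0 km y1 y2; rewrite /comb (bigD1 (Ordinal km))//= big1 ?addr0// => j.
move=> /eqP jk; apply: f0.
have : (j < k)%N \/ (k < j)%N.
  case: (ltngtP j k) => [|| jk']; [by left|by right|exfalso; apply: jk].
  exact: val_inj.
case=> lt; [right|left]; move: lt; rewrite -(ler_nat R) -natr1; lra.
Qed.

End Ramps.

(** * Step functions on rectangles *)

Section StepFunctions.
Context {R : realType}.
Notation mu := (@leb2 R).
Implicit Types s : seq (R * ((R * R) * (R * R))).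

(** An item (w, ((a, b), (c, d))) stands for w times the indicator of ]a, b[ x ]c, d[.
    Lists of items encode the pointwise bounds of the error, and their [stepmass] is
    then computed term by term. *)
Definition rect_of (q : (R * R) * (R * R)) : set (R * R) :=
  rect q.1.1 q.1.2 q.2.1 q.2.2.
Definition area (q : (R * R) * (R * R)) : R := (q.1.2 - q.1.1) * (q.2.2 - q.2.1).
Definition wellformed (i : R * ((R * R) * (R * R))) : Prop :=
  [/\ 0 <= i.1, i.2.1.1 <= i.2.1.2 & i.2.2.1 <= i.2.2.2].

Definition stepfun s (x : R * R) : R := \sum_(i <- s) i.1 * \1_(rect_of i.2) x.
Definition stepmass s : R := \sum_(i <- s) i.1 * area i.2.

Lemma stepfun_cons i s x : stepfun (i :: s) x = i.1 * \1_(rect_of i.2) x + stepfun s x.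
Proof. by rewrite /stepfun big_cons. Qed.

Lemma stepfun_ge0 s x : (forall i, i \in s -> wellformed i) -> 0 <= stepfun s x.
Proof.
elim: s => [|i s ih] wf; first by rewrite /stepfun big_nil.
rewrite stepfun_cons addr_ge0//; last first.
  by apply: ih => j js; apply: wf; rewrite inE js orbT.
by have [i0 _ _] := wf i (mem_head _ _); rewrite mulr_ge0// indicE.
Qed.

Lemma stepfun_ge s x i : (forall i, i \in s -> wellformed i) ->
  i \in s -> rect_of i.2 x -> i.1 <= stepfun s x.
Proof.
elim: s => [|j s ih] wf //; have wf' : forall i, i \in s -> wellformed i.
  by move=> k ks; apply: wf; rewrite inE ks orbT.
rewrite inE stepfun_cons => /predU1P[->|si] qx.
  by rewrite indicE mem_set// mulr1 lerDl; exact: stepfun_ge0.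
apply: (le_trans (ih wf' si qx)); rewrite lerDr.
by have [i0 _ _] := wf j (mem_head _ _); rewrite mulr_ge0// indicE.
Qed.

Lemma int_stepfun_le s (O : set (R * R)) : measurable (O : set (plane R)) ->
  (mu O < +oo)%E -> (forall i, i \in s -> wellformed i) ->
  mu.-integrable O (EFin \o stepfun s) /\ \int[mu]_(x in O) stepfun s x <= stepmass s.
Proof.
move=> mO Ofin; elim: s => [|i s ih] wf.
  have -> : stepfun [::] = cst 0 by apply/funext => x; rewrite /stepfun big_nil.
  split; first by apply: (@eq_integrable _ _ _ mu O mO (cst 0%E)) => //; exact: integrable0.
  by rewrite Rintegral_cst// mul0r /stepmass big_nil.
have [|si sl] := ih; first by move=> j js; apply: wf; rewrite inE js orbT.
have [i0 i1 i2] := wf i (mem_head _ _).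
have mQ : measurable (rect_of i.2 : set (plane R)) by exact: measurable_rect.
have Qi : mu.-integrable O (EFin \o \1_(rect_of i.2)).
  apply: sqint_integrable => //; apply: (@bounded_sqint _ _ _ _ _ _ 1) => //.
  by move=> x _; rewrite indicE; case: (_ \in _); rewrite ?normr1 ?normr0.
have -> : stepfun (i :: s) = (fun x => i.1 * \1_(rect_of i.2) x + stepfun s x).
  by apply/funext => x; rewrite stepfun_cons.
split; first by apply: integrable_addr => //; exact: integrable_mulrl.
rewrite RintegralD//; last exact: integrable_mulrl.
rewrite RintegralZl// /stepmass big_cons lerD// ler_wpM2l//.
rewrite /Rintegral integral_indic// -lee_fin fineK; last first.
  have : (mu (rect_of i.2 `&` O) < +oo)%E.
    apply: le_lt_trans Ofin; apply: le_measure; rewrite ?inE//.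
    exact: measurableI.
  by move=> lty; rewrite ge0_fin_numE.
rewrite /area -(rect_measure i1 i2); apply: le_measure; rewrite ?inE//.
exact: measurableI.
Qed.

Lemma stepmass_cons i s : stepmass (i :: s) = i.1 * area i.2 + stepmass s.
Proof. by rewrite /stepmass big_cons. Qed.

Lemma stepmass_cat s1 s2 : stepmass (s1 ++ s2) = stepmass s1 + stepmass s2.
Proof. by rewrite /stepmass big_cat. Qed.

End StepFunctions.

(** * The competitor *)

Section Shifts.
Context {R : realType}.
Implicit Types (z h : R).

Lemma left_shift z h : 0 < h -> z - h < z. Proof. by move=> h0; lra. Qed.
Lemma right_shift z h : 0 < h -> z < z + h. Proof. by move=> h0; lra. Qed.

Lemma sq_le (u c : R) : - c <= u -> u <= c -> u ^+ 2 <= c ^+ 2.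
Proof. by move=> ? ?; nra. Qed.

Lemma closure_cst (O : set (R * R)) (w : R * R -> R) (c : R) : continuous w ->
  (forall x, O x -> w x = c) -> forall x, closure O x -> w x = c.
Proof.
move=> cw wO x Ox.
have cl : closed (w @^-1` [set c]).
  by apply: closed_comp => [y _|]; [exact: cw|exact: closed_eq].
have sub : O `<=` w @^-1` [set c] by move=> y /wO.
by move: Ox; rewrite closureE => /(_ _ (conj cl sub)).
Qed.

Variable p : comb_params R.

(** g bounds from below the gap between the two fingers of a cell and the half gaps at
    the ends of the cell: a plateau widened by h <= g stays within its cell and does not
    reach the other finger. *)
Record gap_bound (g : R) : Prop := GapBound {
  gap_gt0 : 0 < g; gap_half : g <= 1 / 2; gap_z1 : g <= zeta1 p;
  gap_z4 : g <= 1 - zeta4 p; gap_z23 : g <= zeta3 p - zeta2 p }.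

Lemma gap_bound_half g h : gap_bound g -> h <= g -> h <= 1 / 2.
Proof. by move=> [_ gh _ _ _] hg; lra. Qed.

Lemma cell_size_gt0 n (e : R) : [/\ (0 < n)%N, 0 < e & L p = e * n%:R] -> 0 < e.
Proof. by case. Qed.

Lemma length_gt0 n (e : R) : [/\ (0 < n)%N, 0 < e & L p = e * n%:R] -> 0 < L p.
Proof. by move=> [n0 e0 ->]; rewrite mulr_gt0// ltr0n. Qed.

Lemma zeta41 : comb_ordered p -> zeta4 p - 1 < zeta1 p.
Proof. by move=> []; lra. Qed.

Lemma strip_weight_ge g : gap_bound g -> 36 <= 36 / g ^+ 2.
Proof.
move=> [g0 g1 _ _ _]; rewrite ler_pdivlMr ?exprn_gt0// ler_piMr//.
by rewrite expr_le1//; lra.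
Qed.

End Shifts.

Section Competitor.
Context {R : realType}.
Variable p : comb_params R.
Notation z1 := (zeta1 p).
Notation z2 := (zeta2 p).
Notation z3 := (zeta3 p).
Notation z4 := (zeta4 p).
Notation L := (L p).
Notation l1 := (l1 p).
Notation l2 := (l2 p).
Notation l3 := (l3 p).
Notation mu := (@leb2 R).
Hypothesis ok : comb_ordered p.
Variables (n : nat) (e : R).
Hypothesis adm : [/\ (0 < n)%N, 0 < e & L = e * n%:R].
Hypothesis e_small : 2 * e <= l2 - l1 - 2.
Variables g h : R.
Hypotheses (gb : gap_bound p g) (h_gt0 : 0 < h) (hg : h <= g).

Local Notation h_half := (gap_bound_half gb hg).
Local Notation e_gt0 := (cell_size_gt0 adm).
Local Notation L_gt0 := (length_gt0 adm).
Local Notation a12 := (left_shift z1 h_gt0).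
Local Notation a34 := (right_shift z2 h_gt0).
Local Notation b12 := (left_shift z3 h_gt0).
Local Notation b34 := (right_shift z4 h_gt0).
Local Notation w12 := (zeta41 ok).
Local Notation z12' := (ltW (zeta12 ok)).
Local Notation z34' := (ltW (zeta34 ok)).
Local Notation z23' := (zeta23 ok).
Local Notation t1lt := (right_shift (l1 + 1) e_gt0).
Local Notation t3lt := (left_shift (l2 - 1) e_gt0).
Local Notation m1lt := (right_shift l1 ltr01).
Local Notation r3lt := (left_shift l2 ltr01).
Local Notation t1 := (ramp h (l1 + 1) (l1 + 1 + e)).
Local Notation dt1 := (dramp h (l1 + 1) (l1 + 1 + e)).
Local Notation t3 := (ramp h (l2 - 1 - e) (l2 - 1)).
Local Notation dt3 := (dramp h (l2 - 1 - e) (l2 - 1)).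
Local Notation m1 := (ramp h l1 (l1 + 1)).
Local Notation dm1 := (dramp h l1 (l1 + 1)).
Local Notation r3 := (ramp h (l2 - 1) l2).
Local Notation dr3 := (dramp h (l2 - 1) l2).

(** [plat_a] and [plat_b] smooth the indicators of omega_a and omega_b.  [plat_w]
    smooths phi2, on the period that starts at z4 - 1 instead of 0, because phi2 is
    positive at the integers and zero at z4. *)
Definition plat_a := plateau h (z1 - h) z1 z2 (z2 + h).
Definition dplat_a := dplateau h (z1 - h) z1 z2 (z2 + h).
Definition plat_b := plateau h (z3 - h) z3 z4 (z4 + h).
Definition dplat_b := dplateau h (z3 - h) z3 z4 (z4 + h).
Definition plat_w := plateau h (z4 - 1) z1 z2 z3.
Definition dplat_w := dplateau h (z4 - 1) z1 z2 z3.

Definition Xa (s : R) := comb n.+1 plat_a (s / e).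
Definition dXa (s : R) := comb n.+1 dplat_a (s / e).
Definition Xb (s : R) := comb n.+1 plat_b (s / e).
Definition dXb (s : R) := comb n.+1 dplat_b (s / e).
Definition Xw (s : R) := comb n.+1 plat_w (s / e).
Definition dXw (s : R) := comb n.+1 dplat_w (s / e).

(** The functions of x2 are ramps: m1 and r3 across the lower and the upper layer,
    t1 and t3 across the two gluing strips of height e at the ends of the middle zone.
    The weights 1 - t1, t1 (1 - t3) and t1 t3 add up to 1 and select smoothed versions
    of phi1, of phi2 and of phi3 respectively.  In the gluing strips the vertical slope
    is O(1 / e), hence O(1) after multiplication by e, on an area O(e). *)
Definition competitor (x : R * R) : R :=
  (1 - t1 x.2) * m1 x.2 * Xa x.1 + t1 x.2 * (1 - t3 x.2) * Xw x.1
  + t1 x.2 * t3 x.2 * (1 - (1 - r3 x.2) * Xb x.1).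
Definition competitor_dx1 (x : R * R) : R :=
  ((1 - t1 x.2) * m1 x.2 * dXa x.1 + t1 x.2 * (1 - t3 x.2) * dXw x.1
  - t1 x.2 * t3 x.2 * (1 - r3 x.2) * dXb x.1) / e.
Definition competitor_dx2 (x : R * R) : R :=
  ((1 - t1 x.2) * dm1 x.2 - dt1 x.2 * m1 x.2) * Xa x.1 +
  (dt1 x.2 * (1 - t3 x.2) - t1 x.2 * dt3 x.2) * Xw x.1 +
  (dt1 x.2 * t3 x.2 + t1 x.2 * dt3 x.2) * (1 - (1 - r3 x.2) * Xb x.1) +
  t1 x.2 * t3 x.2 * dr3 x.2 * Xb x.1.

Lemma hasC1_comb (f df : R -> R) : (forall x : R, is_derive x 1 f (df x)) -> continuous df ->
  hasC1 (fun x => comb n.+1 f (x.1 / e)) (fun x => comb n.+1 df (x.1 / e) / e) (cst 0).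
Proof.
move=> d cd; apply: (@hasC1_fst _ (fun s => comb n.+1 f (s / e)) (fun s => comb n.+1 df (s / e) / e)).
  move=> s; apply: cvgM; last exact: cvg_cst.
  have := @continuous_comp_affine R _ e^-1 0 (@continuous_comb _ n.+1 _ cd) s.
  by under eq_fun do rewrite addr0 mulrC.
move=> s.
have := @is_derive_comp_affine R _ _ e^-1 0 s (fun y => @is_derive_comb _ n.+1 f df y d).
rewrite addr0 mulrC [_^-1 * s]mulrC.
by under eq_fun do rewrite addr0 mulrC.
Qed.

Lemma hasC1_ramp (a b : R) : a < b ->
  hasC1 (fun x => ramp h a b x.2) (cst 0) (fun x => dramp h a b x.2).
Proof.
move=> ab; apply: hasC1_snd; first exact: continuous_dramp.
by move=> s; exact: is_derive_ramp.
Qed.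

Lemma hasC1_comp : hasC1 competitor competitor_dx1 competitor_dx2.
Proof.
have Ha := hasC1_comb (is_derive_plateau h_gt0 a12 a34) (continuous_dplateau h_gt0 a12 a34).
have Hb := hasC1_comb (is_derive_plateau h_gt0 b12 b34) (continuous_dplateau h_gt0 b12 b34).
have Hw := hasC1_comb (is_derive_plateau h_gt0 w12 z23') (continuous_dplateau h_gt0 w12 z23').
have T1 := hasC1_ramp t1lt; have T3 := hasC1_ramp t3lt.
have M1 := hasC1_ramp m1lt; have R3 := hasC1_ramp r3lt.
have one := @hasC1_cst R 1.
have A1 := hasC1M (hasC1M (hasC1B one T1) M1) Ha.
have A2 := hasC1M (hasC1M T1 (hasC1B one T3)) Hw.
have A3 := hasC1M (hasC1M T1 T3) (hasC1B one (hasC1M (hasC1B one R3) Hb)).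
apply: hasC1_eq (hasC1D (hasC1D A1 A2) A3) _ _ _ => x //=.
- by rewrite /competitor_dx1 /dXa /dXb /dXw /Xa /Xb /Xw; ring.
- by rewrite /competitor_dx2 /dXa /dXb /dXw /Xa /Xb /Xw; ring.
Qed.

Lemma Xa_eval (s : R) (k : nat) : (k < n.+1)%N -> 0 <= s / e - k%:R -> s / e - k%:R <= 1 ->
  Xa s = plat_a (s / e - k%:R) /\ dXa s = dplat_a (s / e - k%:R).
Proof.
move=> kn u0 u1; have [g0 g1 g2 g3 g4] := gb; have hg' := hg; have h0 := h_gt0.
have [y1 y2 y3 y4 y5 y6 y7 y8] := ok.
have out t : t <= 0 \/ 0 + 1 <= t -> plat_a t = 0 /\ dplat_a t = 0.
  by move=> tt; apply: plateau_out => //; lra.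
by split; apply: (@comb_eval _ _ _ 0) => //; try lra; move=> t /out[].
Qed.

Lemma Xb_eval (s : R) (k : nat) : (k < n.+1)%N -> 0 <= s / e - k%:R -> s / e - k%:R <= 1 ->
  Xb s = plat_b (s / e - k%:R) /\ dXb s = dplat_b (s / e - k%:R).
Proof.
move=> kn u0 u1; have [g0 g1 g2 g3 g4] := gb; have hg' := hg; have h0 := h_gt0.
have [y1 y2 y3 y4 y5 y6 y7 y8] := ok.
have out t : t <= 0 \/ 0 + 1 <= t -> plat_b t = 0 /\ dplat_b t = 0.
  by move=> tt; apply: plateau_out => //; lra.
by split; apply: (@comb_eval _ _ _ 0) => //; try lra; move=> t /out[].
Qed.

Lemma Xw_eval (s : R) (k : nat) : (k < n.+1)%N -> z4 - 1 <= s / e - k%:R ->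
  s / e - k%:R <= z4 ->
  Xw s = plat_w (s / e - k%:R) /\ dXw s = dplat_w (s / e - k%:R).
Proof.
move=> kn u0 u1; have [g0 g1 g2 g3 g4] := gb; have hg' := hg; have h0 := h_gt0.
have [y1 y2 y3 y4 y5 y6 y7 y8] := ok.
have out t : t <= z4 - 1 \/ z4 - 1 + 1 <= t -> plat_w t = 0 /\ dplat_w t = 0.
  by move=> tt; apply: plateau_out => //; lra.
by split; apply: (@comb_eval _ _ _ (z4 - 1)) => //; try lra; move=> t /out[].
Qed.

Lemma comp_zone1 x : x.2 <= l1 + 1 ->
  [/\ competitor x = m1 x.2 * Xa x.1, competitor_dx1 x = m1 x.2 * dXa x.1 / e &
      competitor_dx2 x = dm1 x.2 * Xa x.1].
Proof.
move=> x2; have es := e_small; have e0 := e_gt0.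
have [T1 dT1] := ramp_le h_gt0 h_half t1lt x2.
have x2' : x.2 <= l2 - 1 - e by lra.
have [T3 dT3] := ramp_le h_gt0 h_half t3lt x2'.
by rewrite /competitor /competitor_dx1 /competitor_dx2 T1 T3 dT1 dT3; split; ring.
Qed.

Lemma comp_zone3 x : l2 - 1 <= x.2 ->
  [/\ competitor x = 1 - (1 - r3 x.2) * Xb x.1, competitor_dx1 x = - ((1 - r3 x.2) * dXb x.1) / e &
      competitor_dx2 x = dr3 x.2 * Xb x.1].
Proof.
move=> x2; have es := e_small; have e0 := e_gt0.
have [T3 dT3] := ramp_ge h_gt0 h_half t3lt x2.
have x2' : l1 + 1 + e <= x.2 by lra.
have [T1 dT1] := ramp_ge h_gt0 h_half t1lt x2'.
by rewrite /competitor /competitor_dx1 /competitor_dx2 T1 T3 dT1 dT3; split; ring.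
Qed.

Lemma comp_zone2 x : l1 + 1 <= x.2 -> x.2 <= l2 - 1 ->
  [/\ competitor x = (1 - t1 x.2) * Xa x.1 + t1 x.2 * (1 - t3 x.2) * Xw x.1
         + t1 x.2 * t3 x.2 * (1 - Xb x.1),
      competitor_dx1 x = ((1 - t1 x.2) * dXa x.1 + t1 x.2 * (1 - t3 x.2) * dXw x.1
         - t1 x.2 * t3 x.2 * dXb x.1) / e &
      competitor_dx2 x = - dt1 x.2 * Xa x.1 + (dt1 x.2 * (1 - t3 x.2) - t1 x.2 * dt3 x.2) * Xw x.1
         + (dt1 x.2 * t3 x.2 + t1 x.2 * dt3 x.2) * (1 - Xb x.1)].
Proof.
move=> x2 x2'.
have [M1 dM1] := ramp_ge h_gt0 h_half m1lt x2.
have [R3 dR3] := ramp_le h_gt0 h_half r3lt x2'.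
by rewrite /competitor /competitor_dx1 /competitor_dx2 M1 dM1 R3 dR3; split; ring.
Qed.

Lemma comp_middle x : l1 + 1 + e <= x.2 -> x.2 <= l2 - 1 - e ->
  competitor_dx1 x = dXw x.1 / e /\ competitor_dx2 x = 0.
Proof.
move=> x2 x2'.
have [T1 dT1] := ramp_ge h_gt0 h_half t1lt x2.
have [T3 dT3] := ramp_le h_gt0 h_half t3lt x2'.
rewrite /competitor_dx1 /competitor_dx2 T1 T3 dT1 dT3; split; last by ring.
by congr (_ / e); ring.
Qed.

(** On a finger of the upper comb the profiles Xa and Xw are 1 and Xb is 0, so that the
    three pieces of the competitor coincide there. *)
Lemma comp_Omega_a x : Omega_a p e x -> competitor x = 1.
Proof.
have [g0 g1 g2 g3 g4] := gb; have hg' := hg; have h0 := h_gt0.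
have [y1 y2 y3 y4 y5 y6 y7 y8] := ok.
move=> /(Omega_aP adm)[[_ _ x2 _]|[k kn [u1 u2 x2 x2']]].
  have x2' : l2 - 1 <= x.2 by lra.
  have [-> _ _] := comp_zone3 x2'.
  by have [R3 _] := ramp_ge h_gt0 h_half r3lt (ltW x2); rewrite R3; ring.
have kn' : (k < n.+1)%N by exact: ltnW.
have [u0 u3] : 0 <= x.1 / e - k%:R /\ x.1 / e - k%:R <= 1 by split; lra.
have [XA _] := Xa_eval kn' u0 u3; have [XB _] := Xb_eval kn' u0 u3.
have [w0 w1] : z4 - 1 <= x.1 / e - k%:R /\ x.1 / e - k%:R <= z4 by split; lra.
have [XW _] := Xw_eval kn' w0 w1.
have [PA _] := plateau_top h_gt0 h_half a12 a34 (ltW u1) (ltW u2).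
have [PW _] := plateau_top h_gt0 h_half w12 z23' (ltW u1) (ltW u2).
have b_out : x.1 / e - k%:R <= z3 - h \/ z4 + h <= x.1 / e - k%:R by left; lra.
have [PB _] := plateau_out h_gt0 h_half b12 z34' b34 b_out.
have XB0 : Xb x.1 = 0 by rewrite XB.
have [x3|x3] := leP x.2 (l2 - 1).
  have [-> _ _] := comp_zone2 (ltW x2) x3.
  by rewrite XA XB0 XW /plat_a /plat_w PA PW; ring.
have [-> _ _] := comp_zone3 (ltW x3).
by rewrite XB0; ring.
Qed.

Lemma comp_Omega_b x : Omega_b p e x -> competitor x = 0.
Proof.
have [g0 g1 g2 g3 g4] := gb; have hg' := hg; have h0 := h_gt0.
have [y1 y2 y3 y4 y5 y6 y7 y8] := ok.
move=> /(Omega_bP adm)[[_ _ _ x2]|[k kn [u1 u2 x2' x2]]].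
  have x2' : x.2 <= l1 + 1 by lra.
  have [-> _ _] := comp_zone1 x2'.
  by have [M1 _] := ramp_le h_gt0 h_half m1lt (ltW x2); rewrite M1; ring.
have kn' : (k < n.+1)%N by exact: ltnW.
have [u0 u3] : 0 <= x.1 / e - k%:R /\ x.1 / e - k%:R <= 1 by split; lra.
have [XA _] := Xa_eval kn' u0 u3; have [XB _] := Xb_eval kn' u0 u3.
have [w0 w1] : z4 - 1 <= x.1 / e - k%:R /\ x.1 / e - k%:R <= z4 by split; lra.
have [XW _] := Xw_eval kn' w0 w1.
have [PB _] := plateau_top h_gt0 h_half b12 b34 (ltW u1) (ltW u2).
have w_out : x.1 / e - k%:R <= z4 - 1 \/ z3 <= x.1 / e - k%:R by right; lra.
have [PW _] := plateau_out h_gt0 h_half w12 z12' z23' w_out.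
have a_out : x.1 / e - k%:R <= z1 - h \/ z2 + h <= x.1 / e - k%:R by right; lra.
have [PA _] := plateau_out h_gt0 h_half a12 z12' a34 a_out.
have XA0 : Xa x.1 = 0 by rewrite XA.
have [x3|x3] := leP x.2 (l1 + 1).
  by have [-> _ _] := comp_zone1 x3; rewrite XA0; ring.
have [-> _ _] := comp_zone2 (ltW x3) (ltW x2).
by rewrite XA0 XB XW /plat_b /plat_w PB PW; ring.
Qed.

(** The items of [bad] cover the points where the rescaled gradient of the competitor
    may differ from the limit field by more than O(e / h).  The weight (6 / g)^2 bounds
    the squared difference of two fields of size O(1 / g); in the gluing layers the
    profiles of slope O(1 / h) all contribute, whence the weight (20 / h)^2.
    Rectangles being open, they are drawn larger than the smoothing length. *)
Definition full_item (w : R) : R * ((R * R) * (R * R)) := (w, ((0, L), (0, l3))).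
Definition strip_item (z : R) (k : nat) : R * ((R * R) * (R * R)) :=
  (36 / g ^+ 2, ((e * (k%:R + (z - 2 * h)), e * (k%:R + (z + 2 * h))), (0, l3))).
Definition strips (z : R) := [seq strip_item z k | k <- index_iota 0 n].
Definition end_item (a b : R) : R * ((R * R) * (R * R)) := (36 / g ^+ 2, ((a, b), (0, l3))).
Definition level_item (c : R) : R * ((R * R) * (R * R)) :=
  (36 / g ^+ 2, ((0, L), (c - 2 * h, c + 2 * h))).
Definition layer_item (c : R) : R * ((R * R) * (R * R)) :=
  (400 / h ^+ 2, ((0, L), (c - e, c + 2 * e))).

Definition bad := strips z1 ++ strips z2 ++ strips z3 ++ strips z4 ++
  [:: end_item 0 e; end_item (L - e) L; level_item l1; level_item (l1 + 1);
      level_item (l2 - 1); level_item l2; layer_item (l1 + 1); layer_item (l2 - 1 - e)].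

Lemma bad_wf i : i \in bad -> wellformed i.
Proof.
have [y1 y2 y3 y4 y5 y6 y7 y8] := ok.
have h0 := h_gt0; have e0 := e_gt0; have L0 := L_gt0.
have l30 : 0 <= l3 by lra.
have Ms0 : 0 <= 36 / g ^+ 2 by exact: divr_ge0 (ler0n _ _) (sqr_ge0 _).
have Ml0 : 0 <= 400 / h ^+ 2 by exact: divr_ge0 (ler0n _ _) (sqr_ge0 _).
have st z : i \in strips z -> wellformed i.
  move=> /mapP[k _ ->]; split => //=; rewrite ler_pM2l//; lra.
rewrite /bad !mem_cat => /orP[/st//|/orP[/st//|/orP[/st//|/orP[/st//|]]]].
clear st y1 y2 y3 y4 y5.
rewrite !inE => /orP[|/orP[|/orP[|/orP[|/orP[|/orP[|/orP[|]]]]]]] /eqP ->;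
  split => /=; lra.
Qed.

Lemma bad_strip z (k : nat) x : z \in [:: z1; z2; z3; z4] -> (k < n)%N ->
  0 < x.2 -> x.2 < l3 -> z - h <= x.1 / e - k%:R -> x.1 / e - k%:R <= z + h ->
  36 / g ^+ 2 <= stepfun bad x.
Proof.
have h0 := h_gt0.
move=> zz kn x0 x3 u1 u2; apply: (stepfun_ge (i := strip_item z k)) bad_wf _ _.
  have : strip_item z k \in strips z by apply: map_f; rewrite mem_index_iota.
  move: zz; rewrite !inE /bad !mem_cat => /orP[|/orP[|/orP[|]]] /eqP -> ->;
  by rewrite ?orbT.
by apply/(crectP adm); split => //; lra.
Qed.

Lemma bad_item (i : R * ((R * R) * (R * R))) x : rect_of i.2 x ->
  i \in [:: end_item 0 e; end_item (L - e) L; level_item l1; level_item (l1 + 1);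
      level_item (l2 - 1); level_item l2; layer_item (l1 + 1); layer_item (l2 - 1 - e)] ->
  i.1 <= stepfun bad x.
Proof.
move=> ix ib; apply: (stepfun_ge bad_wf _ ix).
by rewrite /bad !mem_cat ib !orbT.
Qed.

Lemma bad_ge0 x : 0 <= stepfun bad x.
Proof. exact: stepfun_ge0 bad_wf. Qed.

Lemma bad_level c x : c \in [:: l1; l1 + 1; l2 - 1; l2] -> 0 < x.1 -> x.1 < L ->
  c - h <= x.2 -> x.2 <= c + h -> 36 / g ^+ 2 <= stepfun bad x.
Proof.
have h0 := h_gt0.
move=> cc x1 xL u1 u2; apply: (@bad_item (level_item c)).
  by apply/rectP; split => //=; lra.
by move: cc; rewrite !inE => /orP[|/orP[|/orP[|]]] /eqP ->; rewrite eqxx ?orbT.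
Qed.

Lemma stepmass_bad : stepmass bad =
  36 / g ^+ 2 * (16 * L * l3 * h + 2 * e * l3 + 16 * L * h) + 400 / h ^+ 2 * (6 * L * e).
Proof.
have st z : stepmass (strips z) = 36 / g ^+ 2 * (4 * L * l3 * h).
  rewrite /stepmass /strips big_map.
  under eq_bigr => k _.
    rewrite (_ : _ * _ = 36 / g ^+ 2 * (e * (4 * h) * l3)); last by rewrite /area /=; ring.
    over.
  rewrite sumr_const_nat subn0 -mulr_natr.
  by have [_ _ ->] := adm; ring.
rewrite /bad !stepmass_cat !st !stepmass_cons /stepmass big_nil /area /=.
by ring.
Qed.

(** * Distance from the competitor to the limit field *)

(** The columns and gaps on which the limit field is nonzero.  There are n - 1 gaps of
    the last kind, because the half gaps next to x1 = 0 and x1 = L have a finger on one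
    side only. *)
Definition U_a := crects e n z1 z2 l1 (l1 + 1).
Definition U_b := crects e n z3 z4 (l2 - 1) l2.
Definition U_ab := crects e n z2 z3 (l1 + 1) (l2 - 1).
Definition U_ba := crects e n.-1 z4 (1 + z1) (l1 + 1) (l2 - 1).

Lemma in_crects m s t c d x (k : nat) : 0 <= s -> t <= 1 ->
  0 <= x.1 / e - k%:R -> x.1 / e - k%:R < 1 ->
  crects e m s t c d x <->
  [/\ (k < m)%N, s < x.1 / e - k%:R, x.1 / e - k%:R < t, c < x.2 & x.2 < d].
Proof.
move=> s0 t1' u0 u1; split.
  move=> /crectsP[j jm /(crectP adm)[v1 v2 v3 v4]].
  by have [jk|[jk|jk]] := @nat_lt_dec R j k; [subst j; split|exfalso; lra|exfalso; lra].
by move=> [km v1 v2 v3 v4]; apply/crectsP; exists k => //; apply/(crectP adm).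
Qed.

(** A point of such a gap has its phase above z4 in the cell where the gap starts, or
    below z1 in the following one. *)
Lemma in_U_ba x (k : nat) : 0 <= x.1 / e - k%:R -> x.1 / e - k%:R < 1 ->
  U_ba x <->
  [/\ ((k < n.-1)%N /\ z4 < x.1 / e - k%:R) \/ ((0 < k)%N /\ (k <= n.-1)%N /\ x.1 / e - k%:R < z1),
     l1 + 1 < x.2 & x.2 < l2 - 1].
Proof.
have [y1 y2 y3 y4 y5 y6 y7 y8] := ok.
move=> u0 u1; split.
  move=> /crectsP[j jm /(crectP adm)[v1 v2 v3 v4]]; split => //.
  have [jk|[jk|jk]] := @nat_lt_dec R j k; first by subst j; left.
  - right; have jk' : (j.+1 <= k)%N by rewrite -(ler_nat R) -natr1.
    have kE : k = j.+1.
      apply/eqP; rewrite eqn_leq jk' andbT -ltnS -(ltr_nat R) -!natr1; lra.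
    by rewrite kE; split => //; split => //; rewrite -natr1; lra.
  - by exfalso; lra.
move=> [v v3 v4]; apply/crectsP; case: v => [[km v1]|[k0 [km v1]]].
  by exists k => //; apply/(crectP adm); split => //; lra.
case: k k0 km v1 u0 u1 => // k _ km v1 u0 u1.
exists k => //; apply/(crectP adm); rewrite -natr1 in u0 u1 v1; split => //; lra.
Qed.

Lemma Omega_c1_cell x : Omega_c1 p e x -> [/\ 0 < x.1, x.1 < L, 0 < x.2, x.2 < l3 &
  l1 < x.2 < l1 + 1].
Proof.
move=> [/Omega_c_rect[v1 v2 v3 v4] /(rectP 0 L l1 (l1 + 1))[_ _ v5 v6]].
by split => //; rewrite v5.
Qed.

Lemma Omega_c3_cell x : Omega_c3 p e x -> [/\ 0 < x.1, x.1 < L, 0 < x.2, x.2 < l3 &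
  l2 - 1 < x.2 < l2].
Proof.
move=> [/Omega_c_rect[v1 v2 v3 v4] /(rectP 0 L (l2 - 1) l2)[_ _ v5 v6]].
by split => //; rewrite v5.
Qed.

Lemma plateau_error (d q : R) : 0 <= d <= 9 / 4 -> 0 <= q <= 1 ->
  forall I : R, I = 0 \/ I = 1 -> (d * q - I) ^+ 2 <= 36 / g ^+ 2.
Proof.
move=> /andP[d0 d1] /andP[q0 q1] I HI; apply: le_trans (strip_weight_ge gb).
have : 0 <= d * q <= 9 / 4 by apply/andP; split; nra.
by move=> /andP[v1 v2]; case: HI => ->; nra.
Qed.

Lemma unit_width (c : R) : c + 1 - c = 1. Proof. by ring. Qed.

(** In the lower layer the competitor is m1(x2) Xa(x1), of gradient close to
    (0, indicator of omega_a) away from the ends of the ramp m1 and of the plateaus.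
    The horizontal part is e m1 dXa with |dXa| <= (9/4) / h. *)
Lemma err_zone1 x : Omega_c1 p e x ->
  (e ^+ 2 * competitor_dx1 x) ^+ 2 <= 25 * e ^+ 2 / h ^+ 2 /\
  (competitor_dx2 x - \1_U_a x) ^+ 2 <= stepfun bad x.
Proof.
have [g0 g1 g2 g3 g4] := gb; have hg' := hg; have h0 := h_gt0; have e0 := e_gt0.
have [y1 y2 y3 y4 y5 y6 y7 y8] := ok.
move=> /Omega_c1_cell[x1 xL x2 x3 /andP[x4 x5]].
have [k [kn u0 u1 _]] := cell_index adm x1 xL.
have kn' : (k < n.+1)%N by exact: ltnW.
have [XA dXA] := Xa_eval kn' u0 (ltW u1).
have [_ -> ->] := comp_zone1 (ltW x5).
rewrite XA dXA; set u := x.1 / e - k%:R in u0 u1 XA dXA *.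
have /andP[m10 m11] := ramp_bound l1 (l1 + 1) h_gt0 h_half x.2.
split.
  have [w1 w2] : h <= z1 - (z1 - h) /\ h <= z2 + h - z2 by split; lra.
  have := dplateau_bound h_gt0 a12 a34 u h0 w1 w2.
  rewrite ler_norml -/(dplat_a u) => /andP[q1 q2].
  set B := 9 / 4 / h in q1 q2; have B0 : 0 < B by rewrite /B !divr_gt0.
  rewrite (_ : e ^+ 2 * _ = e * (m1 x.2 * dplat_a u)); last by field; rewrite gt_eqF.
  rewrite (_ : 25 * _ / _ = (e * (5 / h)) ^+ 2); last by field; rewrite gt_eqF.
  have B5 : B <= 5 / h by rewrite /B ler_pM2r ?invr_gt0//; lra.
  apply: sq_le; rewrite -?mulrN ler_pM2l//; apply: le_trans B5 || apply: (@le_trans _ _ (- B));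
    rewrite ?lerN2//; nra.
have dm := dramp_bound h_gt0 m1lt x.2; rewrite unit_width divr1 in dm.
have pb := plateau_bound h_gt0 h_half a12 z12' a34 u; rewrite -/(plat_a u) in pb.
have I01 : \1_U_a x = 0 :> R \/ \1_U_a x = 1 :> R.
  by rewrite indicE; case: (_ \in _); [right|left].
have crude := plateau_error dm pb I01.
have [c1|c1] := leP x.2 (l1 + h).
  by apply: le_trans crude _; apply: (bad_level (c := l1)); rewrite ?inE ?eqxx//; lra.
have [c2|c2] := leP (l1 + 1 - h) x.2.
  by apply: le_trans crude _; apply: (bad_level (c := l1 + 1)); rewrite ?inE ?eqxx ?orbT//; lra.
have dm1E : dm1 x.2 = 1.
  have w : l1 + 1 - l1 <= 1 by rewrite unit_width.
  by rewrite (dramp_mid h_gt0 m1lt w (ltW c1) (ltW c2)) unit_width invr1.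
have strip z : z \in [:: z1; z2; z3; z4] -> z - h <= u -> u <= z + h ->
    (dm1 x.2 * plat_a u - \1_U_a x) ^+ 2 <= stepfun bad x.
  by move=> zz v1 v2; apply: le_trans crude _; exact: (bad_strip zz kn).
have inU := @in_crects n z1 z2 l1 (l1 + 1) x k (ltW y1) _ u0 u1.
have z2le : z2 <= 1 by lra.
rewrite dm1E mul1r in strip crude *.
clear g0 g1 g2 g3 g4 hg' e0 y1 y3 y4 y5 y6 y7 y8 x1 xL x2 x3 c1 c2 m10 m11 dm pb dm1E crude XA dXA kn'.
have [v1|v1] := leP u z1.
  have [v2|v2] := leP (z1 - h) u.
    by apply: (strip z1); rewrite ?inE ?eqxx//; lra.
  have v3 : u <= z1 - h \/ z2 + h <= u by left; exact: ltW.
  have [E _] := plateau_out h_gt0 h_half a12 z12' a34 v3.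
  rewrite /plat_a E indicE memNset ?subrr ?expr0n ?bad_ge0//.
  by move=> /(inU z2le)[_ v4 _ _ _]; move: v4; rewrite -/u; lra.
have [v2|v2] := ltP u z2.
  have [E _] := plateau_top h_gt0 h_half a12 a34 (ltW v1) (ltW v2).
  rewrite /plat_a E indicE mem_set ?subrr ?expr0n ?bad_ge0//.
  by apply/(inU z2le).
have [v3|v3] := leP u (z2 + h).
  by apply: (strip z2); rewrite ?inE ?eqxx ?orbT//; lra.
have v4 : u <= z1 - h \/ z2 + h <= u by right; exact: ltW.
have [E _] := plateau_out h_gt0 h_half a12 z12' a34 v4.
rewrite /plat_a E indicE memNset ?subrr ?expr0n ?bad_ge0//.
by move=> /(inU z2le)[_ _ v5 _ _]; move: v5; rewrite -/u; lra.
Qed.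

(** In the upper layer the competitor is 1 - (1 - r3(x2)) Xb(x1). *)
Lemma err_zone3 x : Omega_c3 p e x ->
  (e ^+ 2 * competitor_dx1 x) ^+ 2 <= 25 * e ^+ 2 / h ^+ 2 /\
  (competitor_dx2 x - \1_U_b x) ^+ 2 <= stepfun bad x.
Proof.
have [g0 g1 g2 g3 g4] := gb; have hg' := hg; have h0 := h_gt0; have e0 := e_gt0.
have [y1 y2 y3 y4 y5 y6 y7 y8] := ok.
move=> /Omega_c3_cell[x1 xL x2 x3 /andP[x4 x5]].
have [k [kn u0 u1 _]] := cell_index adm x1 xL.
have kn' : (k < n.+1)%N by exact: ltnW.
have [XB dXB] := Xb_eval kn' u0 (ltW u1).
have [_ -> ->] := comp_zone3 (ltW x4).
rewrite XB dXB; set u := x.1 / e - k%:R in u0 u1 XB dXB *.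
have /andP[m10 m11] := ramp_bound (l2 - 1) l2 h_gt0 h_half x.2.
split.
  have [w1 w2] : h <= z3 - (z3 - h) /\ h <= z4 + h - z4 by split; lra.
  have := dplateau_bound h_gt0 b12 b34 u h0 w1 w2.
  rewrite ler_norml -/(dplat_b u) => /andP[q1 q2].
  set B := 9 / 4 / h in q1 q2; have B0 : 0 < B by rewrite /B !divr_gt0.
  rewrite (_ : e ^+ 2 * _ = e * ((1 - r3 x.2) * - dplat_b u)); last by field; rewrite gt_eqF.
  rewrite (_ : 25 * _ / _ = (e * (5 / h)) ^+ 2); last by field; rewrite gt_eqF.
  have B5 : B <= 5 / h by rewrite /B ler_pM2r ?invr_gt0//; lra.
  apply: sq_le; rewrite -?[- (e * _)]mulrN ler_pM2l//; apply: le_trans B5 || apply: (@le_trans _ _ (- B));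
    rewrite ?lerN2//; nra.
have unit3 : l2 - (l2 - 1) = 1 by ring.
have dm := dramp_bound h_gt0 r3lt x.2; rewrite unit3 divr1 in dm.
have pb := plateau_bound h_gt0 h_half b12 z34' b34 u; rewrite -/(plat_b u) in pb.
have I01 : \1_U_b x = 0 :> R \/ \1_U_b x = 1 :> R.
  by rewrite indicE; case: (_ \in _); [right|left].
have crude := plateau_error dm pb I01.
have [c1|c1] := leP x.2 (l2 - 1 + h).
  by apply: le_trans crude _; apply: (bad_level (c := l2 - 1)); rewrite ?inE ?eqxx ?orbT//; lra.
have [c2|c2] := leP (l2 - h) x.2.
  by apply: le_trans crude _; apply: (bad_level (c := l2)); rewrite ?inE ?eqxx ?orbT//; lra.
have dm1E : dr3 x.2 = 1.
  have w : l2 - (l2 - 1) <= 1 by rewrite unit3.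
  by rewrite (dramp_mid h_gt0 r3lt w (ltW c1) (ltW c2)) unit3 invr1.
have strip z : z \in [:: z1; z2; z3; z4] -> z - h <= u -> u <= z + h ->
    (dr3 x.2 * plat_b u - \1_U_b x) ^+ 2 <= stepfun bad x.
  by move=> zz v1 v2; apply: le_trans crude _; exact: (bad_strip zz kn).
have z3ge : 0 <= z3 by lra.
have inU := @in_crects n z3 z4 (l2 - 1) l2 x k z3ge (ltW y5) u0 u1.
rewrite dm1E mul1r in strip crude *.
clear g0 g1 g2 g3 g4 hg' e0 y1 y2 y3 y5 y6 y7 y8 x1 xL x2 x3 c1 c2 m10 m11 dm pb dm1E unit3 crude XB dXB kn'.
have [v1|v1] := leP u z3.
  have [v2|v2] := leP (z3 - h) u.
    by apply: (strip z3); rewrite ?inE ?eqxx ?orbT//; lra.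
  have v3 : u <= z3 - h \/ z4 + h <= u by left; exact: ltW.
  have [E _] := plateau_out h_gt0 h_half b12 z34' b34 v3.
  rewrite /plat_b E indicE memNset ?subrr ?expr0n ?bad_ge0//.
  by move=> /inU[_ v4 _ _ _]; move: v4; rewrite -/u; lra.
have [v2|v2] := ltP u z4.
  have [E _] := plateau_top h_gt0 h_half b12 b34 (ltW v1) (ltW v2).
  rewrite /plat_b E indicE mem_set ?subrr ?expr0n ?bad_ge0//.
  by apply/inU.
have [v3|v3] := leP u (z4 + h).
  by apply: (strip z4); rewrite ?inE ?eqxx ?orbT//; lra.
have v4 : u <= z3 - h \/ z4 + h <= u by right; exact: ltW.
have [E _] := plateau_out h_gt0 h_half b12 z34' b34 v4.
rewrite /plat_b E indicE memNset ?subrr ?expr0n ?bad_ge0//.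
by move=> /inU[_ _ v5 _ _]; move: v5; rewrite -/u; lra.
Qed.

(** [gap_slope] is the derivative of phi2 at the phase of x1 in the interior of the
    gaps between two fingers, and 0 elsewhere, in particular in the end gaps. *)
Definition slope_ab : R := (z2 - z3)^-1.
Definition slope_ba : R := (z1 - z4 + 1)^-1.
Definition gap_slope (x : R * R) : R := slope_ab * \1_U_ab x + slope_ba * \1_U_ba x.

(** A point of the middle zone outside the closed fingers has its phase in one of
    the three pieces of the complement of the two closed intervals. *)
Lemma Omega_c2_cell x : Omega_c2 p e x -> exists k : nat,
  [/\ [/\ 0 < x.1, x.1 < L, 0 < x.2 & x.2 < l3], l1 + 1 <= x.2 <= l2 - 1, (k < n)%N,
     [\/ 0 <= x.1 / e - k%:R < z1, z2 < x.1 / e - k%:R < z3 | z4 < x.1 / e - k%:R < 1] &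
     forall f, periodic_ext f (x.1 / e) = f (x.1 / e - k%:R)].
Proof.
have e0 := e_gt0; have [y1 y2 y3 y4 y5 y6 y7 y8] := ok.
move=> [Ox [_ /=]]; rewrite in_itv /= => x45.
have /andP[x4 x5] := x45.
have [x1 xL x2 x3] := Omega_c_rect Ox.
have [k [kn u0 u1 per]] := cell_index adm x1 xL.
exists k; split => //.
have nota : ~ closure (Omega_a p e) x by case: Ox => _ /not_orP[].
have notb : ~ closure (Omega_b p e) x by case: Ox => _ /not_orP[].
have le1 u : u <= x.1 / e - k%:R -> e * (k%:R + u) <= x.1.
  by rewrite lerBrDl ler_pdivlMr// mulrC.
have le2 u : x.1 / e - k%:R <= u -> x.1 <= e * (k%:R + u).
  by rewrite lerBlDl ler_pdivrMr// mulrC.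
have [v|v] := ltP (x.1 / e - k%:R) z1; first by constructor 1; apply/andP.
have [v'|v'] := leP (x.1 / e - k%:R) z2.
  exfalso; apply: nota; have fa : l1 + 1 < l2 by lra.
  apply: (box_closure_rect (lt_cell adm k y2) fa (finger_a_sub adm kn)).
  by apply/boxP; split; [exact: le1|exact: le2|lra|lra].
have [w|w] := ltP (x.1 / e - k%:R) z3; first by constructor 2; apply/andP.
have [w'|w'] := leP (x.1 / e - k%:R) z4.
  exfalso; apply: notb; have fb : l1 < l2 - 1 by lra.
  apply: (box_closure_rect (lt_cell adm k y4) fb (finger_b_sub adm kn)).
  by apply/boxP; split; [exact: le1|exact: le2|lra|lra].
by constructor 3; apply/andP.
Qed.

Lemma slope_bound x : - g^-1 <= gap_slope x <= g^-1.
Proof.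
have [g0 g1 g2 g3 g4] := gb.
have [y1 y2 y3 y4 y5 y6 y7 y8] := ok.
have inv (w : R) : g <= w -> 0 < w^-1 <= g^-1.
  move=> gw; have w0 : 0 < w by exact: lt_le_trans gw.
  by rewrite invr_gt0 w0 lef_pV2 ?posrE.
have /andP[i1 i2] : 0 < - slope_ab <= g^-1 by rewrite /slope_ab -invrN opprB; exact: inv.
have /andP[i3 i4] : 0 < slope_ba <= g^-1 by rewrite /slope_ba; apply: inv; lra.
by rewrite /gap_slope !indicE; case: (_ \in _); case: (_ \in _);
  rewrite ?mulr1 ?mulr0 ?addr0 ?add0r; apply/andP; split; lra.
Qed.

Lemma gap_slope_ab x (k : nat) : (k < n)%N -> l1 + 1 < x.2 -> x.2 < l2 - 1 ->
  z2 < x.1 / e - k%:R < z3 -> gap_slope x = slope_ab.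
Proof.
have [y1 y2 y3 y4 y5 y6 y7 y8] := ok.
move=> kn x2 x2' /andP[u1 u2]; rewrite /gap_slope !indicE.
have [u0 u3] : 0 <= x.1 / e - k%:R /\ x.1 / e - k%:R < 1 by split; lra.
have z20 : 0 <= z2 by lra.
have z31 : z3 <= 1 by lra.
rewrite mem_set; last by apply/(in_crects _ _ _ z20 z31 u0 u3).
rewrite memNset ?mulr1 ?mulr0 ?addr0// => /(in_U_ba u0 u3)[].
by move=> [[_ v]|[_ [_ v]]] _ _; move: v; lra.
Qed.

Lemma gap_slope_ba x (k : nat) : l1 + 1 < x.2 -> x.2 < l2 - 1 ->
  ((k < n.-1)%N /\ z4 < x.1 / e - k%:R < 1) \/
  ((0 < k)%N /\ (k <= n.-1)%N /\ 0 <= x.1 / e - k%:R < z1) -> gap_slope x = slope_ba.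
Proof.
have [y1 y2 y3 y4 y5 y6 y7 y8] := ok.
move=> x2 x2' hk; rewrite /gap_slope !indicE.
have [u0 u3] : 0 <= x.1 / e - k%:R /\ x.1 / e - k%:R < 1.
  by case: hk => [[_ /andP[v w]]|[_ [_ /andP[v w]]]]; split; lra.
have z20 : 0 <= z2 by lra.
have z31 : z3 <= 1 by lra.
rewrite memNset; last first.
  move=> /(in_crects _ _ _ z20 z31 u0 u3)[_ v w _ _].
  by case: hk => [[_ /andP[v' w']]|[_ [_ /andP[v' w']]]]; lra.
rewrite mem_set ?mulr1 ?mulr0 ?add0r//; apply/(in_U_ba u0 u3); split => //.
by case: hk => [[k1 /andP[v w]]|[k0 [k1 /andP[v w]]]]; [left|right].
Qed.

Lemma bad_layer c x : c \in [:: l1 + 1; l2 - 1 - e] -> 0 < x.1 -> x.1 < L ->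
  c <= x.2 -> x.2 <= c + e -> 400 / h ^+ 2 <= stepfun bad x.
Proof.
have e0 := e_gt0.
move=> cc x1 xL u1 u2; apply: (bad_item (i := layer_item c)).
  by apply/rectP; split => //=; lra.
by move: cc; rewrite !inE => /orP[|] /eqP ->; rewrite eqxx ?orbT.
Qed.

Lemma bad_end x (k : nat) : 0 < x.1 -> x.1 < L -> 0 < x.2 -> x.2 < l3 ->
  (k < n)%N -> 0 <= x.1 / e - k%:R < 1 -> k = 0%N \/ (k = n.-1 /\ 0 < x.1 / e - k%:R) ->
  36 / g ^+ 2 <= stepfun bad x.
Proof.
have e0 := e_gt0.
move=> x1 xL x2 x3 kn /andP[u0 u1] [k0|[k0 u2]].
  apply: (bad_item (i := end_item 0 e)); last by rewrite !inE eqxx.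
  apply/rectP; split => //=; move: u1; rewrite k0 subr0 ltr_pdivrMr// mul1r; done.
apply: (bad_item (i := end_item (L - e) L)); last by rewrite !inE eqxx ?orbT.
apply/rectP; split => //=; have [n0 _ ->] := adm.
rewrite (_ : _ - e = e * k%:R); last first.
  by rewrite k0 -{1}(prednK n0) -natr1; ring.
by move: u2; rewrite subr_gt0 ltr_pdivlMr// mulrC.
Qed.

Lemma layer_ge : 4 / g ^+ 2 <= 36 / g ^+ 2 /\ 36 / g ^+ 2 <= 400 / h ^+ 2.
Proof.
have g0 : 0 < g by case: gb.
have h0 := h_gt0; split.
  by rewrite ler_pM2r ?invr_gt0 ?exprn_gt0//; lra.
rewrite ler_pdivrMr ?exprn_gt0// mulrAC ler_pdivlMr ?exprn_gt0//.
have hg' := hg; have : h ^+ 2 <= g ^+ 2 by apply: sq_le; lra.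
by have := sqr_ge0 g; lra.
Qed.

Lemma target_slope (u : R) :
  [\/ 0 <= u < z1, z2 < u < z3 | z4 < u < 1] ->
  (phi2 p)^`()%classic (u) =
    if z2 < u < z3 then slope_ab else slope_ba.
Proof.
have [y1 y2 y3 y4 y5 y6 y7 y8] := ok.
have aff (c d : R) : is_derive u 1 (fun s => (s + c) / d) d^-1.
  have := @is_derive_comp_affine R id (cst 1) d^-1 (c / d) u (fun x => is_derive_id _ _).
  rewrite mulr1; have -> : (fun s : R => id (d^-1 * s + c / d)) = (fun s => (s + c) / d).
    by apply/funext => s /=; ring.
  by [].
have near_itv (a b : R) : a < u -> u < b -> \forall s \near u, a < s < b.
  move=> au ub; near=> s; apply/andP; split; near: s;
    [exact: lt_nbhsr|exact: lt_nbhsl].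
have conv (f : R -> R) (d : R) : (\near u, f u = phi2 p u) -> is_derive u 1 f d ->
    (phi2 p)^`()%classic u = d.
  by move=> fn df; rewrite derive1E; have := near_eq_is_derive fn df; case.
move=> [/andP[u0 u1]|/andP[u0 u1]|/andP[u0 u1]].
- rewrite ifF; last by apply/negbTE; rewrite negb_and -!leNgt; apply/orP; left; lra.
  apply: (conv (fun s => (s + (1 - z4)) / (z1 - z4 + 1))) (aff _ _).
  have um : -1 < u by lra.
  apply: filterS (near_itv _ _ um u1) => s /andP[_ s1].
  by rewrite /phi2 (ltW s1) addrA.
- rewrite u0 u1 /=; apply: (conv (fun s => (s + - z3) / (z2 - z3))) (aff _ _).
  apply: filterS (near_itv _ _ u0 u1) => s /andP[s0 s1].
  by rewrite /phi2 leNgt (lt_trans y2 s0) /= leNgt s0 /= (ltW s1).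
- rewrite ifF; last by apply/negbTE; rewrite negb_and -!leNgt; apply/orP; right; lra.
  apply: (conv (fun s => (s + - z4) / (z1 - z4 + 1))) (aff _ _).
  apply: filterS (near_itv _ _ u0 u1) => s /andP[s0 s1].
  have [s2 s3] : z2 < s /\ z3 < s by split; lra.
  by rewrite /phi2 leNgt (lt_trans y2 s2) /= leNgt s2 /= leNgt s3 /= leNgt s0.
Unshelve. all: by end_near. Qed.

Lemma mul_bound (a q B : R) : 0 <= q <= 1 -> `|a| <= B -> `|q * a| <= q * B.
Proof. by move=> /andP[q0 q1] aB; rewrite normrM ger0_norm// ler_wpM2l. Qed.

Lemma compl01 (q : R) : 0 <= q <= 1 -> 0 <= 1 - q <= 1.
Proof. by move=> /andP[q0 q1]; apply/andP; split; lra. Qed.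

Lemma mul01_bound (a b B : R) : 0 <= a <= 1 -> 0 <= b <= B -> 0 <= a * b <= B.
Proof. by move=> /andP[a0 a1] /andP[b0 b1]; apply/andP; split; nra. Qed.

(** The profile Xw is evaluated at a phase t in [z4 - 1, z4]; when the phase of s
    exceeds z4, this is the phase relative to the next cell. *)
Lemma profile_bounds (s : R) : 0 < s -> s < L ->
  [/\ 0 <= Xa s <= 1, 0 <= Xb s <= 1 & 0 <= Xw s <= 1] /\
  [/\ `|dXa s| <= 9 / 4 / h, `|dXb s| <= 9 / 4 / h, `|dXw s| <= 9 / 4 / g &
   exists k : nat, exists t, [/\ (k < n)%N, 0 <= s / e - k%:R < 1,
     dXw s = dplat_w t &
     (t = s / e - k%:R /\ s / e - k%:R <= z4) \/
     (t = s / e - k%:R - 1 /\ z4 < s / e - k%:R)]].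
Proof.
have [g0 g1 g2 g3 g4] := gb; have hg' := hg; have h0 := h_gt0; have e0 := e_gt0.
have [y1 y2 y3 y4 y5 y6 y7 y8] := ok.
move=> s0 sL; have [k [kn u0 u1 _]] := cell_index adm s0 sL.
have kn' : (k < n.+1)%N by exact: ltnW.
have [-> ->] := Xa_eval kn' u0 (ltW u1).
have [-> ->] := Xb_eval kn' u0 (ltW u1).
have [t [-> -> ht]] : exists t, [/\ Xw s = plat_w t, dXw s = dplat_w t &
     (t = s / e - k%:R /\ s / e - k%:R <= z4) \/
     (t = s / e - k%:R - 1 /\ z4 < s / e - k%:R)].
  have [v|v] := leP (s / e - k%:R) z4.
    have v' : z4 - 1 <= s / e - k%:R by lra.
    by have [XW dXW] := Xw_eval kn' v' v; exists (s / e - k%:R); split => //; left.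
  have kn1 : (k.+1 < n.+1)%N by [].
  have sE : s / e - k.+1%:R = s / e - k%:R - 1 by rewrite -natr1; ring.
  have [v1 v2] : z4 - 1 <= s / e - k.+1%:R /\ s / e - k.+1%:R <= z4 by rewrite sE; split; lra.
  have [XW dXW] := Xw_eval kn1 v1 v2.
  by exists (s / e - k.+1%:R); split => //; right.
split; first by split; [exact: (plateau_bound h_gt0 h_half a12 z12' a34)|
  exact: (plateau_bound h_gt0 h_half b12 z34' b34)|
  exact: (plateau_bound h_gt0 h_half w12 z12' z23')].
split.
- by apply: (dplateau_bound h_gt0 a12 a34) => //; lra.
- by apply: (dplateau_bound h_gt0 b12 b34) => //; lra.
- by apply: (dplateau_bound h_gt0 w12 z23') => //; lra.
- by exists k, t; split => //; apply/andP.
Qed.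

(** Each term of the rescaled gradient is O(1 / h): the horizontal
    difference is below 4 / h, the vertical part below 12 / h, and 16 + 144 <= 400. *)
Lemma layer_crude (x : R * R) : l1 + 1 <= x.2 -> x.2 <= l2 - 1 -> 0 < x.1 -> x.1 < L ->
  (e * competitor_dx1 x - gap_slope x) ^+ 2 + (e * competitor_dx2 x) ^+ 2 <= 400 / h ^+ 2.
Proof.
have [g0 g1 g2 g3 g4] := gb; have hg' := hg; have h0 := h_gt0; have e0 := e_gt0.
move=> x2 x2' x1 xL.
have [[XA XB XW] [dXA dXB dXW _]] := profile_bounds x1 xL.
have [_ -> ->] := comp_zone2 x2 x2'.
have T1 : 0 <= t1 x.2 <= 1 := ramp_bound _ _ h_gt0 h_half x.2.
have T3 : 0 <= t3 x.2 <= 1 := ramp_bound _ _ h_gt0 h_half x.2.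
have width a : a - (a - e) = e by ring.
have width' a : a + e - a = e by ring.
have D1 : 0 <= e * dt1 x.2 <= 9 / 4.
  have := dramp_bound h_gt0 t1lt x.2; rewrite width' => /andP[v1 v2].
  by rewrite mulr_ge0 ?(ltW e0)//= mulrC -ler_pdivlMr.
have D3 : 0 <= e * dt3 x.2 <= 9 / 4.
  have := dramp_bound h_gt0 t3lt x.2; rewrite width => /andP[v1 v2].
  by rewrite mulr_ge0 ?(ltW e0)//= mulrC -ler_pdivlMr.
have hinv : g^-1 <= h^-1 by rewrite lef_pV2 ?posrE.
have h1 : 1 <= h^-1 by rewrite -invr1 lef_pV2 ?posrE//; lra.
have /andP[s1 s2] := slope_bound x.
clear g1 g2 g3 g4 x1 xL x2 x2'.
set B := 9 / 4 / h in dXA dXB.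
have {}dXW : `|dXw x.1| <= B by apply: (le_trans dXW); rewrite /B ler_pM2l//; lra.
have e1 : (e * (((1 - t1 x.2) * dXa x.1 + t1 x.2 * (1 - t3 x.2) * dXw x.1
     - t1 x.2 * t3 x.2 * dXb x.1) / e) - gap_slope x) ^+ 2 <= 16 / h ^+ 2.
  have c1 := compl01 T1.
  have c2 : 0 <= t1 x.2 * (1 - t3 x.2) <= 1 by apply: mul01_bound => //; exact: compl01.
  have c3 : 0 <= t1 x.2 * t3 x.2 <= 1 by exact: mul01_bound.
  have := mul_bound c1 dXA; have := mul_bound c2 dXW; have := mul_bound c3 dXB.
  rewrite !ler_norml => /andP[a1 a2] /andP[b1 b2] /andP[d1 d2].
  rewrite (_ : 16 / _ = (4 / h) ^+ 2); last by field; rewrite gt_eqF.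
  rewrite mulrC divfK ?gt_eqF//.
  by apply: sq_le; rewrite /B in a1 a2 b1 b2 d1 d2; lra.
have e2 : (e * (- dt1 x.2 * Xa x.1 + (dt1 x.2 * (1 - t3 x.2) - t1 x.2 * dt3 x.2) * Xw x.1
     + (dt1 x.2 * t3 x.2 + t1 x.2 * dt3 x.2) * (1 - Xb x.1))) ^+ 2 <= 144 / h ^+ 2.
  rewrite (_ : 144 / _ = (12 / h) ^+ 2); last by field; rewrite gt_eqF.
  rewrite (_ : e * _ = - (Xa x.1 * (e * dt1 x.2)) + (Xw x.1 * ((1 - t3 x.2) * (e * dt1 x.2))
    - Xw x.1 * (t1 x.2 * (e * dt3 x.2))) + ((1 - Xb x.1) * (t3 x.2 * (e * dt1 x.2))
    + (1 - Xb x.1) * (t1 x.2 * (e * dt3 x.2)))); last by ring.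
  have /andP[a1 a2] := mul01_bound XA D1.
  have /andP[b1 b2] := mul01_bound XW (mul01_bound (compl01 T3) D1).
  have /andP[c1 c2] := mul01_bound XW (mul01_bound T1 D3).
  have /andP[d1 d2] := mul01_bound (compl01 XB) (mul01_bound T3 D1).
  have /andP[f1 f2] := mul01_bound (compl01 XB) (mul01_bound T1 D3).
  by apply: sq_le; lra.
have hh : 0 < h ^- 2 by rewrite invr_gt0 exprn_gt0.
by apply: (le_trans (lerD e1 e2)); rewrite -mulrDl ler_pM2r//; lra.
Qed.

Lemma Omega_c2_phase x (k : nat) : Omega_c2 p e x ->
  0 <= x.1 / e - k%:R -> x.1 / e - k%:R < 1 ->
  [\/ 0 <= x.1 / e - k%:R < z1, z2 < x.1 / e - k%:R < z3 | z4 < x.1 / e - k%:R < 1].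
Proof.
have [y1 y2 y3 y4 y5 y6 y7 y8] := ok.
move=> /Omega_c2_cell[j [_ _ _ cases _]] u0 u1.
suff jk : j = k by move: cases; rewrite jk.
by apply: (@nat_close R); case: cases => /andP[v w]; lra.
Qed.

(** Outside the gluing layers the competitor is Xw(x1), whose rescaled derivative is the
    slope of phi2 except near the four zetas, and differs from [gap_slope] in the
    end gaps. *)
Lemma err_zone2 x : Omega_c2 p e x ->
  (e * competitor_dx1 x - gap_slope x) ^+ 2 + (e * competitor_dx2 x) ^+ 2 <= stepfun bad x.
Proof.
have [g0 g1 g2 g3 g4] := gb; have hg' := hg; have h0 := h_gt0; have e0 := e_gt0.
have [y1 y2 y3 y4 y5 y6 y7 y8] := ok; have es := e_small.
move=> O2; have [k0' [[x1 xL x2 x3] /andP[x4 x5] _ _ _]] := Omega_c2_cell O2.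
have [_ [_ _ dW [k [s [kn /andP[u0 u1] dXW hs]]]]] := profile_bounds x1 xL.
have cases := Omega_c2_phase O2 u0 u1.
rewrite dXW ler_norml in dW.
set u := x.1 / e - k%:R in u0 u1 hs cases *.
have Wb := dW.
have Gb := slope_bound x.
have [ge1 ge2] := layer_ge.
have G0 : 0 < g^-1 by rewrite invr_gt0.
have layer_case : x.2 <= l1 + 1 + e \/ l2 - 1 - e <= x.2 ->
    (e * competitor_dx1 x - gap_slope x) ^+ 2 + (e * competitor_dx2 x) ^+ 2 <= stepfun bad x.
  move=> xl; apply: (@le_trans _ _ (400 / h ^+ 2)); last first.
    case: xl => xl.
      by apply: (bad_layer (c := l1 + 1)); rewrite ?inE ?eqxx//.
    by apply: (bad_layer (c := l2 - 1 - e)); rewrite ?inE ?eqxx ?orbT//; lra.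
  by apply: layer_crude.
have [xl|xl] := leP x.2 (l1 + 1 + e); first by apply: layer_case; left.
have [xr|xr] := leP (l2 - 1 - e) x.2; first by apply: layer_case; right.
have [C1 C2] := comp_middle (ltW xl) (ltW xr).
rewrite C1 C2 mulr0 expr0n addr0 dXW.
rewrite (_ : e * (dplat_w s / e) = dplat_w s); last by field; rewrite gt_eqF.
have crude : (dplat_w s - gap_slope x) ^+ 2 <= 36 / g ^+ 2.
  rewrite (_ : 36 / _ = (6 / g) ^+ 2); last by field; rewrite gt_eqF.
  move: Wb Gb => /andP[v1 v2] /andP[v3 v4]; apply: sq_le; lra.
have strip z : z \in [:: z1; z2; z3; z4] -> z - h <= u -> u <= z + h ->
    (dplat_w s - gap_slope x) ^+ 2 <= stepfun bad x.
  by move=> zz v1 v2; apply: le_trans crude _; exact: (bad_strip zz kn).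
have exact_case : dplat_w s = gap_slope x ->
    (dplat_w s - gap_slope x) ^+ 2 <= stepfun bad x.
  by move=> ->; rewrite subrr expr0n; exact: bad_ge0.
have at_end : 36 / g ^+ 2 <= stepfun bad x ->
    (dplat_w s - gap_slope x) ^+ 2 <= stepfun bad x := le_trans crude.
clear crude Wb Gb dW ge1 ge2 G0 x4 x5 C1 C2 layer_case.
have x2l : l1 + 1 < x.2 by apply: lt_trans xl; rewrite ltrDl.
have x2r : x.2 < l2 - 1 by apply: (lt_trans xr); rewrite gtrBl.
clear xl xr es y6 y7 y8 g1 e0.
have up_w : z1 - (z4 - 1) <= 1 by lra.
have slope_baE : (z1 - (z4 - 1))^-1 = slope_ba by rewrite /slope_ba; congr (_^-1); ring.
case: cases => [/andP[v0 v1]|/andP[v0 v1]|/andP[v0 v1]].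
- have sE : s = u by case: hs => -[-> v] //; lra.
  have [|k0] := posnP k.
    by move=> k0; apply: at_end; apply: (bad_end (k := k)) => //; [rewrite u0|left].
  have [w|w] := leP (z1 - h) u; first by apply: (strip z1); rewrite ?inE ?eqxx//; lra.
  apply: exact_case; rewrite (gap_slope_ba (k := k))//; last first.
    by right; split => //; split; [rewrite -ltnS prednK// (leq_ltn_trans _ kn)|rewrite u0 v1].
  have t0 : z4 - 1 + h <= s by lra.
  have t1' : s <= z1 - h by lra.
  by rewrite /dplat_w (dplateau_up h_gt0 h_half w12 z12' z23' up_w t0 t1') slope_baE.
- have sE : s = u by case: hs => -[-> v] //; lra.
  have [w|w] := leP u (z2 + h); first by apply: (strip z2); rewrite ?inE ?eqxx ?orbT//; lra.
  have [w'|w'] := leP (z3 - h) u; first by apply: (strip z3); rewrite ?inE ?eqxx ?orbT//; lra.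
  apply: exact_case; rewrite (gap_slope_ab kn)//; last by rewrite v0 v1.
  have dn_w : z3 - z2 <= 1 by lra.
  have t0 : z2 + h <= s by lra.
  have t1' : s <= z3 - h by lra.
  by rewrite /dplat_w (dplateau_down h_gt0 h_half w12 z12' z23' dn_w t0 t1') /slope_ab -invrN opprB.
- have sE : s = u - 1 by case: hs => -[-> v] //; lra.
  have [k1|k1] := ltnP k n.-1; last first.
    apply: at_end; apply: (bad_end (k := k)) => //; first by rewrite u0 u1.
    by right; split; [apply/eqP; rewrite eqn_leq k1 andbT -ltnS prednK// (leq_ltn_trans _ kn)|rewrite -/u; lra].
  have [w|w] := leP u (z4 + h); first by apply: (strip z4); rewrite ?inE ?eqxx ?orbT//; lra.
  apply: exact_case; rewrite (gap_slope_ba (k := k))//; last by left; rewrite v0 v1.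
  have t0 : z4 - 1 + h <= s by lra.
  have t1' : s <= z1 - h by lra.
  by rewrite /dplat_w (dplateau_up h_gt0 h_half w12 z12' z23' up_w t0 t1') slope_baE.
Qed.

(** The field [gap_slope] differs from the derivative of phi2 only in the end gaps and
    on the two horizontal sides of the middle zone. *)
Lemma target_zone2 x : Omega_c2 p e x ->
  (periodic_ext (phi2 p)^`()%classic (x.1 / e) - gap_slope x) ^+ 2 <= stepfun bad x.
Proof.
have [g0 g1 g2 g3 g4] := gb; have e0 := e_gt0.
have [y1 y2 y3 y4 y5 y6 y7 y8] := ok.
move=> /Omega_c2_cell[k [[x1 xL x2 x3] /andP[x4 x5] kn cases ->]].
rewrite (target_slope cases).
have [u0 u1] : 0 <= x.1 / e - k%:R /\ x.1 / e - k%:R < 1.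
  by case: cases => /andP[v w]; split; lra.
have [ge1 ge2] := layer_ge.
have inv (w : R) : g <= w -> 0 < w^-1 <= g^-1.
  move=> gw; have w0 : 0 < w by exact: lt_le_trans gw.
  by rewrite invr_gt0 w0 lef_pV2 ?posrE.
have /andP[i1 i2] : 0 < - slope_ab <= g^-1 by rewrite /slope_ab -invrN opprB; exact: inv.
have /andP[i3 i4] : 0 < slope_ba <= g^-1 by rewrite /slope_ba; apply: inv; lra.
have /andP[s1 s2] := slope_bound x.
set T := if _ then _ else _.
have crude : (T - gap_slope x) ^+ 2 <= 36 / g ^+ 2.
  apply: le_trans ge1; rewrite (_ : 4 / _ = (2 / g) ^+ 2); last by field; rewrite gt_eqF.
  by rewrite /T; case: ifP => _; apply: sq_le; lra.
have [xl|xl] := leP x.2 (l1 + 1).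
  apply: (le_trans crude); apply: (le_trans ge2).
  by apply: (bad_layer (c := l1 + 1)); rewrite ?inE ?eqxx//; lra.
have [xr|xr] := leP (l2 - 1) x.2.
  apply: (le_trans crude); apply: (le_trans ge2).
  by apply: (bad_layer (c := l2 - 1 - e)); rewrite ?inE ?eqxx ?orbT//; lra.
have at_end : 36 / g ^+ 2 <= stepfun bad x ->
    (T - gap_slope x) ^+ 2 <= stepfun bad x := le_trans crude.
clear crude ge1 ge2 i1 i2 i3 i4 s1 s2 x4 x5 y6 y7 y8 g0 g1 g2 g3 g4.
have exact_case : T = gap_slope x -> (T - gap_slope x) ^+ 2 <= stepfun bad x.
  by move=> ->; rewrite subrr expr0n; exact: bad_ge0.
case: cases => [/andP[v0 v1]|/andP[v0 v1]|/andP[v0 v1]].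
- have [|k0] := posnP k.
    by move=> k0; apply: at_end; apply: (bad_end (k := k)) => //; [apply/andP|left].
  apply: exact_case; rewrite (gap_slope_ba (k := k))//; last first.
    by right; split => //; split; [rewrite -ltnS prednK// (leq_ltn_trans _ kn)|apply/andP].
  by rewrite /T ifF//; apply/negbTE; rewrite negb_and -!leNgt; apply/orP; left; lra.
- apply: exact_case; rewrite (gap_slope_ab kn)//; last exact/andP.
  by rewrite /T ifT//; apply/andP.
- have [k1|k1] := ltnP k n.-1; last first.
    apply: at_end; apply: (bad_end (k := k)) => //; first exact/andP.
    by right; split; [apply/eqP; rewrite eqn_leq k1 andbT -ltnS prednK// (leq_ltn_trans _ kn)|lra].
  apply: exact_case; rewrite (gap_slope_ba (k := k))//; last by left; split => //; apply/andP.
  by rewrite /T ifF//; apply/negbTE; rewrite negb_and -!leNgt; apply/orP; right; lra.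
Qed.

Lemma derive_if_affine (b : bool) (c d s : R) :
  'D_1 (fun t : R => if b then t - c else d) s = if b then 1 else 0.
Proof.
case: b; last exact: derive_cst.
by rewrite deriveB// derive_id derive_cst subr0.
Qed.

Lemma partial2_phi1 (x : R * R) (y : R) :
  partial2 (fun z => phi1 p z y) x = if y \in omega_a p then 1 else 0.
Proof. by case: x => a b; rewrite partial2_slice derive1E /phi1; exact: derive_if_affine. Qed.

Lemma partial2_phi3 (x : R * R) (y : R) :
  partial2 (fun z => phi3 p z y) x = if y \in omega_b p then 1 else 0.
Proof.
case: x => a b; rewrite partial2_slice derive1E /phi3 /=.
have -> : (fun t : R => if y \in omega_b p then t + 1 - l2 else 1) =
    (fun t : R => if y \in omega_b p then t - (l2 - 1) else 1).
  by apply/funext => t; case: ifP => // _; ring.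
exact: derive_if_affine.
Qed.

Lemma target_zone1 x : Omega_c1 p e x ->
  periodic_ext (fun y => partial2 (fun z => phi1 p z y) x) (x.1 / e) = \1_U_a x.
Proof.
have [y1 y2 y3 y4 y5 y6 y7 y8] := ok.
move=> /Omega_c1_cell[x1 xL x2 x3 /andP[x4 x5]].
have [k [kn u0 u1 ->]] := cell_index adm x1 xL.
have z2le : z2 <= 1 by lra.
have inU := in_crects n l1 (l1 + 1) (ltW y1) z2le u0 u1.
rewrite partial2_phi1 indicE.
have -> : (x.1 / e - k%:R \in omega_a p) = (x \in U_a).
  apply/idP/idP => [/set_mem|/set_mem/inU[_ v1 v2 _ _]].
    by rewrite /omega_a /= in_itv /= => /andP[v1 v2]; apply: mem_set; apply/inU.
  by apply: mem_set; rewrite /omega_a /= in_itv /= v1 v2.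
by case: (x \in U_a).
Qed.

Lemma target_zone3 x : Omega_c3 p e x ->
  periodic_ext (fun y => partial2 (fun z => phi3 p z y) x) (x.1 / e) = \1_U_b x.
Proof.
have [y1 y2 y3 y4 y5 y6 y7 y8] := ok.
move=> /Omega_c3_cell[x1 xL x2 x3 /andP[x4 x5]].
have [k [kn u0 u1 ->]] := cell_index adm x1 xL.
have z3ge : 0 <= z3 by lra.
have inU := in_crects n (l2 - 1) l2 z3ge (ltW y5) u0 u1.
rewrite partial2_phi3 indicE.
have -> : (x.1 / e - k%:R \in omega_b p) = (x \in U_b).
  apply/idP/idP => [/set_mem|/set_mem/inU[_ v1 v2 _ _]].
    by rewrite /omega_b /= in_itv /= => /andP[v1 v2]; apply: mem_set; apply/inU.
  by apply: mem_set; rewrite /omega_b /= in_itv /= v1 v2.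
by case: (x \in U_b).
Qed.

End Competitor.

(** * Comparison of energies *)

Section EnergyComparison.
Context d (T : measurableType d) (R : realType).
Variable mu : {measure set T -> \bar R}.
Implicit Types (A B : set T) (f : T -> R).

Definition energy A (D1 D2 : R) (f1 f2 : T -> R) : R :=
  \int[mu]_(x in A) (D1 * f1 x ^+ 2 + D2 * f2 x ^+ 2).

Lemma energy_integrable A D1 D2 f1 f2 g1 g2 : measurable A ->
  sqint mu A f1 -> sqint mu A f2 -> sqint mu A g1 -> sqint mu A g2 ->
  mu.-integrable A (EFin \o (fun x => D1 * (f1 x * g1 x) + D2 * (f2 x * g2 x))).
Proof.
by move=> mA L1 L2 L3 L4; apply: integrable_addr => //;
  apply: integrable_mulrl => //; exact: sqint_integrableM.
Qed.

(** The two sides differ by a weighted sum of squares, because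
    2 f (f - r) - (f^2 - r^2) = (f - r)^2. *)
Lemma energy_convexity A D1 D2 (f1 f2 r1 r2 : T -> R) : measurable A ->
  0 <= D1 -> 0 <= D2 ->
  sqint mu A f1 -> sqint mu A f2 -> sqint mu A r1 -> sqint mu A r2 ->
  energy A D1 D2 f1 f2 - energy A D1 D2 r1 r2 <=
  2 * \int[mu]_(x in A) (D1 * (f1 x * (f1 x - r1 x)) + D2 * (f2 x * (f2 x - r2 x))).
Proof.
move=> mA D10 D20 L1 L2 L3 L4.
have I f g : sqint mu A f -> sqint mu A g ->
    mu.-integrable A (EFin \o (fun x => D1 * f x ^+ 2 + D2 * g x ^+ 2)).
  by move=> Lf Lg; have := energy_integrable D1 D2 mA Lf Lg Lf Lg.
have J := energy_integrable D1 D2 mA L1 L2 (sqintB mA L1 L3) (sqintB mA L2 L4).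
rewrite /energy -RintegralB//; [|exact: I|exact: I].
rewrite -RintegralZl//; apply: le_Rintegral => //.
- by apply: integrable_subr => //; exact: I.
- exact: integrable_mulrl.
- move=> x _; rewrite -subr_ge0.
  rewrite (_ : _ - _ = D1 * (f1 x - r1 x) ^+ 2 + D2 * (f2 x - r2 x) ^+ 2); last by ring.
  by rewrite addr_ge0// mulr_ge0// sqr_ge0.
Qed.

End EnergyComparison.

Section MainEstimate.
Context {R : realType}.
Variable p : comb_params R.
Notation z1 := (zeta1 p).
Notation z2 := (zeta2 p).
Notation z3 := (zeta3 p).
Notation z4 := (zeta4 p).
Notation L := (L p).
Notation l1 := (l1 p).
Notation l2 := (l2 p).
Notation l3 := (l3 p).
Notation mu := (@leb2 R).
Hypothesis ok : comb_ordered p.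
Variables (n : nat) (e : R).
Hypothesis adm : [/\ (0 < n)%N, 0 < e & L = e * n%:R].
Hypothesis e_small : 2 * e <= l2 - l1 - 2.
Variables g h : R.
Hypotheses (gb : gap_bound p g) (h_gt0 : 0 < h) (hg : h <= g).
Hypothesis e_lt1 : e < 1.
Variable phi : H1 (Omega_c p e).
Hypothesis sol : solution 2 phi.

Local Notation O1 := (Omega_c1 p e).
Local Notation O2 := (Omega_c2 p e).
Local Notation O3 := (Omega_c3 p e).
Local Notation w1 := (competitor_dx1 p n e h).
Local Notation w2 := (competitor_dx2 p n e h).
Local Notation Ua := (U_a p n e).
Local Notation Ub := (U_b p n e).
Local Notation slope := (gap_slope p n e).
Local Notation bad := (bad p n e g h).
Local Notation D := (Dcoef p 2 e).

(** The vertical component of the limit field in the two outer layers. *)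
Definition pulse (x : R * R) : R := \1_Ua x + \1_Ub x.

Let mO : measurable (Omega_c p e : set (plane R)).
Proof. exact: open_measurable_plane (@open_Omega_c R p e). Qed.

Lemma measurable_O1 : measurable (O1 : set (plane R)).
Proof. by apply: measurableI => //; exact: (measurable_rect 0 L l1 (l1 + 1)). Qed.

Lemma measurable_O3 : measurable (O3 : set (plane R)).
Proof. by apply: measurableI => //; exact: (measurable_rect 0 L (l2 - 1) l2). Qed.

Lemma measurable_O2 : measurable (O2 : set (plane R)).
Proof. by apply: measurableI => //; apply: measurableX; exact: measurable_itv. Qed.

Lemma measurable_O13 : measurable (O1 `|` O3 : set (plane R)).
Proof. by apply: measurableU; [exact: measurable_O1|exact: measurable_O3]. Qed.

Lemma O13_sub : O1 `|` O3 `<=` Omega_c p e.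
Proof. by move=> x [[]|[]]. Qed.

Lemma O2_sub : O2 `<=` Omega_c p e.
Proof. by move=> x []. Qed.

Lemma Omega_c_finite (A : set (R * R)) : measurable (A : set (plane R)) ->
  A `<=` Omega_c p e -> (mu A < +oo)%E.
Proof. by move=> mA sub; apply: (box_finite mA) => x /sub; exact: Omega_c_box. Qed.

Lemma measurable_Ua : measurable (Ua : set (plane R)). Proof. exact: measurable_crects. Qed.
Lemma measurable_Ub : measurable (Ub : set (plane R)). Proof. exact: measurable_crects. Qed.

Lemma Ua_sub : Ua `<=` O1.
Proof.
move=> x /crectsP[k kn kx]; split; first exact: (column_a_sub ok adm kn).
have /(crectP adm)[_ _ v3 v4] := kx.
have [v1 v2 _ _] := Omega_c_rect (column_a_sub ok adm kn kx).
by apply/(rectP 0 L l1 (l1 + 1)).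
Qed.

Lemma Ub_sub : Ub `<=` O3.
Proof.
move=> x /crectsP[k kn kx]; split; first exact: (column_b_sub ok adm kn).
have /(crectP adm)[_ _ v3 v4] := kx.
have [v1 v2 _ _] := Omega_c_rect (column_b_sub ok adm kn kx).
by apply/(rectP 0 L (l2 - 1) l2).
Qed.

Lemma Uab_sub : U_ab p n e `<=` O2.
Proof.
move=> x /crectsP[k kn kx]; split; first exact: (gap_ab_sub ok adm kn).
have /(crectP adm)[_ _ v3 v4] := kx.
have [v1 v2 _ _] := Omega_c_rect (gap_ab_sub ok adm kn kx).
by split; rewrite /= in_itv /= ?v1 ?v2 ?(ltW v3) ?(ltW v4).
Qed.

Lemma Uba_sub : U_ba p n e `<=` O2.
Proof.
move=> x /crectsP[k kn kx].
have kn1 : (k.+1 < n)%N by case: (n) kn.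
split; first exact: (gap_ba_sub ok adm kn1).
have /(crectP adm)[_ _ v3 v4] := kx.
have [v1 v2 _ _] := Omega_c_rect (gap_ba_sub ok adm kn1 kx).
by split; rewrite /= in_itv /= ?v1 ?v2 ?(ltW v3) ?(ltW v4).
Qed.

Lemma sqint_indic (A U : set (R * R)) : measurable (A : set (plane R)) ->
  A `<=` Omega_c p e -> measurable (U : set (plane R)) -> sqint mu A \1_U.
Proof.
move=> mA sub mU; apply: (@bounded_sqint _ _ _ _ _ _ 1) => //; first exact: Omega_c_finite.
by move=> x _; rewrite indicE; case: (_ \in _); rewrite ?normr1 ?normr0.
Qed.

Lemma sqint_pulse : sqint mu (O1 `|` O3) pulse.
Proof.
apply: sqintD; first exact: measurable_O13.
- apply: sqint_indic; [exact: measurable_O13|exact: O13_sub|exact: measurable_Ua].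
- apply: sqint_indic; [exact: measurable_O13|exact: O13_sub|exact: measurable_Ub].
Qed.

Lemma sqint_slope : sqint mu O2 slope.
Proof.
by apply: sqintD; first exact: measurable_O2;
  apply: sqintZ; (try exact: measurable_O2);
  apply: sqint_indic; (try exact: measurable_O2); (try exact: O2_sub);
  exact: measurable_crects.
Qed.

Section Orthogonality.
Variable psi : H1 (Omega_c p e).
Hypotheses (tra : trace_eq (Gamma_a p e) psi (cst 0))
           (trb : trace_eq (Gamma_b p e) psi (cst 0)).

Lemma int_union_zero (m : nat) (s t c d : R) q (A : set (R * R)) :
  measurable (A : set (plane R)) -> A `<=` Omega_c p e ->
  0 <= s -> t <= 1 + s -> crects e m s t c d `<=` A -> sqint mu (Omega_c p e) q ->
  (forall k, (k < m)%N -> \int[mu]_(x in crect e k s t c d) q x = 0) ->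
  mu.-integrable A (EFin \o (fun x => \1_(crects e m s t c d) x * q x)) /\
  \int[mu]_(x in A) (\1_(crects e m s t c d) x * q x) = 0.
Proof.
move=> mA sub s0 ts UA Lq q0.
have mU := measurable_crects e m s t c d.
have LqA := sqintS mO mA sub Lq.
split; first by apply: sqint_integrableM => //; exact: sqint_indic.
rewrite int_indic// (int_crects adm s0 ts)//.
have LqU := sqintS mA mU UA LqA.
by apply: sqint_integrable => //; apply: Omega_c_finite => // x /UA /sub.
Qed.

Lemma pulse_orthogonal : \int[mu]_(x in O1 `|` O3) (pulse x * dx2 psi x) = 0.
Proof.
have [y1 y2 y3 y4 y5 y6 y7 y8] := ok.
have z3_ge0 : 0 <= z3 by lra.
have [w1 w2'] : z2 <= 1 + z1 /\ z4 <= 1 + z3 by split; lra.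
have Ld : sqint mu (Omega_c p e) (dx2 psi) by exact: dx2_L2.
have Ua' : Ua `<=` O1 `|` O3 by move=> x /Ua_sub; left.
have Ub' : Ub `<=` O1 `|` O3 by move=> x /Ub_sub; right.
have [i1 e1] := int_union_zero measurable_O13 O13_sub (ltW y1) w1 Ua' Ld
  (flux_column_a ok adm tra trb).
have [i2 e2] := int_union_zero measurable_O13 O13_sub z3_ge0 w2' Ub' Ld
  (flux_column_b ok adm tra trb).
rewrite -[RHS](addr0 0) -{1}e1 -e2 -RintegralD//; last exact: measurable_O13.
by apply: eq_Rintegral => x _; rewrite /pulse mulrDl.
Qed.

Lemma slope_orthogonal : \int[mu]_(x in O2) (slope x * dx1 psi x) = 0.
Proof.
have [y1 y2 y3 y4 y5 y6 y7 y8] := ok.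
have [z2_ge0 z4_ge0] : 0 <= z2 /\ 0 <= z4 by split; lra.
have [w1 w2'] : z3 <= 1 + z2 /\ 1 + z1 <= 1 + z4 by split; lra.
have Ld : sqint mu (Omega_c p e) (dx1 psi) by exact: dx1_L2.
have ba k : (k < n.-1)%N ->
    \int[mu]_(x in crect e k z4 (1 + z1) (l1 + 1) (l2 - 1)) dx1 psi x = 0.
  by move=> kn; apply: (flux_gap_ba ok adm tra trb); case: (n) kn.
have [i1 e1] := int_union_zero measurable_O2 O2_sub z2_ge0 w1 Uab_sub Ld
  (flux_gap_ab ok adm tra trb).
have [i2 e2] := int_union_zero measurable_O2 O2_sub z4_ge0 w2' Uba_sub Ld ba.
have mO2 := measurable_O2.
transitivity (slope_ab p * \int[mu]_(x in O2) (\1_(U_ab p n e) x * dx1 psi x) +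
  slope_ba p * \int[mu]_(x in O2) (\1_(U_ba p n e) x * dx1 psi x)).
  rewrite -!RintegralZl// -RintegralD//; try exact: integrable_mulrl.
  by apply: eq_Rintegral => x _; rewrite /gap_slope; ring.
by rewrite e1 e2 !mulr0 addr0.
Qed.

End Orthogonality.

Lemma Dcoef_bounds : 1 <= D /\ D <= (l2 - l1) / (l2 - l1 - 2).
Proof.
have [y1 y2 y3 y4 y5 y6 y7 y8] := ok; have [n0 e0 _] := adm; have e1 := e_lt1.
have e21 : e ^+ 2 <= 1 by rewrite expr_le1 ?ltW.
have e20 : 0 <= e ^+ 2 by exact: sqr_ge0.
rewrite /Dcoef (powR_mulrn 2 (ltW e0)).
by split; [rewrite ler_pdivlMr|rewrite ler_pM2r ?invr_gt0]; lra.
Qed.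

Section Minimisation.
Variable psi : H1 (Omega_c p e).
Hypotheses (tra : trace_eq (Gamma_a p e) psi (cst 0))
           (trb : trace_eq (Gamma_b p e) psi (cst 0)).

(** The equation multiplied by e^2, with the powers of e distributed so that both factors
    of each product are rescaled in the same way. *)
Lemma scaled_equation :
  \int[mu]_(x in O1 `|` O3) (1 * ((e ^+ 2 * dx1 phi x) * (e ^+ 2 * dx1 psi x)) +
     1 * (dx2 phi x * dx2 psi x)) +
  \int[mu]_(x in O2) (D * ((e * dx1 phi x) * (e * dx1 psi x)) +
     D^-1 * ((e * dx2 phi x) * (e * dx2 psi x))) = 0.
Proof.
have [n0 e0 _] := adm; have en0 : e != 0 by rewrite gt_eqF.
have [_ _ weak] := sol.
have H : \int[mu]_(x in O1 `|` O3) (e `^ 2 * dx1 phi x * dx1 psi x +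
      e `^ (- 2) * dx2 phi x * dx2 psi x) +
    \int[mu]_(x in O2) (D * dx1 phi x * dx1 psi x + D^-1 * dx2 phi x * dx2 psi x) = 0
  := weak psi tra trb.
have mA := measurable_O13; have mB := measurable_O2.
have LA (f : R * R -> R) : sqint mu (Omega_c p e) f -> sqint mu (O1 `|` O3) f.
  by apply: sqintS => //; exact: O13_sub.
have LB (f : R * R -> R) : sqint mu (Omega_c p e) f -> sqint mu O2 f.
  by apply: sqintS => //; exact: O2_sub.
have d1 := dx1_L2 phi; have d2 := dx2_L2 phi; have p1 := dx1_L2 psi; have p2 := dx2_L2 psi.
have IA := energy_integrable (e `^ 2) (e `^ (- 2)) mA (LA _ d1) (LA _ d2) (LA _ p1) (LA _ p2).
have IB := energy_integrable D D^-1 mB (LB _ d1) (LB _ d2) (LB _ p1) (LB _ p2).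
have ePn : e `^ (- 2) = (e ^+ 2)^-1 by rewrite powRN (powR_mulrn 2 (ltW e0)).
have eP : e `^ 2 = e ^+ 2 by rewrite (powR_mulrn 2 (ltW e0)).
have assoc (k1 k2 : R) (f1 f2 g1 g2 : R * R -> R) :
    (fun x => k1 * (f1 x * g1 x) + k2 * (f2 x * g2 x)) =
    (fun x => k1 * f1 x * g1 x + k2 * f2 x * g2 x).
  by apply/funext => x; rewrite !mulrA.
rewrite assoc in IA; rewrite assoc in IB.
rewrite -[RHS](mulr0 (e ^+ 2)) -H mulrDr -!RintegralZl//.
congr (_ + _); apply: eq_Rintegral => x _.
- by rewrite eP ePn; field.
- by ring.
Qed.

Hypotheses (psi1 : forall x, dx1 psi x = dx1 phi x - w1 x)
           (psi2 : forall x, dx2 psi x = dx2 phi x - w2 x).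

(** [energy_convexity] bounds the difference of the energies by twice the scalar
    product of (rescaled grad phi - limit field) with the rescaled grad psi, where
    psi = phi - competitor.  This scalar product is zero: the contribution of phi
    vanishes by the equation and that of the limit field by [pulse_orthogonal] and
    [slope_orthogonal]. *)
Lemma energy_minimal :
  energy mu (O1 `|` O3) 1 1 (fun x => e ^+ 2 * dx1 phi x) (fun x => dx2 phi x - pulse x) +
  energy mu O2 D D^-1 (fun x => e * dx1 phi x - slope x) (fun x => e * dx2 phi x) <=
  energy mu (O1 `|` O3) 1 1 (fun x => e ^+ 2 * w1 x) (fun x => w2 x - pulse x) +
  energy mu O2 D D^-1 (fun x => e * w1 x - slope x) (fun x => e * w2 x).
Proof.
have [n0 e0 _] := adm.
have [D1 _] := Dcoef_bounds.
have D0 : 0 <= D by lra.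
have Di0 : 0 <= D^-1 by rewrite invr_ge0.
have mA := measurable_O13; have mB := measurable_O2.
have LA (f : R * R -> R) : sqint mu (Omega_c p e) f -> sqint mu (O1 `|` O3) f.
  by apply: sqintS => //; exact: O13_sub.
have LB (f : R * R -> R) : sqint mu (Omega_c p e) f -> sqint mu O2 f.
  by apply: sqintS => //; exact: O2_sub.
have d1 : sqint mu (Omega_c p e) (dx1 phi) := dx1_L2 phi.
have d2 : sqint mu (Omega_c p e) (dx2 phi) := dx2_L2 phi.
have q1 : sqint mu (Omega_c p e) (dx1 psi) := dx1_L2 psi.
have q2 : sqint mu (Omega_c p e) (dx2 psi) := dx2_L2 psi.
have [_ c1 c2 _ _] := hasC1_comp ok adm h_gt0.
have Lw1 : sqint mu (Omega_c p e) w1 by exact: (continuous_sqint mO (@Omega_c_box R p e) c1).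
have Lw2 : sqint mu (Omega_c p e) w2 by exact: (continuous_sqint mO (@Omega_c_box R p e) c2).
have zA f k : sqint mu (Omega_c p e) f -> sqint mu (O1 `|` O3) (fun x => k * f x).
  by move=> Lf; apply: sqintZ => //; exact: LA.
have zB f k : sqint mu (Omega_c p e) f -> sqint mu O2 (fun x => k * f x).
  by move=> Lf; apply: sqintZ => //; exact: LB.
have pA f : sqint mu (Omega_c p e) f -> sqint mu (O1 `|` O3) (fun x => f x - pulse x).
  by move=> Lf; apply: sqintB => //; [exact: LA|exact: sqint_pulse].
have sB f k : sqint mu (Omega_c p e) f -> sqint mu O2 (fun x => k * f x - slope x).
  by move=> Lf; apply: sqintB => //; [exact: zB|exact: sqint_slope].
have hA := energy_convexity mA ler01 ler01 (zA _ (e ^+ 2) d1) (pA _ d2) (zA _ (e ^+ 2) Lw1) (pA _ Lw2).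
have hB := energy_convexity mB D0 Di0 (sB _ e d1) (zB _ e d2) (sB _ e Lw1) (zB _ e Lw2).
suff zero : \int[mu]_(x in O1 `|` O3) (1 * (e ^+ 2 * dx1 phi x * (e ^+ 2 * dx1 phi x - e ^+ 2 * w1 x)) +
     1 * ((dx2 phi x - pulse x) * (dx2 phi x - pulse x - (w2 x - pulse x)))) +
   \int[mu]_(x in O2) (D * ((e * dx1 phi x - slope x) * (e * dx1 phi x - slope x - (e * w1 x - slope x))) +
     D^-1 * (e * dx2 phi x * (e * dx2 phi x - e * w2 x))) = 0.
  by move: hA hB zero; lra.
have I1 := energy_integrable 1 1 mA (zA _ (e ^+ 2) d1) (LA _ d2) (zA _ (e ^+ 2) q1) (LA _ q2).
have I2 := energy_integrable D D^-1 mB (zB _ e d1) (zB _ e d2) (zB _ e q1) (zB _ e q2).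
have I3 : mu.-integrable (O1 `|` O3) (EFin \o (fun x => pulse x * dx2 psi x)).
  by apply: sqint_integrableM => //; [exact: sqint_pulse|exact: LA].
have I4 : mu.-integrable O2 (EFin \o (fun x => slope x * dx1 psi x)).
  by apply: sqint_integrableM => //; [exact: sqint_slope|exact: LB].
have eqA : \int[mu]_(x in O1 `|` O3) (1 * (e ^+ 2 * dx1 phi x * (e ^+ 2 * dx1 phi x - e ^+ 2 * w1 x)) +
     1 * ((dx2 phi x - pulse x) * (dx2 phi x - pulse x - (w2 x - pulse x)))) =
   \int[mu]_(x in O1 `|` O3) (1 * ((e ^+ 2 * dx1 phi x) * (e ^+ 2 * dx1 psi x)) +
     1 * (dx2 phi x * dx2 psi x)).
  rewrite -[RHS]subr0 -(pulse_orthogonal tra trb) -RintegralB//.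
  by apply: eq_Rintegral => x _; rewrite psi1 psi2; ring.
have eqB : \int[mu]_(x in O2) (D * ((e * dx1 phi x - slope x) * (e * dx1 phi x - slope x - (e * w1 x - slope x))) +
     D^-1 * (e * dx2 phi x * (e * dx2 phi x - e * w2 x))) =
   \int[mu]_(x in O2) (D * ((e * dx1 phi x) * (e * dx1 psi x)) +
     D^-1 * ((e * dx2 phi x) * (e * dx2 psi x))).
  rewrite -[RHS]subr0 -[X in _ = _ - X](mulr0 (D * e)) -(slope_orthogonal tra trb).
  rewrite -RintegralZl// -RintegralB//; last exact: integrable_mulrl.
  by apply: eq_Rintegral => x _; rewrite psi1 psi2; ring.
by rewrite eqA eqB scaled_equation.
Qed.

End Minimisation.

(** The first term is the integral over the whole rectangle of the bound (5 e / h)^2 for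
    the horizontal derivative in the outer layers. *)
Definition error_mass : R := 25 * e ^+ 2 / h ^+ 2 * (L * l3) + stepmass bad.

Let items := full_item p (25 * e ^+ 2 / h ^+ 2) :: bad.

Lemma items_wf i : i \in items -> wellformed i.
Proof.
have [y1 y2 y3 y4 y5 y6 y7 y8] := ok; have L0 := length_gt0 adm.
rewrite inE => /predU1P[->|]; last exact: (bad_wf ok adm h_gt0).
split => /=; [|exact: ltW|lra].
by rewrite divr_ge0 ?sqr_ge0// mulr_ge0 ?sqr_ge0.
Qed.

Lemma items_mass : stepmass items = error_mass.
Proof. by rewrite /items stepmass_cons /area /= !subr0. Qed.

Lemma items_eval x : Omega_c p e x ->
  stepfun items x = 25 * e ^+ 2 / h ^+ 2 + stepfun bad x.
Proof.
move=> Ox; rewrite stepfun_cons indicE mem_set ?mulr1//.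
by have [v1 v2 v3 v4] := Omega_c_rect Ox; apply/rectP.
Qed.

Lemma int_items (A : set (R * R)) : measurable (A : set (plane R)) -> A `<=` Omega_c p e ->
  mu.-integrable A (EFin \o stepfun items) /\
  \int[mu]_(x in A) stepfun items x <= error_mass.
Proof.
move=> mA sub; rewrite -items_mass; apply: int_stepfun_le => //; last exact: items_wf.
exact: Omega_c_finite.
Qed.

Lemma pulse_O1 x : O1 x -> pulse x = \1_Ua x.
Proof.
have [y1 y2 y3 y4 y5 y6 y7 y8] := ok.
move=> /Omega_c1_cell[_ _ _ _ /andP[_ v]]; rewrite /pulse [X in _ + X]indicE memNset ?addr0//.
by move=> /Ub_sub/Omega_c3_cell[_ _ _ _ /andP[v' _]]; lra.
Qed.

Lemma pulse_O3 x : O3 x -> pulse x = \1_Ub x.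
Proof.
have [y1 y2 y3 y4 y5 y6 y7 y8] := ok.
move=> /Omega_c3_cell[_ _ _ _ /andP[v _]]; rewrite /pulse [X in X + _]indicE memNset ?add0r//.
by move=> /Ua_sub/Omega_c1_cell[_ _ _ _ /andP[_ v']]; lra.
Qed.

Local Notation D0 := ((l2 - l1) / (l2 - l1 - 2)).

Lemma full_ge0 : 0 <= 25 * e ^+ 2 / h ^+ 2.
Proof. by rewrite divr_ge0 ?sqr_ge0// mulr_ge0 ?sqr_ge0. Qed.

Lemma competitor_energy :
  energy mu (O1 `|` O3) 1 1 (fun x => e ^+ 2 * w1 x) (fun x => w2 x - pulse x) +
  energy mu O2 D D^-1 (fun x => e * w1 x - slope x) (fun x => e * w2 x) <=
  (1 + D0) * error_mass.
Proof.
have [D1 D2] := Dcoef_bounds.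
have D00 : 0 <= D0 by lra.
have mA := measurable_O13; have mB := measurable_O2.
have [_ c1 c2 _ _] := hasC1_comp ok adm h_gt0.
have Lc f A : measurable (A : set (plane R)) -> A `<=` Omega_c p e -> continuous f -> sqint mu A f.
  by move=> mAA sub cf; apply: (sqintS mO mAA sub (continuous_sqint mO (@Omega_c_box R p e) cf)).
have L1 := Lc _ _ mA O13_sub c1; have L2 := Lc _ _ mA O13_sub c2.
have L3 := Lc _ _ mB O2_sub c1; have L4 := Lc _ _ mB O2_sub c2.
have [iA mAle] := int_items mA O13_sub; have [iB mBle] := int_items mB O2_sub.
rewrite mulrDl mul1r; apply: lerD.
- apply: le_trans mAle; apply: le_Rintegral => //.
    by apply: energy_integrable => //; [exact: sqintZ|apply: sqintB => //; exact: sqint_pulse|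
      exact: sqintZ|apply: sqintB => //; exact: sqint_pulse].
  move=> x Ax; rewrite items_eval; last exact: O13_sub.
  rewrite !mul1r; apply: lerD; case: Ax => Ox.
  + by have [] := err_zone1 ok adm e_small gb h_gt0 hg Ox.
  + by have [] := err_zone3 ok adm e_small gb h_gt0 hg Ox.
  + by rewrite (pulse_O1 Ox); have [] := err_zone1 ok adm e_small gb h_gt0 hg Ox.
  + by rewrite (pulse_O3 Ox); have [] := err_zone3 ok adm e_small gb h_gt0 hg Ox.
- apply: (@le_trans _ _ (D0 * \int[mu]_(x in O2) stepfun items x)); last first.
    by rewrite ler_wpM2l.
  rewrite -RintegralZl//; apply: le_Rintegral => //.
  + by apply: energy_integrable => //; [apply: sqintB => //; [exact: sqintZ|exact: sqint_slope]|
      exact: sqintZ|apply: sqintB => //; [exact: sqintZ|exact: sqint_slope]|exact: sqintZ].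
  + exact: integrable_mulrl.
  + move=> x Ox; rewrite items_eval; last exact: O2_sub.
    have := err_zone2 ok adm e_small gb h_gt0 hg Ox.
    set a := (_ - slope x) ^+ 2; set b := (e * w2 x) ^+ 2 => ab.
    have a0 : 0 <= a by exact: sqr_ge0.
    have b0 : 0 <= b by exact: sqr_ge0.
    have Dp : 0 < D by lra.
    have Di : D^-1 <= D0 by apply: (@le_trans _ _ 1); [rewrite invf_le1|lra].
    have f0 := full_ge0.
    apply: (@le_trans _ _ (D0 * (a + b))).
      by rewrite mulrDr lerD// ler_wpM2r.
    by rewrite ler_wpM2l//; lra.
Qed.

Lemma competitor_psi : exists psi : H1 (Omega_c p e),
  [/\ trace_eq (Gamma_a p e) psi (cst 0), trace_eq (Gamma_b p e) psi (cst 0),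
      forall x, dx1 psi x = dx1 phi x - w1 x & forall x, dx2 psi x = dx2 phi x - w2 x].
Proof.
have C1 := hasC1_comp ok adm h_gt0.
have [p1 p2] := hasC1_partial C1; have [cc _ _ _ _] := C1.
have [psi [_ d1 d2 tr]] := H1B_C1 phi (@open_Omega_c R p e) (@Omega_c_box R p e) (hasC1_Ck C1).
have [ta tb _] := sol.
exists psi; split.
- apply: (tr _ _ ta) => x /Gamma_a_closure ax.
  exact: (closure_cst cc (comp_Omega_a ok adm e_small gb h_gt0 hg) ax).
- apply: (tr _ _ tb) => x /Gamma_b_closure bx.
  exact: (closure_cst cc (comp_Omega_b ok adm e_small gb h_gt0 hg) bx).
- by move=> x; rewrite d1 p1.
- by move=> x; rewrite d2 p2.
Qed.

Lemma solution_energy :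
  energy mu (O1 `|` O3) 1 1 (fun x => e ^+ 2 * dx1 phi x) (fun x => dx2 phi x - pulse x) +
  energy mu O2 D D^-1 (fun x => e * dx1 phi x - slope x) (fun x => e * dx2 phi x) <=
  (1 + D0) * error_mass.
Proof.
have [psi [ta tb d1 d2]] := competitor_psi.
by apply: le_trans competitor_energy; exact: (energy_minimal ta tb d1 d2).
Qed.

Lemma energy_ge0 (A : set (R * R)) (D1 D2 : R) f1 f2 : 0 <= D1 -> 0 <= D2 ->
  0 <= energy mu A D1 D2 f1 f2.
Proof.
by move=> ? ?; apply: Rintegral_ge0 => x _; rewrite addr_ge0// mulr_ge0// sqr_ge0.
Qed.

Lemma zone13_energy :
  energy mu (O1 `|` O3) 1 1 (fun x => e ^+ 2 * dx1 phi x) (fun x => dx2 phi x - pulse x)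
    <= (1 + D0) * error_mass.
Proof.
have [D1 _] := Dcoef_bounds.
apply: le_trans solution_energy; rewrite lerDl energy_ge0//; first lra.
by rewrite invr_ge0; lra.
Qed.

Lemma zone2_energy :
  energy mu O2 D D^-1 (fun x => e * dx1 phi x - slope x) (fun x => e * dx2 phi x)
    <= (1 + D0) * error_mass.
Proof. by apply: le_trans solution_energy; rewrite lerDr energy_ge0. Qed.

Lemma sub_zone_energy (A U : set (R * R)) : measurable (A : set (plane R)) ->
  A `<=` O1 `|` O3 -> (forall x, A x -> pulse x = \1_U x) ->
  (\int[mu]_(x in A) (`|e ^+ 2 * dx1 phi x| ^+ 2 + `|dx2 phi x - \1_U x| ^+ 2)%:E <=
   ((1 + D0) * error_mass)%:E)%E.
Proof.
move=> mA sub pU; have mAA := measurable_O13.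
have d1 : sqint mu (O1 `|` O3) (dx1 phi) := sqintS mO mAA O13_sub (dx1_L2 phi).
have d2 : sqint mu (O1 `|` O3) (dx2 phi) := sqintS mO mAA O13_sub (dx2_L2 phi).
have L1 := sqintZ (e ^+ 2) mAA d1.
have L2 : sqint mu (O1 `|` O3) (fun x => dx2 phi x - pulse x).
  by apply: sqintB => //; exact: sqint_pulse.
have I : mu.-integrable (O1 `|` O3) (EFin \o
    (fun x => 1 * (e ^+ 2 * dx1 phi x) ^+ 2 + 1 * (dx2 phi x - pulse x) ^+ 2)).
  by have := energy_integrable 1 1 mAA L1 L2 L1 L2.
apply: (@le_trans _ _ (\int[mu]_(x in O1 `|` O3)
    (1 * (e ^+ 2 * dx1 phi x) ^+ 2 + 1 * (dx2 phi x - pulse x) ^+ 2)%:E)%E); last first.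
  have := zone13_energy; rewrite /energy /Rintegral -lee_fin fineK//.
  exact: (integrable_fin_num _ I).
rewrite (_ : (\int[mu]_(x in A) _)%E = (\int[mu]_(x in A)
    (1 * (e ^+ 2 * dx1 phi x) ^+ 2 + 1 * (dx2 phi x - pulse x) ^+ 2)%:E)%E); last first.
  apply: eq_integral => x /set_mem Ax.
  by rewrite (pU _ Ax) !real_normK ?num_real// !mul1r.
apply: ge0_subset_integral => //; first by case/integrableP: I.
by move=> x _; rewrite lee_fin !mul1r addr_ge0// sqr_ge0.
Qed.

Lemma zone1_bound :
  (\int[lebesgue2]_(x in O1) (`|e ^+ 2 * dx1 phi x| ^+ 2 +
      `|dx2 phi x - periodic_ext (fun y => partial2 (fun z => phi1 p z y) x) (x.1 / e)| ^+ 2)%:E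
   <= ((1 + D0) * error_mass)%:E)%E.
Proof.
have := sub_zone_energy measurable_O1 (@subsetUl _ _ _) pulse_O1.
apply: le_trans; rewrite le_eqVlt; apply/orP; left; apply/eqP.
by apply: eq_integral => x /set_mem Ox; rewrite (target_zone1 ok adm Ox).
Qed.

Lemma zone3_bound :
  (\int[lebesgue2]_(x in O3) (`|e ^+ 2 * dx1 phi x| ^+ 2 +
      `|dx2 phi x - periodic_ext (fun y => partial2 (fun z => phi3 p z y) x) (x.1 / e)| ^+ 2)%:E
   <= ((1 + D0) * error_mass)%:E)%E.
Proof.
have := sub_zone_energy measurable_O3 (@subsetUr _ _ _) pulse_O3.
apply: le_trans; rewrite le_eqVlt; apply/orP; left; apply/eqP.
by apply: eq_integral => x /set_mem Ox; rewrite (target_zone3 ok adm Ox).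
Qed.

(** On the middle zone the derivative of phi2 at the phase of x1 only takes the two
    slopes; the indicator of [wide_gap] selects between them, which gives a function
    that is measurable on the whole plane. *)
Definition wide_gap := crects e n z2 z3 0 l3.
Definition target2 (x : R * R) : R :=
  slope_ba p + (slope_ab p - slope_ba p) * \1_wide_gap x.

Lemma target2E x : O2 x -> periodic_ext (phi2 p)^`()%classic (x.1 / e) = target2 x.
Proof.
have [y1 y2 y3 y4 y5 y6 y7 y8] := ok.
move=> Ox; have [k [[v1 v2 v3 v4] _ kn cases ->]] := Omega_c2_cell ok adm Ox.
have [u0 u1] : 0 <= x.1 / e - k%:R /\ x.1 / e - k%:R < 1.
  by case: cases => /andP[v w]; split; lra.
have [z2_ge0 z3_le1] : 0 <= z2 /\ z3 <= 1 by split; lra.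
have inW := in_crects adm n 0 l3 z2_ge0 z3_le1 u0 u1.
rewrite (target_slope ok cases) /target2 indicE.
have -> : (x \in wide_gap) = (z2 < x.1 / e - k%:R < z3).
  apply/idP/andP => [/set_mem/inW[]//|[w1' w2']].
  by apply: mem_set; apply/inW.
by case: ifP => _ /=; ring.
Qed.

(** The field [gap_slope] is replaced by the derivative of phi2 at the cost of
    (q - t)^2 <= 2 (q - s)^2 + 2 (t - s)^2; the factor 2 + D0 absorbs the weights D >= 1
    and 1/D >= 1/D0 of the energy. *)
Lemma zone2_bound :
  (\int[lebesgue2]_(x in O2) (`|e * dx1 phi x -
        periodic_ext (phi2 p)^`()%classic (x.1 / e)| ^+ 2 + `|e * dx2 phi x| ^+ 2)%:E
   <= (((2 + D0) * (1 + D0) + 2) * error_mass)%:E)%E.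
Proof.
have [D1 D2] := Dcoef_bounds.
have mB := measurable_O2.
have d1 : sqint mu O2 (dx1 phi) := sqintS mO mB O2_sub (dx1_L2 phi).
have d2 : sqint mu O2 (dx2 phi) := sqintS mO mB O2_sub (dx2_L2 phi).
have Lt : sqint mu O2 target2.
  apply: sqintD => //; first by apply: (@bounded_sqint _ _ _ _ _ _ `|slope_ba p|) => //;
    exact: Omega_c_finite O2_sub.
  by apply: sqintZ => //; apply: sqint_indic => //; [exact: O2_sub|exact: measurable_crects].
have L1 : sqint mu O2 (fun x => e * dx1 phi x - slope x).
  by apply: sqintB => //; [exact: sqintZ|exact: sqint_slope].
have L2 : sqint mu O2 (fun x => e * dx2 phi x) by exact: sqintZ.
have L3 : sqint mu O2 (fun x => e * dx1 phi x - target2 x).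
  by apply: sqintB => //; exact: sqintZ.
have I12 := energy_integrable D D^-1 mB L1 L2 L1 L2.
have I32 := energy_integrable 1 1 mB L3 L2 L3 L2.
have [iB mBle] := int_items mB O2_sub.
rewrite (_ : (\int[lebesgue2]_(x in O2) _)%E = (\int[mu]_(x in O2)
   (1 * ((e * dx1 phi x - target2 x) * (e * dx1 phi x - target2 x)) +
    1 * ((e * dx2 phi x) * (e * dx2 phi x)))%:E)%E); last first.
  apply: eq_integral => x /set_mem Ox.
  by rewrite (target2E Ox) !real_normK ?num_real// !mul1r !expr2.
rewrite -[leLHS]fineK; last exact: (integrable_fin_num _ I32).
rewrite lee_fin; apply: (@le_trans _ _ (\int[mu]_(x in O2)
  ((2 + D0) * (D * ((e * dx1 phi x - slope x) * (e * dx1 phi x - slope x)) +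
    D^-1 * ((e * dx2 phi x) * (e * dx2 phi x))) + 2 * stepfun items x))).
  apply: le_Rintegral => //.
    by apply: integrable_addr => //; exact: integrable_mulrl.
  move=> x Ox; rewrite items_eval; last exact: O2_sub.
  have := target_zone2 ok adm gb h_gt0 hg Ox; rewrite (target2E Ox).
  have f0 := full_ge0.
  set s := slope x; set t := target2 x; set q := e * dx1 phi x; set r := e * dx2 phi x => ts.
  have Dp : 0 < D by lra.
  have k1 : 1 <= (2 + D0) * D^-1.
    by rewrite ler_pdivlMr// mul1r; lra.
  have k2 : 2 <= (2 + D0) * D by nra.
  have k3 := sqr_ge0 r; have k4 := sqr_ge0 (q - s).
  have m1 : r ^+ 2 <= (2 + D0) * D^-1 * r ^+ 2 by rewrite ler_peMl.
  have m2 : 2 * (q - s) ^+ 2 <= (2 + D0) * D * (q - s) ^+ 2 by rewrite ler_wpM2r.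
  have m3 : (q - t) ^+ 2 <= 2 * (q - s) ^+ 2 + 2 * (t - s) ^+ 2.
    by have := sqr_ge0 (q - s + (t - s)); lra.
  have -> : 1 * ((q - t) * (q - t)) + 1 * (r * r) = (q - t) ^+ 2 + r ^+ 2 by ring.
  have -> : (2 + D0) * (D * ((q - s) * (q - s)) + D^-1 * (r * r)) =
    (2 + D0) * D * (q - s) ^+ 2 + (2 + D0) * D^-1 * r ^+ 2 by ring.
  by clear k1 k2 k3 k4; lra.
rewrite RintegralD//; [|exact: integrable_mulrl|exact: integrable_mulrl].
rewrite RintegralZl// RintegralZl// [leRHS]mulrDl -mulrA; apply: lerD.
  rewrite ler_wpM2l//; first lra.
  apply: le_trans zone2_energy; rewrite le_eqVlt; apply/orP; left; apply/eqP.
  by apply: eq_Rintegral => x _; rewrite !expr2.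
by rewrite ler_wpM2l.
Qed.

End MainEstimate.

(** * Smallness of the error *)

Section Smallness.
Context {R : realType}.
Variable p : comb_params R.
Hypothesis ok : comb_ordered p.
Hypothesis L_gt0 : 0 < L p.

Definition comb_gap : R :=
  Num.min (Num.min (1 / 2) (zeta1 p)) (Num.min (1 - zeta4 p) (zeta3 p - zeta2 p)).

Lemma comb_gap_bound : gap_bound p comb_gap.
Proof.
have [y1 y2 y3 y4 y5 y6 y7 y8] := ok; rewrite /comb_gap; split.
- rewrite !lt_min; apply/andP; split; apply/andP; split; lra.
- by rewrite !ge_min lexx.
- by rewrite !ge_min lexx !orbT.
- by rewrite !ge_min lexx !orbT.
- by rewrite !ge_min lexx !orbT.
Qed.

(** For e < 1 and h <= 1, each of e^2 / h^2, e, e / h^2 and h is at most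
    h + e / h^2. *)
Lemma error_mass_le (n : nat) (e g h : R) :
  [/\ (0 < n)%N, 0 < e & L p = e * n%:R] -> e < 1 -> 0 < g -> 0 < h -> h <= 1 ->
  error_mass p n e g h <=
  (25 * (L p * l3 p) + 36 / g ^+ 2 * (16 * L p * l3 p + 2 * l3 p + 16 * L p) + 2400 * L p)
  * (h + e / h ^+ 2).
Proof.
move=> adm e1 g0 h0 h1; have [y1 y2 y3 y4 y5 y6 y7 y8] := ok.
have [n0 e0 _] := adm; have L0 := L_gt0.
rewrite /error_mass (stepmass_bad adm).
set G := 36 / g ^+ 2; have G0 : 0 < G by rewrite divr_gt0// exprn_gt0.
set v := h ^- 2; have v0 : 0 < v by rewrite invr_gt0 exprn_gt0.
have v1 : 1 <= v by rewrite -[1]invr1 lef_pV2 ?posrE ?exprn_gt0// expr_le1// ltW.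
have l30 : 0 < l3 p by lra.
have Ll : 0 < L p * l3 p by exact: mulr_gt0.
have ev0 : 0 < e * v by exact: mulr_gt0.
have a1 : e ^+ 2 * v <= h + e * v.
  by rewrite expr2 -mulrA; apply: (@le_trans _ _ (e * v)); [rewrite ler_piMl// ltW|lra].
have a2 : e <= h + e * v.
  by apply: (@le_trans _ _ (e * v)); [rewrite ler_peMr// ltW|lra].
have a3 : e * v <= h + e * v by lra.
have a4 : h <= h + e * v by rewrite lerDl mulr_ge0 ?ltW.
set S := h + e * v in a1 a2 a3 a4 *.
have b1 : 25 * e ^+ 2 * v * (L p * l3 p) <= 25 * (L p * l3 p) * S.
  rewrite (_ : 25 * e ^+ 2 * v * _ = 25 * (L p * l3 p) * (e ^+ 2 * v)); last by ring.
  by rewrite ler_wpM2l// mulr_ge0// ltW.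
have b2 : G * (16 * L p * l3 p * h + 2 * e * l3 p + 16 * L p * h) <=
    G * (16 * L p * l3 p + 2 * l3 p + 16 * L p) * S.
  rewrite -[leRHS]mulrA ler_wpM2l ?(ltW G0)//.
  have c1 : L p * l3 p * h <= L p * l3 p * S by rewrite ler_pM2l.
  have c2 : l3 p * e <= l3 p * S by rewrite ler_pM2l.
  have c3 : L p * h <= L p * S by rewrite ler_pM2l.
  by clear b1; lra.
have b3 : 400 * v * (6 * L p * e) <= 2400 * L p * S.
  have c1 : L p * (e * v) <= L p * S by rewrite ler_pM2l.
  by clear b1 b2; lra.
rewrite addrA [leRHS]mulrDl [X in _ <= X + _]mulrDl.
exact: lerD (lerD b1 b2) b3.
Qed.

(** The scale h depends only on the threshold; e / h^2 is small once e is small with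
    respect to this fixed h. *)
Lemma small_error_mass (K th : R) : 0 <= K -> 0 < th -> exists h e0 : R,
  [/\ 0 < h, h <= comb_gap, 0 < e0 &
    forall n e, [/\ (0 < n)%N, 0 < e & L p = e * n%:R] -> e < 1 -> e < e0 ->
      2 * e <= l2 p - l1 p - 2 /\ K * error_mass p n e comb_gap h <= th].
Proof.
move=> K0 th0; have [y1 y2 y3 y4 y5 y6 y7 y8] := ok; have L0 := L_gt0.
have gb := comb_gap_bound; have [g0 g1 _ _ _] := gb.
set C := 25 * (L p * l3 p) +
  36 / comb_gap ^+ 2 * (16 * L p * l3 p + 2 * l3 p + 16 * L p) + 2400 * L p.
have l30 : 0 < l3 p by lra.
have C0 : 0 < C.
  have Ll : 0 < L p * l3 p by exact: mulr_gt0.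
  have G0 : 0 < 36 / comb_gap ^+ 2 by rewrite divr_gt0// exprn_gt0.
  have A0 : 0 < 16 * L p * l3 p + 2 * l3 p + 16 * L p by lra.
  by have := mulr_gt0 G0 A0; rewrite /C; lra.
pose M := 2 * (K * C + 1).
have KC : 0 <= K * C by rewrite mulr_ge0// ltW.
have M0 : 0 < M by rewrite /M; lra.
pose h := Num.min comb_gap (th / M).
have h0 : 0 < h by rewrite lt_min g0 divr_gt0.
have hg : h <= comb_gap by rewrite ge_min lexx.
have hth : h <= th / M by rewrite ge_min lexx orbT.
pose e0 := Num.min ((l2 p - l1 p - 2) / 2) (th / M * h ^+ 2).
have h20 : 0 < h ^+ 2 by rewrite exprn_gt0.
exists h, e0; split => //.
  by rewrite lt_min; apply/andP; split; [lra|rewrite mulr_gt0// divr_gt0].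
move=> n e adm e1; rewrite lt_min => /andP[e2 e3]; split; first lra.
have h1 : h <= 1 by lra.
have e4 : e / h ^+ 2 <= th / M by rewrite ler_pdivrMr// ltW.
have := error_mass_le adm e1 g0 h0 h1; rewrite -/C => le.
apply: (@le_trans _ _ (K * (C * (2 * (th / M))))).
  rewrite ler_wpM2l//; apply: (le_trans le); rewrite ler_wpM2l ?(ltW C0)//.
  by rewrite [leRHS]mulr_natl mulr2n lerD.
rewrite (_ : K * _ = K * C * 2 / M * th); last by ring.
rewrite ler_piMl ?(ltW th0)// ler_pdivrMr// mul1r /M; lra.
Qed.

End Smallness.

Lemma cvge0_within (R : realType) (W : set R) (F : R -> \bar R) :
  (forall th : R, 0 < th -> exists2 e0 : R, 0 < e0 &
     forall e, W e -> `|e| < e0 -> (0 <= F e <= th%:E)%E) ->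
  F e @[e --> within W 0^'] --> 0%E.
Proof.
move=> small A /= [r /= r0 rA].
have [e0 e00 Fe] := small (r / 2) (divr_gt0 r0 (ltr0n _ 2)).
have near0 : \forall e \near (0 : R)^', `|e| < e0 by exact: dnbhs0_lt.
apply: filterS near0 => e ee We.
rewrite /=; move: (Fe e We ee); case: (F e) => [y| |]; rewrite ?leye_eq ?andbF ?lee_fin //.
move=> /andP[y0 y1]; apply: rA; rewrite /ball /= sub0r normrN ger0_norm//; lra.
Qed.

Theorem proposition6p7 (R : realType) (p : comb_params R)
  (zeta1_gt0 : 0 < zeta1 p) (zeta12 : zeta1 p < zeta2 p)
  (zeta23 : zeta2 p < zeta3 p) (zeta34 : zeta3 p < zeta4 p)
  (zeta4_lt1 : zeta4 p < 1)
  (L_gt0 : 0 < L p)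
  (l1_gt0 : 0 < l1 p) (l2_gt0 : 0 < l2 p) (l3_gt0 : 0 < l3 p)
  (l12 : l1 p + 2 < l2 p) (l23 : l2 p < l3 p)
  (phi : forall e : R, H1 (Omega_c p e))
  (phi_sol : forall e : R, admissible p e -> solution 2 (phi e)) :
  [/\ (\int[lebesgue2]_(x in Omega_c1 p e)
         (`|e ^+ 2 * dx1 (phi e) x| ^+ 2 +
          `|dx2 (phi e) x -
            periodic_ext (fun y => partial2 (fun z => phi1 p z y) x)
              (x.1 / e)| ^+ 2)%:E)%E
        @[e --> within (admissible p) 0^'] --> 0%E,
      (\int[lebesgue2]_(x in Omega_c3 p e)
         (`|e ^+ 2 * dx1 (phi e) x| ^+ 2 +
          `|dx2 (phi e) x -
            periodic_ext (fun y => partial2 (fun z => phi3 p z y) x)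
              (x.1 / e)| ^+ 2)%:E)%E
        @[e --> within (admissible p) 0^'] --> 0%E &
      (\int[lebesgue2]_(x in Omega_c2 p e)
         (`|e * dx1 (phi e) x - periodic_ext (phi2 p)^`()%classic (x.1 / e)| ^+ 2 +
          `|e * dx2 (phi e) x| ^+ 2)%:E)%E
        @[e --> within (admissible p) 0^'] --> 0%E].
Proof.
have ok : comb_ordered p by split.
have gb := comb_gap_bound ok.
pose D0 := (l2 p - l1 p) / (l2 p - l1 p - 2).
have D00 : 0 <= D0 by rewrite divr_ge0//; lra.
have admE e : admissible p e -> exists n : nat,
    [/\ (0 < n)%N, 0 < e & L p = e * n%:R] /\ e < 1.
  move=> [[n n0 ->] e1]; have n0' : 0 < n%:R :> R by rewrite ltr0n.
  by exists n; split => //; split => //; [rewrite divr_gt0|rewrite divfK ?gt_eqF].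
have main (K : R) (F : R -> \bar R) : 0 <= K -> (forall e, (0 <= F e)%E) ->
    (forall (n : nat) (e h : R), admissible p e -> [/\ (0 < n)%N, 0 < e & L p = e * n%:R] -> e < 1 ->
       2 * e <= l2 p - l1 p - 2 -> 0 < h -> h <= comb_gap p ->
       (F e <= (K * error_mass p n e (comb_gap p) h)%:E)%E) ->
    F e @[e --> within (admissible p) 0^'] --> 0%E.
  move=> K0 F0 Fle; apply: cvge0_within => th th0.
  have [h [e0 [h0 hg e00 small]]] := small_error_mass ok L_gt0 K0 th0.
  exists e0 => // e We; have [n [adm e1]] := admE e We.
  have [_ egt0 _] := adm; rewrite gtr0_norm// => ee.
  have [es me] := small n e adm e1 ee; rewrite F0 /=.
  by apply: (le_trans (Fle n e h We adm e1 es h0 hg)); rewrite lee_fin.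
split.
- apply: (main (1 + D0)); first lra.
    by move=> e; apply: integral_ge0 => x _; rewrite lee_fin addr_ge0 ?sqr_ge0.
  move=> n e h We adm e1 es h0 hg.
  exact: (zone1_bound ok adm es gb h0 hg e1 (phi_sol e We)).
- apply: (main (1 + D0)); first lra.
    by move=> e; apply: integral_ge0 => x _; rewrite lee_fin addr_ge0 ?sqr_ge0.
  move=> n e h We adm e1 es h0 hg.
  exact: (zone3_bound ok adm es gb h0 hg e1 (phi_sol e We)).
- apply: (main ((2 + D0) * (1 + D0) + 2)).
    by rewrite addr_ge0// mulr_ge0//; lra.
    by move=> e; apply: integral_ge0 => x _; rewrite lee_fin addr_ge0 ?sqr_ge0.
  move=> n e h We adm e1 es h0 hg.
  exact: (zone2_bound ok adm es gb h0 hg e1 (phi_sol e We)).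
Qed.
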